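(* Let $\alpha\in(1,2)$ and let $\lambda>0$ be the rate of the Poisson arrival times $(T_j)_{j\ge 1}$. Let $R_j(T_j)$, $j\ge1$, be noises that are conditionally independent given the arrival times, the conditional law of $R_j(T_j)$ given $T_j=u$ being $F_u$, with conditional moments $K_r(u)=\int_{\mathbb{R}}x^r\,dF_u(x)$ finite for $r=1,2,3,4$ and $K_1(u)=0$ for every $u>0$. Suppose that $K_2(\cdot)$ and $K_4(\cdot)$ are positive, uniformly bounded functions such that $\lim_{t\to\infty}K_2(t)=K$ for some $K>0$, and that there is $\kappa>0$ with $K_4(u)/K_2(u)\le\kappa$ for every $u>0$. Put $K_{\alpha,\lambda}:=K\lambda\Gamma(\alpha)$ and, for $c>0$, define the process $\hat S_{\alpha,c}=\{\hat S_{\alpha,c}(t)\}_{t\ge0}$ by $$\hat S_{\alpha,c}(t):=\frac{1}{\sqrt{cK_{\alpha,\lambda}}}\sum_{j=1}^{+\infty}\bigl(\log(ct)-\log(T_j)\bigr)_+^{\frac{\alpha-1}{2}}R_j(T_j),\qquad t\ge0.$$ Then, as $c\to+\infty$, $\hat S_{\alpha,c}$ converges in the sense of finite-dimensional distributions to the Hadamard fractional Brownian motion $B^H_\alpha=\{B^H_\alpha(t)\}_{t\ge0}$.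
   Context: Shot-noise setting. $(T_j)_{j\ge1}$ are the successive arrival times of a homogeneous Poisson process on $(0,\infty)$ with rate $\lambda>0$. $\{F_u\}_{u>0}$ is a (measurable) family of probability distribution functions on $\mathbb{R}$. Given $(T_j)_{j\ge1}$, the random variables $R_j(T_j)$ are independent, with $P(R_j\le x\mid T_j=u)=F_u(x)$ for all $j$. Equivalently, the points $(T_j,R_j(T_j))$ form a Poisson random measure on $(0,\infty)\times\mathbb{R}$ with intensity $\lambda F_u(dr)\,du$. Conventions. $x_+=\max(x,0)$, and $(\log(ct)-\log T_j)_+^{(\alpha-1)/2}$ means $\bigl((\log(ct)-\log T_j)_+\bigr)^{(\alpha-1)/2}$; it is $0$ when $T_j\ge ct$ (in particular for $t=0$), so only finitely many terms of the sum are nonzero almost surely. Tricomi's confluent hypergeometric function: for non-integer $b$ and $z>0$, $$\Psi(a,b;z)=\frac{\Gamma(1-b)}{\Gamma(1+a-b)}\Phi(a,b;z)+\frac{\Gamma(b-1)}{\Gamma(a)}z^{1-b}\Phi(1+a-b,2-b;z),$$ where $\Phi(a,b;z)=\sum_{l\ge0}\frac{(a)_l}{(b)_l}\frac{z^l}{l!}$ and $(x)_l=\Gamma(x+l)/\Gamma(x)$. Hadamard fractional Brownian motion $B^H_\alpha$, $\alpha\in(1,2)$: the centered Gaussian process on $[0,\infty)$ with $B^H_\alpha(0)=0$, $\mathbb{E}[B^H_\alpha(t)^2]=t$, and, for $s,t>0$, $s\ne t$, $$\mathbb{E}[B^H_\alpha(s)B^H_\alpha(t)]=C_\alpha\,(s\wedge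 t)\,\Psi\!\left(\tfrac{1-\alpha}{2},1-\alpha;\log\tfrac{s\vee t}{s\wedge t}\right),\qquad C_\alpha=\frac{2^{1-\alpha}\sqrt{\pi}}{\Gamma(\alpha/2)}.$$ *)

(* Defs.v *)
From HB Require Import structures.
From mathcomp Require Import all_boot all_order all_algebra.
From mathcomp Require Import all_classical all_reals all_analysis.

Set Implicit Arguments.
Unset Strict Implicit.
Unset Printing Implicit Defensive.

Import Order.TTheory GRing.Theory Num.Theory.
Import numFieldNormedType.Exports.

Local Open Scope classical_set_scope.
Local Open Scope ring_scope.

Section special_functions.
Context {R : realType}.
Implicit Types a b x z : R.

Definition Euler_integral x : R :=
  \int[lebesgue_measure]_(t in `]0, +oo[) (t `^ (x - 1) * expR (- t)).

(* For [x < 0] not an integer, [n] is the least natural number with [0 < x + n],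
   and the Euler integral is continued by Gamma(y) = Gamma(y + 1) / y; for
   [0 < x], [n = 0]. The values at the poles 0, -1, -2, ... are meaningless. *)
Definition Gamma x : R :=
  let n := absz (Num.floor (Num.min x 0)) in
  Euler_integral (x + n%:R) / \prod_(i < n) (x + i%:R).

Definition Pochhammer x (l : nat) : R := Gamma (x + l%:R) / Gamma x.

Definition Kummer_Phi a b z : R :=
  limn (series (fun l : nat =>
    Pochhammer a l / Pochhammer b l * (z ^+ l / l`!%:R))).

(* Meaningful for [b] not an integer and [0 < z]. *)
Definition Tricomi_Psi a b z : R :=
  Gamma (1 - b) / Gamma (1 + a - b) * Kummer_Phi a b z +
  Gamma (b - 1) / Gamma a * z `^ (1 - b) * Kummer_Phi (1 + a - b) (2 - b) z.

End special_functions.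

Section probability.
Context {R : realType} {d : measure_display} {Omega : measurableType d}.
Variable P : probability Omega R.

Definition mutually_independent (X : nat -> Omega -> R) :=
  forall (s : seq nat) (A : nat -> set R),
    uniq s -> (forall j, measurable (A j)) ->
    P (\bigcap_(j in [set` s]) (X j @^-1` A j)) =
    (\prod_(j <- s) P (X j @^-1` A j))%E.

Definition generated_sigma_algebra (X : nat -> Omega -> R) : set (set Omega) :=
  <<s \bigcup_j preimage_set_system setT (X j) measurable >>.

(* [Z] is a version of the conditional probability of [E] given the
   sigma-algebra [G]. *)
Definition is_cond_probability (G : set (set Omega)) (E : set Omega)
    (Z : Omega -> R) :=
  (forall A : set R, measurable A -> G (Z @^-1` A)) /\
  (forall B, G B -> (\int[P]_(w in B) (Z w)%:E)%E = P (E `&` B)).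

(* The arrival times are indexed from 0: [T 0] is the first one. *)
Definition interarrival (T : nat -> Omega -> R) (j : nat) (w : Omega) : R :=
  if j is i.+1 then T j w - T i w else T j w.

Definition Poisson_arrival_times (lambda : R) (T : nat -> {RV P >-> R}) :=
  mutually_independent (interarrival T) /\
  (forall j (A : set R), measurable A ->
    P (interarrival T j @^-1` A) = exponential_prob lambda A).

(* Given the whole sequence [T], the [X j] are independent with laws
   [F (T j)]. *)
Definition conditionally_independent_noises (T X : nat -> {RV P >-> R})
    (F : R.-pker R ~> R) :=
  forall (s : seq nat) (A : nat -> set R),
    uniq s -> (forall j, measurable (A j)) ->
    is_cond_probability (generated_sigma_algebra T)
      (\bigcap_(j in [set` s]) (X j @^-1` A j))
      (fun w => \prod_(j <- s) fine (F (T j w) (A j))).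

(* [normal_prob m 0] is not the Dirac mass in the library, so degenerate
   Gaussian laws are treated apart. *)
Definition Gaussian_law (Y : Omega -> R) :=
  exists m s : R, 0 <= s /\
    forall A : set R, measurable A ->
      P (Y @^-1` A) = if s == 0 then \d_m A else normal_prob m s A.

Definition Gaussian_process (B : R -> {RV P >-> R}) :=
  forall (n : nat) (t a : 'I_n -> R), (forall i, 0 <= t i) ->
    Gaussian_law (fun w => \sum_(i < n) a i * B (t i) w).

Definition C_coef (alpha : R) : R :=
  2 `^ (1 - alpha) * Num.sqrt pi / Gamma (alpha / 2).

(* Processes on [0, +oo) are given as families over [R] of which only the
   members of nonnegative index matter. *)
Definition Hadamard_fBm (alpha : R) (B : R -> {RV P >-> R}) :=
  [/\ Gaussian_process B,
      forall t : R, 0 <= t -> ('E_P[B t] = 0)%E,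
      {ae P, forall w, B 0 w = 0},
      forall t : R, 0 <= t -> ('E_P[fun w => (B t w ^+ 2)%R] = t%:E)%E &
      forall s t : R, 0 < s -> 0 < t -> s != t ->
        ('E_P[fun w => (B s w * B t w)%R] =
          (C_coef alpha * Num.min s t *
            Tricomi_Psi ((1 - alpha) / 2) (1 - alpha)
              (ln (Num.max s t / Num.min s t)))%:E)%E].

(* (log x - log y)_+, with log x = -oo for [x <= 0] (whereas [ln 0 = 0]). *)
Definition log_excess (x y : R) : R :=
  if 0 < x then Num.max (ln x - ln y) 0 else 0.

Definition shot_noise (alpha lambda K : R) (T X : nat -> Omega -> R)
    (c t : R) (w : Omega) : R :=
  (Num.sqrt (c * (K * lambda * Gamma alpha)))^-1 *
  limn (series (fun j : nat =>
    log_excess (c * t) (T j w) `^ ((alpha - 1) / 2) * X j w)).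

End probability.

Section moments.
Context {R : realType}.

Definition noise_moment (F : R.-pker R ~> R) (r : nat) (u : R) : R :=
  \int[F u]_x (x ^+ r).

End moments.

(* Convergence as [c] tends to +oo of the finite-dimensional distributions of
   the processes [S c] on [0, +oo) to those of [B]. *)
Definition cvg_fdd (R : realType) (d d' : measure_display)
    (Omega : measurableType d) (Omega' : measurableType d')
    (P : probability Omega R) (P' : probability Omega' R)
    (S : R -> R -> Omega -> R) (B : R -> Omega' -> R) :=
  forall (n : nat) (t : 'I_n -> R), (forall i, 0 <= t i) ->
  forall f : 'rV[R]_n -> R, continuous f -> (exists M : R, forall v, `|f v| <= M) ->
    ('E_P[fun w => f (\row_i S c (t i) w)])%E @[c --> +oo] -->
    ('E_P'[fun w => f (\row_i B (t i) w)])%E.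

(* Main.v *)
(** By the trigonometric form of the Cramer-Wold device, it suffices to show that
    [E cos (Y_c + phi)] converges to [cos phi * exp (- v / 2)] for every linear
    combination [Y_c] of values of the shot noise, with [v] the variance of the
    same combination of values of the limit, and that second moments stay
    bounded. Write [Y_c = sum_j y_c(T_j) R_j]. Given the arrival times, replacing
    the noises one at a time (Lindeberg) turns [E cos (Y_c + phi)] into
    [cos phi * E exp (- sum_j y_c(T_j)^2 K_2(T_j) / 2)], up to an error controlled
    by [int y_c^4 = O(1 / c)]. The Laplace functional of the Poisson process,
    obtained from a martingale along the arrivals, equals
    [exp (- lambda * int (1 - exp (- y_c^2 K_2 / 2)))], and its exponent tends to
    [- v / 2] because [int y_c^2] does not depend on [c] and [K_2] tends to [K].

    For the variance, substituting [u = s e^(-x)] in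
    [int (log s - log u)_+^m (log t - log u)_+^m du], [m = (alpha - 1) / 2], gives
    [s * int x^m (x + z)^m e^(-x) dx] with [z = log (t / s)]. This integral and
    the given covariance solve the same Kummer equation; neither grows like
    [e^z], which leaves one dimension of solutions, and the values at [z = 0]
    agree by the duplication formula for Gamma. *)

From HB Require Import structures.
From mathcomp Require Import all_boot all_order all_algebra.
From mathcomp Require Import all_classical all_reals all_analysis.
From mathcomp Require Import measurable_realfun.
From mathcomp Require Import ring lra.
Require Import Defs.

Set Implicit Arguments.
Unset Strict Implicit.
Unset Printing Implicit Defensive.

Import Order.TTheory GRing.Theory Num.Theory.
Import numFieldNormedType.Exports.

Local Open Scope classical_set_scope.
Local Open Scope ring_scope.

(** * Conditional laws *)

(** The hypotheses give laws on finite families of events, while each Lindeberg replacement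
    integrates a function of the past and of one fresh variable. The past is therefore made a
    measurable type of its own, the sample space with a smaller sigma-algebra, and
    [conditional_law_integral] turns identities on a pi-system into a kernel formula for nonnegative
    functions. This is why 1 is added to the cosines: no integrability has to be carried through the
    conditioning. The phases are restricted to [0 <= cos phi] for the same reason; 0 and -pi/2
    generate all the others.

    Only the second and fourth powers of the kernel are controlled, so the cubic Taylor term is
    split between them with a parameter [e]: the quadratic share does not decrease with [c] and is
    made small by [e], the quartic share is then made small by [c]. Trigonometric tests reach
    bounded continuous functions through Bernstein polynomials in [(1 + sin (v_i / L)) / 2]; the
    error outside the box is quadratic, so bounded second moments stand in for tightness. *)

Definition image_measure d d' (X : measurableType d) (Y : measurableType d')
    (R : realType) (m : {measure set X -> \bar R}) (f : X -> Y)
    (mf : measurable_fun setT f) : {measure set Y -> \bar R} :=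
  measure_function_pushforward__canonical__measure_function_Measure m mf.

Section conditional_law.
Context d d' (Omega : measurableType d) (E : measurableType d') (R : realType).
Variable P : probability Omega R.
Variable k : R.-pker E ~> R.
Local Open Scope ereal_scope.

Let measurable_graph (w : E) :
  measurable_fun setT ((fun y => (w, y)) : R -> E * R).
Proof. exact: pair1_measurable. Qed.

(** The law of [(w, y)] when [y] is drawn from [k w]. The dummy factor [unit] makes the law of [W] a
    kernel too, so that the candidate joint law is a composition [kcomp] and inherits its integral
    formula. *)
Let graph_law (z : unit * E) : {measure set (E * R) -> \bar R} :=
  image_measure (k z.2) (measurable_graph z.2).

Let measurable_graph_law U : measurable U ->
  measurable_fun [set: unit * E] (graph_law ^~ U : _ -> \bar R).
Proof.
move=> mU.
rewrite (_ : graph_law ^~ U = (fun z => k z.2 (xsection U z.2))); last first.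
  apply/funext => z /=; rewrite /graph_law /image_measure /= /pushforward; congr (k _ _).
  by apply/seteqP; split => y; rewrite /xsection /= inE.
apply: (measurableT_comp (f := fun w => k w (xsection U w)) _ measurable_snd).
by apply: measurable_fun_xsection_finite_kernel; rewrite inE.
Qed.

HB.instance Definition _ := isKernel.Build _ _ _ _ R graph_law measurable_graph_law.

Let graph_law_prob z : graph_law z setT = 1.
Proof. by rewrite /graph_law /image_measure /= /pushforward preimage_setT prob_kernel. Qed.

HB.instance Definition _ :=
  Kernel_isProbability.Build _ _ _ _ R graph_law graph_law_prob.

Variables (W : Omega -> E) (Y : Omega -> R).
Hypotheses (mW : measurable_fun setT W) (mY : measurable_fun setT Y).

Let base_law (z : unit) : {measure set E -> \bar R} := image_measure P mW.

Let measurable_base_law U : measurable U -> measurable_fun [set: unit] (base_law ^~ U : _ -> \bar R).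
Proof. by move=> mU; exact: measurable_cst. Qed.

HB.instance Definition _ := isKernel.Build _ _ _ _ R base_law measurable_base_law.

Let base_law_prob z : base_law z setT = 1.
Proof. by rewrite /base_law /image_measure /= /pushforward preimage_setT probability_setT. Qed.

HB.instance Definition _ :=
  Kernel_isProbability.Build _ _ _ _ R base_law base_law_prob.

Let WY (w : Omega) : E * R := (W w, Y w).

Let mWY : measurable_fun setT WY.
Proof. exact: measurable_fun_pair. Qed.

Variable G : set (set E).
Hypotheses (GI : setI_closed G) (GT : G setT) (Gm : measurable = <<s G >>).
Hypothesis PWY : forall C A, G C -> measurable A ->
  P (W @^-1` C `&` Y @^-1` A) = \int[P]_(w in W @^-1` C) k (W w) A.

Let kcomp_rect C A : measurable C -> measurable A ->
  kcomp base_law graph_law tt (C `*` A) = \int[P]_(w in W @^-1` C) k (W w) A.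
Proof.
move=> mC mA; rewrite /kcomp.
rewrite ge0_integral_pushforward//=; last first.
- by move=> w _; exact: measure_ge0.
- have mCA := measurable_graph_law (measurableX mC mA).
  exact: (measurableT_comp mCA (pair1_measurable tt)).
rewrite preimage_setT [RHS]integral_mkcond.
apply: eq_integral => w _ /=; rewrite /graph_law /image_measure /= /pushforward/= patchE.
case: ifPn => [|]; rewrite ?inE /=.
- by move=> Cw; congr (k _ _); apply/seteqP; split => // y [].
- rewrite notin_setE => /= nC; rewrite (_ : _ @^-1` _ = set0) ?measure0//.
  by apply/seteqP; split => // y [].
Qed.

(** Disintegration of the law of [(W, Y)]. The image of [P] and the kernel composition agree on
    rectangles with first side in the pi-system [G]; these generate the product sigma-algebra, so
    the two measures coincide. *)
Lemma conditional_law_integral (f : E * R -> \bar R) :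
  (forall z, 0 <= f z) -> measurable_fun setT f ->
  \int[P]_w f (W w, Y w) = \int[P]_w \int[k (W w)]_y f (W w, y).
Proof.
move=> f0 mf.
have mG C : G C -> measurable C by move=> GC; rewrite Gm; exact: sub_sigma_algebra.
pose m1 : {measure set (E * R) -> \bar R} := image_measure P mWY.
pose m2 : {measure set (E * R) -> \bar R} := kcomp base_law graph_law tt.
have m12 A : measurable A -> m1 A = m2 A.
  apply: (@measure_unique _ _ _ [set C `*` A | C in G & A in measurable] (fun=> setT)).
  - rewrite measurable_prod_measurableType; apply/seteqP; split.
    + apply: smallest_sub; first exact: smallest_sigma_algebra.
      move=> _ [C mC] [B mB <-].
      pose H : set (set (E * R)) := [set C `*` A | C in G & A in @measurable _ R].
      (* The sets [D] whose cylinder over [setT] lies in the generated sigma-algebra form a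
         sigma-algebra containing [G], hence include every measurable set. *)
      have GX : <<s G >> `<=` [set D : set E | <<s H >> (D `*` setT)].
        apply: smallest_sub; last first.
          by move=> D GD; apply: sub_sigma_algebra; exists D => //; exists setT.
        split.
        + by rewrite /= set0X; exact: (@measurable0 _ (g_sigma_algebraType H)).
        + move=> D /= hC; rewrite setTD.
          rewrite (_ : _ `*` _ = ~` (D `*` setT)); last first.
            by apply/seteqP; split => -[a b] /=; tauto.
          exact: (@measurableC _ (g_sigma_algebraType H)).
        + move=> F hF /=; rewrite (_ : _ `*` _ = \bigcup_i (F i `*` setT)).
            exact: (@bigcupT_measurable _ (g_sigma_algebraType H)).
          apply/seteqP; split => -[a b] /=.
            by move=> [[i _ Fi] _]; exists i.
          by move=> [i _ [Fi _]]; split => //; exists i.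
      rewrite (_ : C `*` B = (C `*` setT) `&` (setT `*` B)); last first.
        by apply/seteqP; split => -[a b] /=; tauto.
      apply: (@measurableI _ (g_sigma_algebraType H)).
        by apply: GX; rewrite -Gm.
      by apply: sub_sigma_algebra; exists setT => //; exists B.
    + apply: smallest_sub; first exact: smallest_sigma_algebra.
      move=> _ [C GC] [B mB <-]; apply: sub_sigma_algebra.
      by exists C; [exact: mG|exists B].
  - move=> _ _ [C1 GC1 [A1 mA1 <-]] [C2 GC2 [A2 mA2 <-]].
    rewrite -setXI; exists (C1 `&` C2); first exact: GI.
    by exists (A1 `&` A2) => //; exact: measurableI.
  - by move=> _; exists setT => //; exists setT => //; rewrite setXTT.
  - by apply/seteqP; split => // x _; exists 0%N.
  - move=> _ [C GC [B mB <-]].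
    rewrite /m2 /= kcomp_rect//; last exact: mG.
    by rewrite -PWY.
  - by move=> _; rewrite /m1 /= /pushforward preimage_setT probability_setT ltry.
transitivity (\int[m1]_z f z).
  by rewrite ge0_integral_pushforward// preimage_setT.
transitivity (\int[m2]_z f z).
  by apply: eq_measure_integral => A mA _; exact: m12.
rewrite (integral_kcomp base_law graph_law)// ge0_integral_pushforward//=; last first.
- by move=> w _; exact: integral_ge0.
- have mg : measurable_fun setT (fun z => \int[graph_law z]_z f z).
    by apply: measurable_fun_integral_kernel => //; exact: measurable_graph_law.
  exact: (measurableT_comp mg (pair1_measurable tt)).
rewrite preimage_setT; apply: eq_integral => w _ /=.
rewrite ge0_integral_pushforward//= ?preimage_setT//.
Qed.

End conditional_law.

(** * The Gamma function *)

Section half_line.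
Context {R : realType}.
Notation mu := (@lebesgue_measure R).
Implicit Types (f g F G : R -> R) (a b C l : R).

(** Compact intervals away from 0 and from infinity: the integrands may be singular at 0, so
    calculus is done on these intervals and passed to the limit. *)
Definition pos_exhaustion (n : nat) : set R := `[(n.+1%:R)^-1, n.+1%:R].

Local Notation cpt := pos_exhaustion.

Lemma inv_natS_le_natS (n : nat) : (n.+1%:R)^-1 <= n.+1%:R :> R.
Proof. by rewrite (@le_trans _ _ 1)// ?invf_le1// ler1n. Qed.

Lemma nondecreasing_pos_exhaustion :
  nondecreasing_seq cpt.
Proof.
apply/nondecreasing_seqP => n; apply/subsetPset => x; rewrite /pos_exhaustion /= !in_itv/=.
move=> /andP[h1 h2]; apply/andP; split.
- by apply: le_trans h1; rewrite lef_pV2 ?posrE// ler_nat.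
- by apply: (le_trans h2); rewrite ler_nat.
Qed.

Lemma bigcup_pos_exhaustion :
  \bigcup_n cpt n = `]0, +oo[%classic :> set R.
Proof.
apply/seteqP; split => x /=.
  move=> [n _]; rewrite /pos_exhaustion /= !in_itv/= andbT => /andP[+ _].
  by apply: lt_le_trans.
rewrite in_itv/= andbT => x0.
pose n := maxn (Num.truncn x) (Num.truncn x^-1).
exists n => //; rewrite /pos_exhaustion /= in_itv/=; apply/andP; split.
- rewrite -[leRHS]invrK lef_pV2 ?posrE ?invr_gt0//.
  apply: (le_trans (ltW (Num.Theory.truncnS_gt _))).
  by rewrite ler_nat ltnS leq_maxr.
- apply: (le_trans (ltW (Num.Theory.truncnS_gt _))).
  by rewrite ler_nat ltnS leq_maxl.
Qed.

Lemma is_derive_continuous f (x df : R) : is_derive x 1 f df -> {for x, continuous f}.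
Proof. by move=> fx; apply/differentiable_continuous/derivable1_diffP. Qed.

Lemma is_derive_shift (z x : R) : is_derive x 1 (fun y => z + y) 1.
Proof.
have h := is_deriveD (is_derive_cst z x 1) (is_derive_id x (1 : R)).
by apply: (is_derive_eq h); rewrite add0r.
Qed.

Lemma pos_continuous_measurable f :
  (forall x : R, 0 < x -> {for x, continuous f}) -> measurable_fun (`]0, +oo[ : set R) f.
Proof.
move=> cf; apply: open_continuous_measurable_fun; first exact: interval_open.
by move=> x; rewrite inE/= in_itv/= andbT => /cf.
Qed.

Lemma cvg_integral_pos f :
  measurable_fun (`]0, +oo[ : set R) f -> (forall x : R, 0 < x -> 0 <= f x) ->
  (\int[mu]_(x in cpt n) (f x)%:E)%E @[n --> \oo] -->
  (\int[mu]_(x in `]0%R, +oo[) (f x)%:E)%E.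
Proof.
move=> mf f0; rewrite -bigcup_pos_exhaustion.
have sub n : cpt n `<=` `]0, +oo[ by rewrite -bigcup_pos_exhaustion => x; exists n.
apply: ge0_nondecreasing_set_cvg_integral.
- exact: nondecreasing_pos_exhaustion.
- by move=> n; exact: measurable_itv.
- move=> n; apply/measurable_EFinP.
  by apply: measurable_funS mf => //; exact: sub.
- move=> n x /sub /=; rewrite in_itv/= andbT lee_fin; exact: f0.
Qed.

Lemma continuous_FTC2_pos f F a b : 0 < a -> a <= b ->
  (forall x : R, 0 < x -> {for x, continuous f}) ->
  (forall x : R, 0 < x -> is_derive x 1 F (f x)) ->
  (\int[mu]_(x in `[a, b]) (f x)%:E = (F b - F a)%:E)%E.
Proof.
move=> a0; rewrite le_eqVlt => /predU1P[<- _ _|ab cf dF].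
  by rewrite set_itv1 integral_set1 subrr.
have cF x : 0 < x -> {for x, continuous F}.
  by move=> /dF dFx; apply/differentiable_continuous/derivable1_diffP.
rewrite (@continuous_FTC2 _ f F)//.
- apply: continuous_in_subspaceT => x; rewrite inE/= in_itv/= => /andP[ax _].
  by apply: cf; exact: lt_le_trans ax.
- split.
  + move=> x; rewrite in_itv/= => /andP[ax _].
    by case: (dF x (lt_trans a0 ax)).
  + by apply: cvg_at_right_filter; exact: cF.
  + by apply: cvg_at_left_filter; apply: cF; exact: lt_trans ab.
- move=> x; rewrite in_itv/= => /andP[ax _]; rewrite derive1E.
  by case: (dF x (lt_trans a0 ax)) => _ ->.
Qed.

(** A bounded primitive [G] of the dominating function bounds its integral over every compact
    interval by [C + C]; monotone convergence does the rest. *)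
Lemma integrable_pos_primitive f g G C :
  measurable_fun (`]0, +oo[ : set R) f -> (forall x : R, 0 < x -> `|f x| <= g x) ->
  (forall x : R, 0 < x -> {for x, continuous g}) ->
  (forall x : R, 0 < x -> is_derive x 1 G (g x)) ->
  (forall x : R, 0 < x -> `|G x| <= C) ->
  mu.-integrable `]0, +oo[ (EFin \o f).
Proof.
move=> mf fg cg dG GC.
have g0 x : 0 < x -> 0 <= g x by move=> x0; exact: le_trans (fg _ x0).
have mg := pos_continuous_measurable cg.
suff ig : mu.-integrable `]0, +oo[ (EFin \o g).
  apply: le_integrable ig => //; first exact/measurable_EFinP.
  move=> x /=; rewrite in_itv/= andbT lee_fin => x0.
  by rewrite (le_trans (fg _ x0))// ler_norm.
apply/integrableP; split; first exact/measurable_EFinP.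
have -> : (\int[mu]_(x in `]0%R, +oo[) `|(EFin \o g) x| =
    \int[mu]_(x in `]0%R, +oo[) (g x)%:E)%E.
  apply: eq_integral => x; rewrite inE/= in_itv/= andbT => x0.
  by rewrite ger0_norm// g0.
have /cvg_lim <- // := cvg_integral_pos mg g0.
apply: (@le_lt_trans _ _ (C + C)%:E); last exact: ltry.
apply: lime_le.
  by apply/cvg_ex; eexists; exact: (cvg_integral_pos mg g0).
apply: nearW => n; rewrite (continuous_FTC2_pos _ _ cg dG)//; last first.
  exact: inv_natS_le_natS.
rewrite lee_fin (le_trans (ler_norm _))// (le_trans (ler_normB _ _))//.
by rewrite lerD// GC.
Qed.

Lemma cvg_Rintegral_pos f : mu.-integrable `]0, +oo[ (EFin \o f) ->
  \int[mu]_(x in cpt n) f x @[n --> \oo] -->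
  \int[mu]_(x in `]0, +oo[) f x.
Proof.
move=> fi.
have sub n : cpt n `<=` `]0, +oo[ by rewrite -bigcup_pos_exhaustion => x; exists n.
have mcpt n : measurable (cpt n) by exact: measurable_itv.
apply: fine_cvg.
have -> : (\int[mu]_(x in `]0%R, +oo[) f x)%:E = (\int[mu]_(x in `]0%R, +oo[) (f x)%:E)%E.
  by rewrite fineK//; apply: integrable_fin_num.
have h n : (\int[mu]_(x in cpt n) (f x)%:E =
    \int[mu]_(x in `]0%R, +oo[) (((EFin \o f) \_ (cpt n)) x))%E.
  rewrite integral_mkcond [RHS]integral_mkcond; apply: eq_integral => x _.
  rewrite -patch_setI setIC; congr (patch _ _ _ _).
  by apply/esym/setIidPl; exact: sub.
rewrite (eq_cvg _ _ h).
apply: (@dominated_cvg _ _ _ mu (`]0%R, +oo[%classic : set R) _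
  (fun n => (EFin \o f) \_ (cpt n)) (EFin \o f) (abse \o (EFin \o f))).
- exact: measurable_itv.
- move=> n; apply/measurable_restrict => //; first exact: mcpt.
  apply: (measurable_funS _ _ (measurable_int _ fi)); first exact: measurable_itv.
  exact: subIsetl.
- move=> x; rewrite -bigcup_pos_exhaustion => -[n _ nx].
  apply: cvg_near_cst; exists n => // m /= nm; rewrite patchE ifT// inE.
  by have /subsetPset := nondecreasing_pos_exhaustion nm; exact.
- by [].
- exact: integrable_abse.
- move=> n x _; rewrite patchE; case: ifPn => // _.
  by rewrite /= normr0 lee_fin.
Qed.

Lemma integrable_FTC2_pos f F l0 l : mu.-integrable `]0, +oo[ (EFin \o f) ->
  (forall x : R, 0 < x -> {for x, continuous f}) ->
  (forall x : R, 0 < x -> is_derive x 1 F (f x)) ->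
  F x @[x --> 0^'+] --> l0 -> F x @[x --> +oo] --> l ->
  \int[mu]_(x in `]0, +oo[) f x = l - l0.
Proof.
move=> fi cf dF F0 Fy.
have h1 := cvg_Rintegral_pos fi.
apply: (cvg_unique _ h1) => //.
rewrite (_ : (fun n : nat => _) = (fun n : nat => F n.+1%:R - F (n.+1%:R)^-1)); last first.
  apply/funext => n; rewrite /Rintegral (continuous_FTC2_pos _ _ cf dF)//.
  exact: inv_natS_le_natS.
apply: cvgB.
- by apply: cvg_comp Fy; apply/cvgrnyP; rewrite (cvg_shiftS id).
- apply: cvg_comp F0.
  move=> A /= /cvg_harmonic [N _ hN]; exists N => // n /hN; apply.
  exact: harmonic_gt0.
Qed.

End half_line.

(** * The Euler integral, its functional equation and the duplication formula *)

Section Gamma_function.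
Context {R : realType}.
Notation mu := (@lebesgue_measure R).
Implicit Types (s t x : R).

(** The maximum of [y^q e^(-y)] is attained at [y = q]; the proof is [ln u <= u - 1] at
    [u = y / q]. *)
Lemma powR_le_expR q y : 0 < q -> 0 < y -> y `^ q <= q `^ q * expR (y - q) :> R.
Proof.
move=> q0 y0.
have -> : q `^ q = expR (q * ln q) by rewrite /powR gt_eqF.
rewrite /powR gt_eqF// -expRD ler_expR.
have : ln (y / q) <= y / q - 1.
  have := @le_ln1Dx R (y / q - 1).
  by rewrite addrCA subrr addr0; apply; rewrite ltrBrDl subrr divr_gt0.
rewrite ln_div ?posrE// -(ler_pM2l q0) !mulrBr mulr1.
rewrite [q * (y / q)]mulrCA divff ?gt_eqF// mulr1; lra.
Qed.

(* With [m := 1 + x (y - 1)], [ln u <= u - 1] at [u = y / m] and at [u = 1 / m],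
   averaged with weights [x] and [1 - x], gives [x * ln y <= ln m]. *)
Lemma powR_le_affine x y : 0 <= x <= 1 -> 0 < y -> y `^ x <= 1 + x * (y - 1).
Proof.
move=> /andP[x0 x1] y0; set m := (leRHS).
have m0 : 0 < m.
  rewrite /m; have [->|xn0] := eqVneq x 0; first by rewrite mul0r addr0.
  have xp : 0 < x by rewrite lt_neqAle eq_sym xn0.
  have := mulr_gt0 xp y0; lra.
have ln_le (u : R) : 0 < u -> ln u <= u - 1.
  move=> u0; have := @le_ln1Dx R (u - 1).
  by rewrite addrCA subrr addr0; apply; rewrite ltrBrDl subrr.
have l1 := ln_le _ (divr_gt0 y0 m0).
have l2 := ln_le m^-1; rewrite invr_gt0 in l2; move/(_ m0) in l2.
rewrite ln_div ?posrE// in l1; rewrite lnV ?posrE// in l2.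
have h : x * (ln y - ln m) + (1 - x) * (- ln m) <= x * (y / m - 1) + (1 - x) * (m^-1 - 1).
  by rewrite lerD// ler_wpM2l//; lra.
have e : x * (y / m - 1) + (1 - x) * (m^-1 - 1) = 0.
  rewrite (_ : _ + _ = (1 + x * (y - 1)) / m - 1); last by field; rewrite gt_eqF.
  by rewrite divff ?subrr// gt_eqF.
rewrite e in h; rewrite /powR gt_eqF// -[leRHS]lnK ?posrE// ler_expR; lra.
Qed.

Let mpos : measurable (`]0, +oo[%classic : set (measurableTypeR R)).
Proof. exact: measurable_itv. Qed.

Let integrand s t := t `^ (s - 1) * expR (- t).

Let is_derive_expN t : is_derive t 1 (fun t => expR (- t) : R) (- expR (- t)).
Proof.
have := is_derive1_comp (is_derive_expR (- t)) (is_deriveNid t 1).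
by rewrite mulrN1.
Qed.

Let is_derive_pow_exp s t : 0 < t ->
  is_derive t 1 (fun t => t `^ s * expR (- t))
    (s * integrand s t - integrand (s + 1) t).
Proof.
move=> t0; rewrite /integrand addrK.
have := is_deriveM (is_derive1_powR s t0) (is_derive_expN t).
by move=> h; apply: (is_derive_eq h); rewrite /GRing.scale/=; ring.
Qed.

Let continuous_integrand s t : 0 < t -> {for t, continuous (integrand s)}.
Proof. by move=> t0; apply: is_derive_continuous (is_derive_pow_exp _ t0). Qed.

(** The comparison function is the derivative of [C (t / (1 + t))^s], which stays below [C]. It
    equals [C s t^(s-1) (1 + t)^(-s-1)], and [C] is the constant for which [powR_le_expR] at [1 + t]
    gives [e^(-t) <= C s (1 + t)^(-s-1)]. *)
Lemma integrable_Euler s : 0 < s ->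
  mu.-integrable `]0, +oo[ (EFin \o (fun t => t `^ (s - 1) * expR (- t))).
Proof.
move=> s0; pose C := (s + 1) `^ (s + 1) * expR (1 - (s + 1)) / s.
have d1 t : 0 < t -> is_derive t 1 (fun t => (1 + t) `^ (- s)) (- s * (1 + t) `^ (- s - 1)).
  move=> t0; have t1 : 0 < 1 + t by lra.
  by have := is_derive1_comp (is_derive1_powR (- s) t1) (is_derive_shift 1 t); rewrite mulr1.
pose g t := C * (s * t `^ (s - 1) * (1 + t) `^ (- s)
              + t `^ s * (- s * (1 + t) `^ (- s - 1))).
have gE t : 0 < t -> g t = C * s * (t `^ (s - 1) * (1 + t) `^ (- (s + 1))).
  move=> t0; have t1 : 0 < 1 + t by lra.
  rewrite /g; have -> : t `^ s = t * t `^ (s - 1) by rewrite mulr_powRB1// ltW.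
  have -> : (1 + t) `^ (- s) = (1 + t) * (1 + t) `^ (- (s + 1)).
    rewrite -{2}(@powRr1 _ (1 + t)) ?(ltW t1)// -powRD; last by rewrite (gt_eqF t1) implybT.
    by congr powR; lra.
  have -> : - s - 1 = - (s + 1) by lra.
  by ring.
apply: (@integrable_pos_primitive _ _ g (fun t => C * (t `^ s * (1 + t) `^ (- s))) C).
- by apply: pos_continuous_measurable => t t0; apply: continuous_integrand.
- move=> t t0; have t1 : 0 < 1 + t by lra.
  rewrite ger0_norm; last by rewrite mulr_ge0 ?powR_ge0 ?expR_ge0.
  rewrite gE// mulrCA ler_wpM2l ?powR_ge0//.
  rewrite powRN ler_pdivlMr ?powR_gt0// /C divfK ?gt_eqF//.
  rewrite expRN ler_pdivrMl ?expR_gt0// mulrCA -expRD.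
  have -> : t + (1 - (s + 1)) = 1 + t - (s + 1) by ring.
  exact: powR_le_expR (addr_gt0 s0 ltr01) t1.
- move=> t t0; have t1 : 0 < 1 + t by lra.
  have c1 : {for t, continuous (fun t => C * s * (t `^ (s - 1) * (1 + t) `^ (- (s + 1))))}.
    have h1 := is_derive1_comp (is_derive1_powR (- (s + 1)) t1) (is_derive_shift 1 t).
    apply: (@continuousM _ _ (cst (C * s))); first exact: cst_continuous.
    apply: continuousM; first exact: is_derive_continuous (is_derive1_powR _ t0).
    exact: is_derive_continuous h1.
  apply: (@cvg_trans _ ((fun t => C * s * (t `^ (s - 1) * (1 + t) `^ (- (s + 1)))) @ t)).
    apply: near_eq_cvg; near=> u; rewrite gE//.
    near: u; exact: lt_nbhsr.
  by rewrite gE.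
- move=> t t0.
  have h := is_deriveM (is_derive1_powR s t0) (d1 _ t0).
  have h2 := is_deriveZ C h.
  by apply: (is_derive_eq h2); rewrite /g /GRing.scale/=; ring.
- move=> t t0; have t1 : 0 < 1 + t by lra.
  have C0 : 0 <= C by rewrite divr_ge0 ?(ltW s0)// mulr_ge0 ?powR_ge0 ?expR_ge0.
  rewrite ger0_norm; last by apply: mulr_ge0 => //; apply: mulr_ge0; exact: powR_ge0.
  rewrite ler_piMr// powRN ler_pdivrMr ?powR_gt0// mul1r.
  by apply: ge0_ler_powR; rewrite ?nnegrE ?(ltW s0) ?(ltW t0) ?(ltW t1)//; lra.
Unshelve. all: by end_near. Qed.

Lemma Euler_integral_gt0 s : 0 < s -> 0 < Euler_integral s.
Proof.
move=> s0; have fi := integrable_Euler s0.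
have m12 : measurable (`[1, 2]%classic : set R) by exact: measurable_itv.
have sub : (`[1, 2]%classic : set R) `<=` `]0, +oo[.
  by move=> t /=; rewrite !in_itv/= => /andP[t1 _]; rewrite andbT; lra.
(* On [[1, 2]] the integrand is at least [t^(-1) e^(-2)], hence at least half of [e^(-2)]. *)
have : ((expR (- 2) / 2)%:E <= \int[mu]_(t in `]0%R, +oo[) (integrand s t)%:E)%E.
  apply: (@le_trans _ _ (\int[mu]_(t in `[1%R, 2%R]) (integrand s t)%:E)%E); last first.
    apply: ge0_subset_integral => //.
    - exact: (measurable_int _ fi).
    - by move=> t _; rewrite lee_fin mulr_ge0 ?powR_ge0 ?expR_ge0.
  rewrite [leLHS](_ : _ = \int[mu]_(t in `[1%R, 2%R]) (expR (- 2) / 2)%:E)%E; last first.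
    have e : mu `[1%R, 2%R] = 1%E.
      by rewrite lebesgue_measure_itv/= lte_fin ltr1n -EFinB; congr EFin; lra.
    transitivity ((expR (- 2) / 2)%:E * mu `[1%R, 2%R])%E; first by rewrite e mule1.
    exact/esym/integral_cst.
  apply: ge0_le_integral => //.
  - by apply: measurable_funS (measurable_int _ fi); first exact: measurable_itv.
  - move=> t /=; rewrite in_itv/= => /andP[t1 t2]; rewrite lee_fin mulrC.
    apply: ler_pM; rewrite ?expR_ge0 ?invr_ge0//; last by rewrite ler_expR; lra.
    apply: (@le_trans _ _ (t `^ (- 1))).
      rewrite powR_inv1 ?lef_pV2 ?posrE//; lra.
    by apply: ler_powR => //; lra.
rewrite /Euler_integral /Rintegral -/(integrand s).
have fin : (\int[mu]_(t in `]0%R, +oo[) (integrand s t)%:E)%E \is a fin_num.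
  by apply: integrable_fin_num.
rewrite -(fineK fin) lee_fin; apply: lt_le_trans.
by rewrite divr_gt0 ?expR_gt0.
Qed.

(** Half of the exponential absorbs the power: [powR_le_expR] is applied at [t / 2]. *)
Lemma cvg_pow_expN s : 0 < s -> t `^ s * expR (- t) @[t --> +oo] --> (0 : R).
Proof.
move=> s0; pose C := 2 `^ s * s `^ s.
apply: (@squeeze_cvgr _ _ _ _ (cst 0) (fun t => C * expR (- (t * 2^-1)))).
- near=> t.
  have t0 : 0 < t by near: t; exact: nbhs_pinfty_gt.
  rewrite mulr_ge0 ?powR_ge0 ?expR_ge0//= /C.
  have -> : t `^ s = 2 `^ s * (t / 2) `^ s.
    by rewrite -powRM ?divr_ge0 ?(ltW t0)//; congr powR; lra.
  rewrite -!mulrA ler_wpM2l ?powR_ge0//.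
  have t2 : 0 < t / 2 by lra.
  have := powR_le_expR s0 t2; rewrite -(ler_pM2r (expR_gt0 (- t))) => /le_trans; apply.
  rewrite -mulrA ler_wpM2l ?powR_ge0// -expRD ler_expR; lra.
- exact: cvg_cst.
- rewrite -(mulr0 C); apply: cvgM; first exact: cvg_cst.
  apply: (@cvg_comp _ _ _ (fun t => t * 2^-1) (fun u => expR (- u)) _ (pinfty_nbhs R)).
    by apply: gt0_cvgMly; [lra|exact: cvg_id].
  exact: cvgr_expR.
Unshelve. all: by end_near. Qed.

Lemma Euler_integralS s : 0 < s -> Euler_integral (s + 1) = s * Euler_integral s.
Proof.
move=> s0; have s10 : 0 < s + 1 by lra.
have i1 := integrable_Euler s0; have i2 := integrable_Euler s10.
have i3 : mu.-integrable `]0, +oo[ (EFin \o (fun t => s * integrand s t)).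
  by have := integrableZl mpos s i1.
have : \int[mu]_(t in `]0, +oo[) (s * integrand s t - integrand (s + 1) t) = 0 - 0.
  apply: (@integrable_FTC2_pos _ _ (fun t => t `^ s * expR (- t))).
  - by have := integrableB mpos i3 i2.
  - move=> t t0; apply: continuousB; last exact: continuous_integrand.
    apply: (@continuousM _ _ (cst s)); first exact: cst_continuous.
    exact: continuous_integrand.
  - by move=> t t0; exact: is_derive_pow_exp.
  - rewrite -[X in _ --> X](mul0r (expR (- 0))); apply: cvgM; first exact: powR_cvg0.
    by apply: cvg_at_right_filter; apply: is_derive_continuous (is_derive_expN 0).
  - exact: cvg_pow_expN.
rewrite RintegralB// RintegralZl// subr0 => /eqP; rewrite subr_eq0 => /eqP h.
by rewrite /Euler_integral -h.
Qed.

Lemma Gamma_pos s : 0 < s -> Gamma s = Euler_integral s.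
Proof.
move=> s0; rewrite /Gamma min_r ?ltW// floor0 absz0 big_ord0 divr1.
by rewrite addr0.
Qed.

Lemma Gamma_neg s : - 1 < s < 0 -> Gamma s = Euler_integral (s + 1) / s.
Proof.
move=> /andP[s1 s0]; rewrite /Gamma min_l ?ltW//.
rewrite (@floor_def _ _ (-1)); last first.
  by rewrite (ltW s1)/= addrC subrr.
by rewrite /= big_ord1 addr0.
Qed.

Lemma Gamma_gt0 s : 0 < s -> 0 < Gamma s.
Proof. by move=> s0; rewrite Gamma_pos// Euler_integral_gt0. Qed.

(** The range [-1 < s], where one step of the continuation suffices, covers the parameters of both
    Kummer series, of which only [a] and [b] are negative. *)
Lemma GammaS s : - 1 < s -> s != 0 -> Gamma (s + 1) = s * Gamma s.
Proof.
move=> s1 s0; have [sp|sn|/eqP] := ltgtP 0 s; last by rewrite eq_sym (negbTE s0).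
- by rewrite !Gamma_pos ?Euler_integralS//; lra.
- rewrite Gamma_pos; last lra.
  by rewrite Gamma_neg ?s1// mulrCA divff// mulr1.
Qed.

Lemma Gamma_neq0 s : - 1 < s -> s != 0 -> Gamma s != 0.
Proof.
move=> s1 s0; apply/negP => /eqP G0.
have : 0 < Gamma (s + 1) by apply: Gamma_gt0; lra.
by rewrite GammaS// G0 mulr0 ltxx.
Qed.


(** Integrate the tangent bound [(t / s)^x <= 1 + x (t / s - 1)] against [t^(s-1) e^(-t)]: the term
    in [x] vanishes because [Gamma (s + 1) = s * Gamma s]. *)
Lemma GammaD_le s x : 0 < s -> 0 <= x <= 1 -> Gamma (s + x) <= s `^ x * Gamma s.
Proof.
move=> s0 /andP[x0 x1]; have sx0 : 0 < s + x by lra.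
have s10 : 0 < s + 1 by lra.
have i1 := integrable_Euler s0; have i2 := integrable_Euler s10.
have i3 := integrable_Euler sx0.
pose c1 := s `^ x * (1 - x); pose c2 := s `^ x * x / s.
have j1 : mu.-integrable `]0, +oo[ (EFin \o (fun t => c1 * integrand s t)).
  by have := integrableZl mpos c1 i1.
have j2 : mu.-integrable `]0, +oo[ (EFin \o (fun t => c2 * integrand (s + 1) t)).
  by have := integrableZl mpos c2 i2.
rewrite [leLHS]Gamma_pos//.
apply: (@le_trans _ _ (\int[mu]_(t in `]0, +oo[) (c1 * integrand s t + c2 * integrand (s + 1) t))).
  apply: le_Rintegral => //; first by have := integrableD mpos j1 j2.
  move=> t /=; rewrite in_itv/= andbT => t0; rewrite /integrand addrK.
  have -> : s + x - 1 = s - 1 + x by ring.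
  rewrite powRD; last by rewrite (gt_eqF t0) implybT.
  have -> : t `^ s = t `^ (s - 1) * t by rewrite mulrC mulr_powRB1// ltW.
  have -> : c1 * (t `^ (s - 1) * expR (- t)) + c2 * (t `^ (s - 1) * t * expR (- t)) =
    (t `^ (s - 1) * expR (- t)) * (s `^ x * (1 + x * (t / s - 1))).
    by rewrite /c1 /c2; field; rewrite gt_eqF.
  rewrite mulrAC ler_wpM2l ?mulr_ge0 ?powR_ge0 ?expR_ge0//.
  have ts0 : 0 < t / s by rewrite divr_gt0.
  have -> : t `^ x = s `^ x * (t / s) `^ x.
    by rewrite -powRM ?(ltW s0) ?(ltW ts0)//; congr powR; field; rewrite gt_eqF.
  by rewrite ler_wpM2l ?powR_ge0// powR_le_affine// x0.
rewrite RintegralD// !RintegralZl//.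
rewrite -[\int[mu]_(t in _) integrand s t]/(Euler_integral s).
rewrite -[\int[mu]_(t in _) integrand (s + 1) t]/(Euler_integral (s + 1)).
rewrite Euler_integralS// Gamma_pos// /c1 /c2.
rewrite le_eqVlt; apply/orP; left; apply/eqP; field; rewrite gt_eqF//.
Qed.

Lemma Gamma1 : Gamma 1 = 1 :> R.
Proof.
rewrite Gamma_pos// /Euler_integral.
have := @integrable_FTC2_pos R (fun t => integrand 1 t) (fun t => - expR (- t)) (- 1) 0.
rewrite opprK add0r; apply.
- exact: integrable_Euler.
- by move=> t t0; exact: continuous_integrand.
- move=> t t0; have := is_deriveN (is_derive_expN t); rewrite opprK /integrand subrr powRr0 mul1r.
  by [].
- rewrite -[X in _ --> - X]expR0 -oppr0; apply: cvgN; apply: cvg_at_right_filter.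
  by rewrite oppr0 -{2}oppr0; apply: is_derive_continuous (is_derive_expN 0).
- by rewrite -[X in _ --> X]oppr0; apply: cvgN; exact: cvgr_expR.
Qed.

(** The substitution [t = x^2] leads to the Gaussian integral. It maps the compact interval of index
    [n] onto the one of index [(n.+1 ^ 2).-1], whence the passage to that subsequence. *)
Lemma Gamma_half : Gamma 2^-1 = Num.sqrt pi :> R.
Proof.
have h0 : 0 < 2^-1 :> R by lra.
rewrite Gamma_pos//; have := cvg_Rintegral_pos (integrable_Euler h0).
set u := (X in X @ _ --> _) => hu.
have {}hu : u (n.+1 ^ 2).-1 @[n --> \oo] --> Euler_integral (2^-1 : R).
  apply: cvg_comp hu => A [N _ hN]; exists N => // n /= An; apply: hN => /=.
  exact: leq_trans An (leq_addr _ _).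
have gi : mu.-integrable `]0, +oo[ (EFin \o (fun t : R => 2 * gauss_fun t)).
  have gi : mu.-integrable `]0, +oo[ (EFin \o (@gauss_fun R)).
    by apply: (integrableS _ _ _ integrableT_gauss).
  by have := integrableZl mpos 2 gi.
have := cvg_Rintegral_pos gi.
have -> : \int[mu]_(x in `]0, +oo[) (2 * gauss_fun x) = Num.sqrt pi.
  rewrite RintegralZl//; last by apply: (integrableS _ _ _ integrableT_gauss).
  rewrite /Rintegral integral_itv_obnd_cbnd; last first.
    apply: measurable_funS measurableT _ _ => //.
    by apply/measurable_EFinP; exact: measurable_gauss_fun.
  by rewrite integral0y_gauss /= mulrCA divff// mulr1.
rewrite (_ : (fun n : nat => _) = (fun n => u (n.+1 ^ 2).-1)); first exact: (cvg_unique _ hu).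
apply/funext => n; rewrite /u /Rintegral; congr fine.
rewrite /pos_exhaustion prednK ?expn_gt0//.
have sqd t : is_derive t 1 (fun t : R => t ^+ 2) (2 * t).
  have := is_deriveX 2 (is_derive_id t (1 : R)) => h.
  by apply: (is_derive_eq h); rewrite /GRing.scale/=; ring.
have sq' : (fun t : R => t ^+ 2)^`()%classic = (fun t => 2 * t).
  by apply/funext => t; rewrite derive1E; case: (sqd t).
have csq (t : R) : {for t, continuous (fun t : R => 2 * t)}.
  by apply: continuousM; [exact: cst_continuous|exact: cvg_id].
have := @integration_by_substitution_increasing R (fun t => t ^+ 2) (integrand 2^-1)
  (n.+1%:R^-1) (n.+1%:R).
rewrite natrX -exprVn => ->.
- apply: eq_integral => t; rewrite inE/= in_itv/= => /andP[t1 t2].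
  have t0 : 0 < t by apply: lt_le_trans t1.
  rewrite sq' /integrand/= /gauss_fun; congr EFin.
  change (2 * expR (- (t : R) ^+ 2) =
    ((t : R) ^+ 2) `^ (2^-1 - 1) * expR (- t ^+ 2) * (2 * t)).
  have -> : ((t : R) ^+ 2) `^ (2^-1 - 1) = t^-1.
    rewrite -(powR_mulrn _ (ltW t0)) -powRrM (_ : 2%:R * _ = - 1); last by field.
    by rewrite powR_inv1// ltW.
  by field; rewrite gt_eqF.
- exact: inv_natS_le_natS.
- move=> x y; rewrite !in_itv/= => /andP[x0 _] _ xy.
  by rewrite ltrXn2r//; apply: le_trans x0; rewrite invr_ge0.
- by rewrite sq' => t _; exact: csq.
- rewrite sq'; apply/cvg_ex; eexists; apply: cvg_at_right_filter; exact: csq.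
- rewrite sq'; apply/cvg_ex; eexists; apply: cvg_at_left_filter; exact: csq.
- split.
  + by move=> t _; case: (sqd t).
  + by apply: cvg_at_right_filter; apply: is_derive_continuous (sqd _).
  + by apply: cvg_at_left_filter; apply: is_derive_continuous (sqd _).
- apply: continuous_in_subspaceT => t; rewrite inE/= in_itv/= => /andP[t1 _].
  by apply: continuous_integrand; apply: lt_le_trans t1; rewrite exprn_gt0// invr_gt0.
Qed.

(** Legendre's formula says that this quotient is constant. It has period 1, and [dupD_le] bounds
    its growth by a factor that tends to 1 at infinity; moving far to the right by integers removes
    the factor and leaves [dup_le]. *)
Let dup s := Gamma (s / 2) * Gamma ((s + 1) / 2) * 2 `^ s / Gamma s.

Let dupS s : 0 < s -> dup (s + 1) = dup s.
Proof.
move=> s0; rewrite /dup; have -> : (s + 1 + 1) / 2 = s / 2 + 1 by field.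
rewrite !GammaS ?gt_eqF//; try lra.
rewrite powRD ?pnatr_eq0 ?implybT// powRr1//.
have := Gamma_gt0 s0 => G0; field; rewrite ?gt_eqF//.
Qed.

Let dupSn s n : 0 < s -> dup (s + n%:R) = dup s.
Proof.
move=> s0; elim: n => [|n IH]; first by rewrite addr0.
by rewrite -natr1 addrA dupS// ltr_wpDr.
Qed.

Let dupD_le s x : 0 < s -> 0 <= x <= 1 -> dup (s + x) <= dup s * (1 + s^-1) ^+ 2.
Proof.
move=> s0 /andP[x0 x1]; have sx0 : 0 < s + x by lra.
have h1 : Gamma ((s + x) / 2) <= (s / 2) `^ (x / 2) * Gamma (s / 2).
  by rewrite mulrDl; apply: GammaD_le; lra.
have h2 : Gamma ((s + x + 1) / 2) <= ((s + 1) / 2) `^ (x / 2) * Gamma ((s + 1) / 2).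
  by rewrite addrAC mulrDl; apply: GammaD_le; lra.
(* A lower bound for [Gamma (s + x)], from the same inequality started at [s + x] and ending at
   [s + 1]. *)
have h3 : s * Gamma s <= (s + x) `^ (1 - x) * Gamma (s + x).
  rewrite -GammaS ?gt_eqF//; last lra.
  have -> : s + 1 = s + x + (1 - x) by ring.
  by apply: GammaD_le; lra.
have G0 := Gamma_gt0 s0; have G1 := Gamma_gt0 sx0.
have G2 : 0 < Gamma (s / 2) by apply: Gamma_gt0; lra.
have G3 : 0 < Gamma ((s + 1) / 2) by apply: Gamma_gt0; lra.
rewrite /dup ler_pdivrMr//.
apply: (@le_trans _ _ (((s / 2) `^ (x / 2) * Gamma (s / 2)) *
  (((s + 1) / 2) `^ (x / 2) * Gamma ((s + 1) / 2)) * 2 `^ (s + x))).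
  rewrite ler_wpM2r ?powR_ge0//; apply: ler_pM => //; apply: ltW; apply: Gamma_gt0; lra.
have -> : 2 `^ (s + x) = 2 `^ s * (2 `^ (x / 2) * 2 `^ (x / 2)) :> R.
  rewrite powRD ?pnatr_eq0 ?implybT//; congr (_ * _).
  by rewrite -powRD ?pnatr_eq0 ?implybT//; congr powR; field.
have p2 : 0 <= s / 2 by lra.
have p3 : 0 <= (s + 1) / 2 by lra.
have e1 : (s / 2) `^ (x / 2) * 2 `^ (x / 2) = s `^ (x / 2).
  by rewrite -powRM//; congr powR; field.
have e2 : ((s + 1) / 2) `^ (x / 2) * 2 `^ (x / 2) = (s + 1) `^ (x / 2).
  by rewrite -powRM//; congr powR; field.
have -> : (s / 2) `^ (x / 2) * Gamma (s / 2) *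
  (((s + 1) / 2) `^ (x / 2) * Gamma ((s + 1) / 2)) *
  (2 `^ s * (2 `^ (x / 2) * 2 `^ (x / 2))) =
  s `^ (x / 2) * (s + 1) `^ (x / 2) * (Gamma (s / 2) * Gamma ((s + 1) / 2) * 2 `^ s).
  by rewrite -e1 -e2; ring.
set A := Gamma (s / 2) * Gamma ((s + 1) / 2) * 2 `^ s.
have A0 : 0 < A by rewrite /A; apply: mulr_gt0; [exact: mulr_gt0|exact: powR_gt0].
have -> : A / Gamma s * (1 + s^-1) ^+ 2 * Gamma (s + x) =
  (1 + s^-1) ^+ 2 * (Gamma (s + x) / Gamma s) * A.
  by field; rewrite !gt_eqF.
rewrite ler_wpM2r ?(ltW A0)//.
have h4 : s / (s + 1) `^ (1 - x) <= Gamma (s + x) / Gamma s.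
  have s10 : 0 < s + 1 by lra.
  rewrite ler_pdivrMr ?powR_gt0// mulrAC ler_pdivlMr//; apply: (le_trans h3); rewrite mulrC ler_wpM2l ?(ltW G1)//.
  by apply: ge0_ler_powR; rewrite ?nnegrE; lra.
apply: (@le_trans _ _ ((1 + s^-1) ^+ 2 * (s / (s + 1) `^ (1 - x)))); last first.
  by rewrite ler_wpM2l// exprn_ge0// addr_ge0// invr_ge0 ltW.
have s1 : 0 < s + 1 by lra.
apply: (@le_trans _ _ ((s + 1) `^ x)).
  have -> : (s + 1) `^ x = (s + 1) `^ (x / 2) * (s + 1) `^ (x / 2).
    by rewrite -[RHS]powRD; [congr powR; field|rewrite (gt_eqF s1) implybT].
  rewrite ler_wpM2r ?powR_ge0//; apply: ge0_ler_powR; rewrite ?nnegrE; lra.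
have -> : (s + 1) `^ (1 - x) = (s + 1) / (s + 1) `^ x.
  rewrite powRB; last by rewrite (gt_eqF s1) implybT.
  by rewrite powRr1// ltW.
have p1 : 0 < (s + 1) `^ x by rewrite powR_gt0.
have -> : (1 + s^-1) ^+ 2 * (s / ((s + 1) / (s + 1) `^ x)) = (1 + s^-1) * (s + 1) `^ x.
  by field; rewrite !gt_eqF.
rewrite ler_peMl ?(ltW p1)//.
by rewrite lerDl invr_ge0 ltW.
Qed.

Let dup_le s x : 0 < s -> 0 <= x <= 1 -> dup (s + x) <= dup s.
Proof.
move=> s0 x01.
have h n : dup (s + x) <= dup s * (1 + (s + n.+1%:R)^-1) ^+ 2.
  have sn0 : 0 < s + n.+1%:R by rewrite ltr_wpDr.
  have sx0 : 0 < s + x by case/andP: x01 => ? _; rewrite ltr_wpDr.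
  rewrite -(dupSn n.+1 s0) -(dupSn n.+1 sx0).
  by have := dupD_le sn0 x01; rewrite addrAC.
have c0 : (s + n.+1%:R)^-1 @[n --> \oo] --> (0 : R).
  apply: (@squeeze_cvgr _ _ _ _ (cst 0) (fun n => harmonic n)).
  - apply: nearW => n /=; have sn0 : 0 < s + n.+1%:R by rewrite ltr_wpDr.
    by rewrite invr_ge0 (ltW sn0)/= lef_pV2 ?posrE// lerDr ltW.
  - exact: cvg_cst.
  - exact: cvg_harmonic.
have c1 : dup s * (1 + (s + n.+1%:R)^-1) ^+ 2 @[n --> \oo] --> dup s * (1 + 0) ^+ 2.
  apply: cvgM; first exact: cvg_cst.
  by rewrite !expr2; apply: cvgM; apply: cvgD => //; exact: cvg_cst.
rewrite addr0 expr1n mulr1 in c1.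
by apply: (ler_cvg_to (cvg_cst (dup (s + x))) c1); apply: nearW.
Qed.

(** [dup_le] from 1 to [s] and from [s] to 2, together with [dup 2 = dup 1], pins [dup s] to its
    value at 1, which [Gamma_half] provides. *)
Lemma Gamma_duplication s : 1 <= s <= 2 ->
  Gamma (s / 2) * Gamma ((s + 1) / 2) = 2 `^ (1 - s) * Num.sqrt pi * Gamma s.
Proof.
move=> /andP[s1 s2].
have d1 : dup 1 = 2 * Num.sqrt pi.
  rewrite /dup mul1r Gamma_half (_ : (1 + 1) / 2 = 1); last by field.
  by rewrite Gamma1 powRr1// divr1 mulr1 mulrC.
have d2 : dup s = dup 1.
  apply: le_anti; apply/andP; split.
  - have -> : s = 1 + (s - 1) by ring.
    by apply: dup_le; lra.
  - rewrite -(@dupS 1)// (_ : 1 + 1 = s + (2 - s)); last by ring.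
    by apply: dup_le; lra.
have Gs : 0 < Gamma s by apply: Gamma_gt0; lra.
have h : Gamma (s / 2) * Gamma ((s + 1) / 2) * 2 `^ s = 2 * Num.sqrt pi * Gamma s.
  by rewrite -d1 -d2 /dup divfK// gt_eqF.
have p0 : 0 < 2 `^ s :> R by rewrite powR_gt0.
apply: (mulIf (x := 2 `^ s)); first by rewrite gt_eqF.
rewrite h powRB ?pnatr_eq0 ?implybT// powRr1//.
by field; rewrite gt_eqF.
Qed.

End Gamma_function.

(** * Kummer's equation and the function Psi *)

Section Kummer_equation.
Context {R : realType}.
Implicit Types (a b z k : R) (w v : R -> R) (c : R^nat).

Definition Kummer_solution a b w w1 w2 := forall z, 0 < z ->
  [/\ is_derive z 1 w (w1 z), is_derive z 1 w1 (w2 z) &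
      z * w2 z + (b - z) * w1 z - a * w z = 0].

Lemma is_derive0_pos_const (f : R -> R) :
  (forall x : R, 0 < x -> is_derive x 1 f 0) -> forall x, 0 < x -> f x = f 1.
Proof.
move=> df.
have h (u v : R) : 0 < u -> u <= v -> f u = f v.
  move=> u0 uv; have := @continuous_FTC2_pos R (cst 0) f u v u0 uv.
  have c0 x : 0 < x -> {for x, continuous (cst (0 : R) : R -> R)}.
    by move=> _; exact: cst_continuous.
  move=> /(_ c0) /(_ df) /=.
  by rewrite integral0 => -[/esym/eqP]; rewrite subr_eq0 => /eqP ->.
move=> x x0; have [x1|/ltW x1] := leP x 1; first exact: h.
by apply/esym/h.
Qed.

(** Abel's identity: multiplied by [z^b e^(-z)], the Wronskian has zero derivative. *)
Lemma Kummer_wronskian a b w w1 w2 v v1 v2 :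
  Kummer_solution a b w w1 w2 -> Kummer_solution a b v v1 v2 ->
  exists k, forall z, 0 < z -> w1 z * v z - w z * v1 z = k * (z `^ (- b) * expR z).
Proof.
move=> hw hv.
pose V z := (w1 z * v z - w z * v1 z) * (z `^ b * expR (- z)).
suff dV (z : R) : 0 < z -> is_derive z 1 V 0.
  exists (V 1) => z z0; rewrite -(is_derive0_pos_const dV z0).
  rewrite /V powRN expRN; field.
  by rewrite expR_eq0/= gt_eqF// powR_gt0.
move=> z0; have [dw dw1 ew] := hw _ z0; have [dv dv1 ev] := hv _ z0.
have dE : is_derive z 1 (fun t => expR (- t) : R) (- expR (- z)).
  by have := is_derive1_comp (is_derive_expR (- z)) (is_deriveNid z 1); rewrite mulrN1.
have d1 := is_deriveB (is_deriveM dw1 dv) (is_deriveM dw dv1).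
have d2 := is_deriveM d1 (is_deriveM (is_derive1_powR b z0) dE).
apply: (is_derive_eq d2); rewrite /GRing.scale/= !fctE.
have -> : z `^ b = z * z `^ (b - 1).
  rewrite -{2}(@powRr1 _ z) ?(ltW z0)// -powRD; last by rewrite (gt_eqF z0) implybT.
  by congr powR; ring.
have e1 : z * w2 z = a * w z - (b - z) * w1 z by lra.
have e2 : z * v2 z = a * v z - (b - z) * v1 z by lra.
set p := z `^ (b - 1); set e := expR _.
rewrite (_ : _ + _ = p * e * ((z * w2 z) * v z - w z * (z * v2 z)
   + (b - z) * (w1 z * v z - w z * v1 z))); last by ring.
by rewrite e1 e2; ring.
Qed.

Lemma Kummer_solutionN a b w w1 w2 : Kummer_solution a b w w1 w2 ->
  Kummer_solution a b (- w) (- w1) (- w2).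
Proof.
move=> h z z0; have [dw dw1 ew] := h _ z0; split; try exact: is_deriveN.
rewrite -[LHS]/(z * - w2 z + (b - z) * - w1 z - a * - w z).
rewrite (_ : _ - _ = - (z * w2 z + (b - z) * w1 z - a * w z)); last by ring.
by rewrite ew oppr0.
Qed.

(* The Wronskian is [k z^(-b) e^z]: unless [k = 0], the quotient [w / v] would
   grow like [e^z / v^2], faster than both bounds allow. *)
Lemma Kummer_comparison a b w w1 w2 v v1 v2 (A B c0 : R) : b <= 0 ->
  Kummer_solution a b w w1 w2 -> Kummer_solution a b v v1 v2 -> 0 < c0 ->
  (forall z, 0 < z -> c0 <= v z <= A * expR (z / 8)) ->
  (forall z, 0 < z -> `|w z| <= B * expR (z / 2)) ->
  exists k, forall z, 0 < z -> w z = k * v z.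
Proof.
move=> b0 hw hv c00 hA hB.
have [k hk] := Kummer_wronskian hw hv.
have v0 z : 0 < z -> 0 < v z by move=> /hA/andP[h _]; exact: lt_le_trans h.
have dq z : 0 < z -> is_derive z 1 (fun z => w z / v z) (k * (z `^ (- b) * expR z) / v z ^+ 2).
  move=> z0; have [dw dw1 _] := hw _ z0; have [dv dv1 _] := hv _ z0.
  have vn : v z != 0 by rewrite gt_eqF// v0.
  have dV := is_deriveV vn dv.
  have d2 := is_deriveM dw dV.
  by apply: (is_derive_eq d2); rewrite /GRing.scale/= -hk//; field.
have A0 : 0 < A.
  have /andP[h1 h2] := hA _ ltr01.
  have := lt_le_trans c00 (le_trans h1 h2); rewrite pmulr_lgt0// expR_gt0//.
have k0 : k = 0.
  (* Stated for all [k] and [w] in order to serve for [- w] as well, which excludes [k < 0]. *)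
  have key : forall k w w1 w2, Kummer_solution a b w w1 w2 ->
     (forall z, 0 < z -> `|w z| <= B * expR (z / 2)) ->
     (forall z, 0 < z -> is_derive z 1 (fun z => w z / v z) (k * (z `^ (- b) * expR z) / v z ^+ 2)) ->
     ~ 0 < k.
    move=> {k w w1 w2 hw hB hk dq} k w w1 w2 hw hB dq kp.
    pose m := k / A ^+ 2; have m0 : 0 < m by rewrite divr_gt0// exprn_gt0.
    (* For [1 <= z], [b <= 0] gives [1 <= z^(-b)] and the bound on [v] gives [v^2 <= A^2 e^(z/4)],
       so the derivative of [w / v] is at least [m e^(3z/4)]. Subtracting a primitive of this leaves
       [H] nondecreasing. *)
    pose H z := w z / v z - (4 / 3 * m) * expR (3 / 4 * z).
    pose dH z := k * (z `^ (- b) * expR z) / v z ^+ 2 - m * expR (3 / 4 * z).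
    have dHE z : 0 < z -> is_derive z 1 H (dH z).
      move=> z0.
      have dl : is_derive z 1 (fun z => 3 / 4 * z) (3 / 4).
        by have := is_deriveZ (3 / 4) (is_derive_id z (1 : R)); rewrite /GRing.scale/= mulr1.
      have de := is_deriveZ (4 / 3 * m) (is_derive1_comp (is_derive_expR (3 / 4 * z)) dl).
      have d2 := is_deriveB (dq z z0) de.
      by apply: (is_derive_eq d2); rewrite /GRing.scale/= /dH; congr (_ - _); field.
    have dH0 z : 1 <= z -> 0 <= dH z.
      move=> z1; have z0 : 0 < z by lra.
      have /andP[_ hv2] := hA _ z0.
      rewrite /dH subr_ge0 /m.
      have vA : v z ^+ 2 <= A ^+ 2 * expR (z / 4).
        have -> : expR (z / 4) = expR (z / 8) ^+ 2.
          by rewrite -expRM_natl; congr expR; field.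
        by rewrite -exprMn ler_pXn2r ?nnegrE// ?(ltW (v0 _ _))// ltW// (lt_le_trans (v0 _ z0)).
      rewrite ler_pdivlMr ?exprn_gt0 ?v0//.
      apply: (@le_trans _ _ (k / A ^+ 2 * expR (3 / 4 * z) * (A ^+ 2 * expR (z / 4)))).
        by rewrite ler_wpM2l// mulr_ge0 ?expR_ge0 ?(ltW m0).
      have -> : k / A ^+ 2 * expR (3 / 4 * z) * (A ^+ 2 * expR (z / 4)) =
         k * (expR (3 / 4 * z) * expR (z / 4)) by field; rewrite gt_eqF.
      rewrite -expRD (_ : 3 / 4 * z + z / 4 = z); last by field.
      rewrite ler_wpM2l ?(ltW kp)// ler_peMl ?expR_ge0//.
      by rewrite -(powRr0 z) ler_powR//; lra.
    have Hmono z : 1 <= z -> H 1 <= H z.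
      move=> z1; have [->|zn1] := eqVneq z 1; first by [].
      have z1' : 1 < z by rewrite lt_neqAle eq_sym zn1.
      have cH : {within `[1, z], continuous H}.
        apply: continuous_in_subspaceT => y; rewrite inE/= in_itv/= => /andP[y1 _].
        by apply: is_derive_continuous (dHE _ _); lra.
      have [|y] := @MVT R H dH 1 z z1' _ cH.
        by move=> y; rewrite in_itv/= => /andP[y1 _]; apply: dHE; lra.
      rewrite in_itv/= => /andP[y1 _] e.
      by rewrite -subr_ge0 e mulr_ge0// ?dH0; lra.
    have C0 : 0 <= `|H 1| + B / c0.
      have hB1 := hB _ ltr01.
      have B0 : 0 <= B by rewrite -(@pmulr_lge0 _ (expR (1 / 2)))// ?expR_gt0// (le_trans _ hB1).
      by rewrite addr_ge0// divr_ge0// ltW.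
    have bound z : 1 <= z -> (4 / 3 * m) * expR (z / 4) <= `|H 1| + B / c0.
      move=> z1; have z0 : 0 < z by lra.
      have h1 := Hmono _ z1.
      have h2 : w z / v z <= B / c0 * expR (z / 2).
        apply: (le_trans (ler_norm _)); rewrite normf_div (gtr0_norm (v0 _ z0)).
        rewrite [leRHS]mulrAC; apply: ler_pM; rewrite ?invr_ge0 ?(ltW (v0 _ z0))//.
          exact: hB.
        by rewrite lef_pV2 ?posrE ?v0//; case/andP: (hA _ z0).
      have h3 : (4 / 3 * m) * expR (3 / 4 * z) <= `|H 1| + B / c0 * expR (z / 2).
        have h5 : - `|H 1| <= H 1 by rewrite lerNl -normrN ler_norm.
        have h4 : H z = w z / v z - (4 / 3 * m) * expR (3 / 4 * z) by [].
        lra.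
      rewrite -(ler_pM2r (expR_gt0 (z / 2))) -[leLHS]mulrA -expRD.
      rewrite (_ : z / 4 + z / 2 = 3 / 4 * z); last by field.
      apply: (le_trans h3); rewrite mulrDl lerD2r ler_peMr//.
      by rewrite -[leLHS]expR0 ler_expR; lra.
    (* By [bound], [e^(z/4) <= Q] for all [z >= 1]; this [z] violates it through
       [1 + z/4 <= e^(z/4)]. *)
    pose Q := (`|H 1| + B / c0) / (4 / 3 * m); pose z := 4 * Q + 1.
    have m43 : 0 < 4 / 3 * m by lra.
    have q0 : 0 <= Q by rewrite divr_ge0// ltW.
    have z1 : 1 <= z by rewrite /z; lra.
    have := bound _ z1; apply/negP; rewrite -ltNge -ltr_pdivrMl//.
    apply: (lt_le_trans _ (expR_ge1Dx _)).
    rewrite mulrC -/Q /z; lra.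
  have [kn|kp|//] := ltgtP k 0; exfalso; last exact: (key _ _ _ _ hw hB dq kp).
  apply: (key (- k) _ _ _ (Kummer_solutionN hw)); last by rewrite oppr_gt0.
    by move=> z z0; rewrite !fctE normrN; exact: hB.
  move=> z z0; have d2 := is_deriveN (dq z z0).
  have <- : (\- (fun z => w z / v z)) = (fun z => (- w) z / v z).
    by apply/funext => y; rewrite !fctE mulNr.
  by apply: (is_derive_eq d2); rewrite !mulNr.
have dq0 (x : R) : 0 < x -> is_derive x 1 (fun z => w z / v z) 0.
  by move=> x0; have := dq x x0; rewrite k0 !mul0r.
exists (w 1 / v 1) => z z0; rewrite -(is_derive0_pos_const dq0 z0).
by rewrite divfK// gt_eqF// v0.
Qed.

Section Kummer_series.
Variables (a b : R) (a1 : -1 < a) (a0 : a != 0) (b1 : -1 < b) (b0 : b != 0).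

Let natD_neq0 (x : R) l : -1 < x -> x != 0 -> x + l%:R != 0.
Proof.
move=> x1 x0; case: l => [|l]; first by rewrite addr0.
by rewrite gt_eqF// -natr1; have : 0 <= l%:R :> R by []; lra.
Qed.

Let natD_gtN1 (x : R) (l : nat) : -1 < x -> -1 < x + l%:R.
Proof. by move=> x1; have : 0 <= l%:R :> R by []; lra. Qed.

Lemma Pochhammer0 (x : R) : -1 < x -> x != 0 -> Pochhammer x 0 = 1.
Proof. by move=> x1 x0; rewrite /Pochhammer addr0 divff// Gamma_neq0. Qed.

Lemma PochhammerS (x : R) l : -1 < x -> x != 0 ->
  Pochhammer x l.+1 = (x + l%:R) * Pochhammer x l.
Proof.
move=> x1 x0; rewrite /Pochhammer -natr1 addrA GammaS ?mulrA//.
- exact: natD_gtN1.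
- exact: natD_neq0.
Qed.

Lemma Pochhammer_neq0 (x : R) l : -1 < x -> x != 0 -> Pochhammer x l != 0.
Proof.
move=> x1 x0; elim: l => [|l IH]; first by rewrite Pochhammer0// oner_neq0.
by rewrite PochhammerS// mulf_neq0// natD_neq0.
Qed.

Definition Kummer_coef l : R := Pochhammer a l / Pochhammer b l / l`!%:R.

Let c := Kummer_coef.

(** Kummer's equation read on the coefficients. *)
Let c_rec l : (b + l%:R) * (l.+1%:R * c l.+1) = (a + l%:R) * c l.
Proof.
rewrite /c /Kummer_coef !PochhammerS// factS natrM.
have := natD_neq0 l b1 b0; have := Pochhammer_neq0 l b1 b0.
have : l`!%:R != 0 :> R by rewrite pnatr_eq0 -lt0n fact_gt0.
have : l.+1%:R != 0 :> R by rewrite pnatr_eq0.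
move: (l.+1%:R : R) (l`!%:R : R) => L F L0 F0 B0 bl0.
by field; rewrite L0 F0 B0 bl0.
Qed.

(** Coefficients dominated by those of [C e^(M z)]. The class is stable under [pseries_diffs] and
    gives convergence at every point, which is all that termwise differentiation requires. *)
Let expbdd (u : R^nat) := exists C M : R, [/\ 0 <= C, 0 <= M &
  forall l, `|u l| <= C * (M ^+ l / l`!%:R)].

Let expbdd_diffs u : expbdd u -> expbdd (pseries_diffs u).
Proof.
move=> [C [M [C0 M0 h]]]; exists (C * M), M; split => //; first exact: mulr_ge0.
move=> l; rewrite /pseries_diffs normrM normr_nat.
apply: (@le_trans _ _ (l.+1%:R * (C * (M ^+ l.+1 / l.+1`!%:R)))).
  by rewrite ler_wpM2l.
rewrite factS natrM exprS le_eqVlt; apply/orP; left; apply/eqP.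
have : l`!%:R != 0 :> R by rewrite pnatr_eq0 -lt0n fact_gt0.
have : l.+1%:R != 0 :> R by rewrite pnatr_eq0.
move: (l.+1%:R : R) (l`!%:R : R) => L F L0 F0.
by field; rewrite L0 F0.
Qed.

Let expbdd_cvg u x : expbdd u -> cvgn (pseries u x).
Proof.
move=> [C [M [C0 M0 h]]]; apply: normed_cvg.
apply: (@series_le_cvg _ _ (C *: (fun l => (M * `|x|) ^+ l / l`!%:R))).
- by move=> n; rewrite normr_ge0.
- by move=> n; rewrite !fctE /GRing.scale/= mulr_ge0// divr_ge0// exprn_ge0// mulr_ge0.
- move=> n; rewrite !fctE /GRing.scale/= normrM normrX exprMn.
  apply: (le_trans (ler_wpM2r _ (h n))); first by rewrite exprn_ge0.
  by rewrite le_eqVlt; apply/orP; left; apply/eqP; ring.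
- apply: is_cvg_seriesZ; exact: is_cvg_series_exp_coeff.
Qed.

Let expbdd_c : expbdd c.
Proof.
(* [m] is such that [m l <= b + l] for [l >= 1], whether [b] is positive or between -1 and 0. The
   ratio at [l = 0] is treated apart, since [b] itself may be negative. *)
pose m := Num.min 1 (1 + b); have m0 : 0 < m by rewrite lt_min ltr01/= -ltrBlDl sub0r.
pose M := `|a / b| + (`|a| + 1) / m.
have M0 : 0 <= M by rewrite addr_ge0// divr_ge0 ?(ltW m0)// addr_ge0.
exists 1, M; split => //.
have ratio l : `|(a + l%:R) / (b + l%:R)| <= M.
  case: l => [|l]; first by rewrite !addr0 lerDl divr_ge0 ?(ltW m0)// addr_ge0.
  apply: (@le_trans _ _ ((`|a| + 1) / m)); last by rewrite lerDr.
  have bl : m * l.+1%:R <= b + l.+1%:R.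
    have l1 : 1 <= l.+1%:R :> R by rewrite ler1n.
    have [b0'|b0'] := leP 0 b.
      apply: (@le_trans _ _ l.+1%:R); last by rewrite lerDr.
      by rewrite ler_piMl// ge_min lexx.
    apply: (@le_trans _ _ ((1 + b) * l.+1%:R)).
      by rewrite ler_wpM2r// ge_min lexx orbT.
    rewrite mulrDl mul1r addrC lerD2r; have : 0 <= - b * (l.+1%:R - 1) by rewrite mulr_ge0//; lra.
    lra.
  have bl0 : 0 < b + l.+1%:R by apply: lt_le_trans bl; rewrite mulr_gt0.
  rewrite normf_div (gtr0_norm bl0) ler_pdivrMr//.
  apply: (@le_trans _ _ ((`|a| + 1) / m * (m * l.+1%:R))); last first.
    by rewrite ler_wpM2l// divr_ge0 ?(ltW m0)// addr_ge0.
  rewrite mulrA divfK ?gt_eqF// mulrDl mul1r.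
  apply: (le_trans (ler_normD _ _)); rewrite normr_nat lerD2r ler_peMr// ler1n//.
elim=> [|l IH].
  by rewrite /c /Kummer_coef !Pochhammer0// fact0 expr0 !divr1 normr1 mul1r.
have e : c l.+1 = (a + l%:R) / (b + l%:R) * c l / l.+1%:R.
  have h1 := natD_neq0 l b1 b0; have h2 : l.+1%:R != 0 :> R by rewrite pnatr_eq0.
  have := c_rec l; move: (l.+1%:R : R) h2 (b + l%:R) h1 => L L0 x x0 h.
  by apply: (mulfI (mulf_neq0 x0 L0)); rewrite -mulrA h; field; rewrite L0 x0.
rewrite e normrM normrM mul1r normfV normr_nat.
rewrite mul1r in IH.
rewrite factS natrM invfM exprS.
rewrite [leRHS](_ : _ = M * (M ^+ l / l`!%:R) / l.+1%:R); last by ring.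
by rewrite ler_wpM2r ?invr_ge0//; apply: ler_pM.
Qed.

Let Phi z := limn (pseries c z).
Let Phi1 z := limn (pseries (pseries_diffs c) z).
Let Phi2 z := limn (pseries (pseries_diffs (pseries_diffs c)) z).

Lemma Kummer_PhiE z : Kummer_Phi a b z = limn (pseries Kummer_coef z).
Proof.
rewrite /Kummer_Phi /pseries; congr (limn (series _)); apply/funext => l.
rewrite -[RHS]/(Kummer_coef l * z ^+ l) /Kummer_coef; ring.
Qed.

Let PhiE : Kummer_Phi a b = Phi.
Proof. by apply/funext => z; rewrite Kummer_PhiE. Qed.

Let is_derive_lim u z : expbdd u ->
  is_derive z 1 (fun x => limn (pseries u x)) (limn (pseries (pseries_diffs u) z)).
Proof.
move=> hu; apply: (@pseries_snd_diffs _ _ (`|z| + 1)); try apply: expbdd_cvg => //.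
- exact: expbdd_diffs.
- exact/expbdd_diffs/expbdd_diffs.
- by rewrite [ltRHS]ger0_norm ?addr_ge0// ltrDl.
Qed.

Lemma continuous_Kummer_Phi : continuous (Kummer_Phi a b).
Proof. by move=> z; rewrite PhiE; apply: is_derive_continuous (is_derive_lim z expbdd_c). Qed.

Lemma Kummer_Phi0 : Kummer_Phi a b 0 = 1.
Proof.
rewrite Kummer_PhiE; apply/cvg_lim => //.
rewrite -(cvg_shiftS (pseries _ 0)); apply: cvg_near_cst; apply: nearW => n.
rewrite /pseries /series /= big_nat_recl// expr0 mulr1 big1 ?addr0.
  by rewrite /Kummer_coef !Pochhammer0// fact0 !divr1.
by move=> i _; rewrite expr0n /= mulr0.
Qed.

Lemma Kummer_Phi_solution :
  exists w1 w2, Kummer_solution a b (Kummer_Phi a b) w1 w2.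
Proof.
exists Phi1, Phi2 => z z0; rewrite PhiE; split.
- exact: is_derive_lim expbdd_c.
- exact: is_derive_lim (expbdd_diffs expbdd_c).
pose d := pseries_diffs c; pose e := pseries_diffs d.
have cc : pseries c z @ \oo --> Phi z by apply: expbdd_cvg expbdd_c.
have cd : pseries d z @ \oo --> Phi1 z by apply: expbdd_cvg; exact: expbdd_diffs expbdd_c.
have ce : pseries e z @ \oo --> Phi2 z.
  by apply: expbdd_cvg; do 2!apply: expbdd_diffs; exact: expbdd_c.
(* The equation already holds for partial sums, provided those multiplied by [a] and [b] have one
   term more than the others: with this offset, each induction step is one instance of [c_rec]. *)
have part n : z * pseries e z n + (b * pseries d z n.+1 - z * pseries d z n)
    - a * pseries c z n.+1 = 0.
  have pS u m : pseries u z m.+1 = pseries u z m + u m * z ^+ m.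
    by rewrite /pseries /series /= big_nat_recr.
  have p0 u : pseries u z 0 = 0 by rewrite /pseries /series /= big_geq.
  elim: n => [|n IH].
    rewrite !pS !p0 !mulr0 !add0r subr0 !expr0 !mulr1 /d /pseries_diffs.
    by have := c_rec 0%N; rewrite !addr0 => h; lra.
  rewrite (pS e) (pS d) (pS d n) (pS c).
  have key : e n + b * d n.+1 - d n - a * c n.+1 = 0.
    have := c_rec n.+1; rewrite /e /d /pseries_diffs => h; lra.
  rewrite [LHS](_ : _ = (z * pseries e z n + (b * pseries d z n.+1 - z * pseries d z n)
     - a * pseries c z n.+1) + z * z ^+ n * (e n + b * d n.+1 - d n - a * c n.+1)).
    by rewrite IH key mulr0 addr0.
  by rewrite (pS d n) exprS; ring.
have : (fun n => z * pseries e z n + (b * pseries d z n.+1 - z * pseries d z n)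
    - a * pseries c z n.+1) @ \oo --> z * Phi2 z + (b * Phi1 z - z * Phi1 z) - a * Phi z.
  apply: cvgB; last first.
    by apply: cvgM; [exact: cvg_cst|rewrite (cvg_shiftS (pseries c z))].
  apply: cvgD; first by apply: cvgM; [exact: cvg_cst|].
  apply: cvgB; last by apply: cvgM; [exact: cvg_cst|].
  by apply: cvgM; [exact: cvg_cst|rewrite (cvg_shiftS (pseries d z))].
under eq_fun do rewrite part.
move=> /(cvg_unique _ (cvg_cst 0)) h.
by rewrite mulrBl -h.
Qed.

End Kummer_series.
End Kummer_equation.

(** * The integral solution of Kummer's equation *)

Section Kummer_integral.
Context {R : realType}.
Notation leb := (@lebesgue_measure R).
Variable m : R.
Hypotheses (m0 : 0 < m) (m1 : m < 1 / 2).
Implicit Types (q x y z : R).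

Let mpos : measurable (`]0, +oo[%classic : set (measurableTypeR R)).
Proof. exact: measurable_itv. Qed.

Let k q z x := x `^ m * (x + z) `^ q * expR (- x).

(** For [q = m] this is [Gamma (m + 1)] times the Tricomi function with parameters [- m] and
    [- (2 * m)]; differentiating in [z] lowers [q] by 1. *)
Definition Kummer_integral q z := \int[leb]_(x in `]0, +oo[) (x `^ m * (x + z) `^ q * expR (- x)).

Let dE x : is_derive x 1 (fun t => expR (- t) : R) (- expR (- x)).
Proof. by have := is_derive1_comp (is_derive_expR (- x)) (is_deriveNid x 1); rewrite mulrN1. Qed.

Let dS q z x : 0 < x + z -> is_derive x 1 (fun x => (x + z) `^ q) (q * (x + z) `^ (q - 1)).
Proof.
move=> xz; have xz' : 0 < z + x by rewrite addrC.
have := is_derive1_comp (is_derive1_powR q xz') (is_derive_shift z x); rewrite mulr1 addrC.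
by rewrite (_ : _ \o _ = fun x => (x + z) `^ q)//; apply/funext => y /=; rewrite addrC.
Qed.

Let ck q z x : 0 <= z -> 0 < x -> {for x, continuous (k q z)}.
Proof.
move=> z0 x0; have xz : 0 < x + z by lra.
apply: is_derive_continuous (is_deriveM (is_deriveM (is_derive1_powR m x0) (dS q xz)) (dE x)).
Qed.

Let mk q z : 0 <= z -> measurable_fun (`]0, +oo[ : set R) (k q z).
Proof. by move=> z0; apply: pos_continuous_measurable => x; exact: ck. Qed.

Let k0 q z x : 0 <= k q z x.
Proof. by rewrite /k !mulr_ge0 ?powR_ge0 ?expR_ge0. Qed.

Let powR_le1 q y : 0 < y -> 0 <= q <= 1 -> y `^ q <= 1 + y.
Proof.
move=> y0 /andP[q0 q1]; have := @powR_le_affine _ q y; rewrite q0 q1 => /(_ isT y0) h.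
apply: (le_trans h); have : q * y <= y by rewrite ler_piMl// ltW.
lra.
Qed.

Let powR_anti q x y : q <= 0 -> 0 < x -> x <= y -> y `^ q <= x `^ q.
Proof.
move=> q0 x0 xy; have y0 : 0 < y by lra.
have -> : q = - (- q) by rewrite opprK.
rewrite !(powRN _ (- q)) lef_pV2 ?posrE ?powR_gt0//.
by apply: ge0_ler_powR; rewrite ?nnegrE; lra.
Qed.

Let powR_bound q z x : q <= 1 -> 0 < z -> 0 < x -> (x + z) `^ q <= z `^ q + 1 + z + x.
Proof.
move=> q1 z0 x0; have xz : 0 < x + z by lra.
have zq := powR_ge0 z q.
have [qn|qp] := leP q 0.
- have : (x + z) `^ q <= z `^ q; last lra.
  by apply: powR_anti => //; lra.
- have := @powR_le1 q _ xz; rewrite (ltW qp) q1 => /(_ isT); lra.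
Qed.

Let k_bound q z x : q <= 1 -> 0 < z -> 0 < x ->
  k q z x <= (z `^ q + 1 + z) * (x `^ (m + 1 - 1) * expR (- x)) +
             x `^ (m + 1 + 1 - 1) * expR (- x).
Proof.
move=> q1 z0 x0; rewrite !addrK.
have -> : x `^ (m + 1) = x `^ m * x.
  by rewrite powRD ?(gt_eqF x0) ?implybT// powRr1// ltW.
have := powR_bound q1 z0 x0 => h.
rewrite /k; have -> : (z `^ q + 1 + z) * (x `^ m * expR (- x)) + x `^ m * x * expR (- x) =
  x `^ m * (z `^ q + 1 + z + x) * expR (- x) by ring.
by rewrite ler_wpM2r ?expR_ge0// ler_wpM2l ?powR_ge0.
Qed.

Let m11 : 0 < m + 1. Proof. move: (m0) => h; lra. Qed.
Let m12 : 0 < m + 1 + 1. Proof. move: (m0) => h; lra. Qed.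

Let bound_integrable c :
  leb.-integrable `]0, +oo[ (EFin \o (fun x => c * (x `^ (m + 1 - 1) * expR (- x)) +
             x `^ (m + 1 + 1 - 1) * expR (- x))).
Proof.
have i1 := integrableZl mpos c (integrable_Euler m11).
by have := integrableD mpos i1 (integrable_Euler m12).
Qed.

Lemma integrable_Kummer q z : q <= 1 -> 0 < z ->
  leb.-integrable `]0, +oo[ (EFin \o (fun x => x `^ m * (x + z) `^ q * expR (- x))).
Proof.
move=> q1 z0; apply: le_integrable (bound_integrable (z `^ q + 1 + z)) => //.
  by apply/measurable_EFinP; apply: mk; exact: ltW.
move=> x /=; rewrite in_itv/= andbT => x0; rewrite lee_fin.
rewrite ger0_norm ?k0// (le_trans (k_bound q1 z0 x0))// ler_norm//.
Qed.

Lemma is_derive_Kummer_integral q z : q <= 1 -> 0 < z ->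
  is_derive z 1 (Kummer_integral q) (q * Kummer_integral (q - 1) z).
Proof.
move=> q1 z0; have q11 : q - 1 <= 1 by lra.
pose f y x := k q y x.
have z2 : 0 < z / 2 by lra.
have z3 : 0 < 2 * z by lra.
have pd y x : 0 < y -> 0 < x -> is_derive y 1 (f ^~ x) (q * k (q - 1) y x).
  move=> y0 x0; have xy : 0 < y + x by lra.
  have d1 := dS q xy.
  have d2 := is_deriveZ (x `^ m * expR (- x)) d1.
  rewrite (_ : f ^~ x = (x `^ m * expR (- x)) \*: (fun y => (y + x) `^ q)); last first.
    apply/funext => t.
    by rewrite -[RHS]/(x `^ m * expR (- x) * (t + x) `^ q) /f /k (addrC x t); ring.
  by apply: (is_derive_eq d2); rewrite /GRing.scale/= /k (addrC y x); ring.
have Ia : (`](z / 2), (2 * z)[%classic : set R) z by rewrite /= in_itv/=; apply/andP; split; lra.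
have inI (y : R) : (`](z / 2), (2 * z)[%classic : set R) y -> z / 2 < y /\ y < 2 * z.
  by rewrite /= in_itv/= => /andP.
have intf y : (`](z / 2), (2 * z)[%classic : set R) y -> leb.-integrable `]0, +oo[ (EFin \o f y).
  by move=> /inI[y1 y2]; apply: integrable_Kummer => //; lra.
have derf y x : (`](z / 2), (2 * z)[%classic : set R) y -> (`]0, +oo[%classic : set R) x -> derivable (f ^~ x) y 1.
  move=> /inI[y1 y2] /=; rewrite in_itv/= andbT => x0.
  by case: (pd y x (lt_trans z2 y1) x0).
(* The sum of the values at both ends of the interval dominates, whichever way [(x + y)^(q-1)] is
   monotone in [y]. *)
pose G x := `|q| * (k (q - 1) (z / 2) x + k (q - 1) (2 * z) x).
have G0 x : 0 <= G x by rewrite mulr_ge0// addr_ge0 ?k0.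
have iG : leb.-integrable `]0, +oo[ (EFin \o G).
  have i1 := integrable_Kummer q11 z2; have i2 := integrable_Kummer q11 z3.
  by have := integrableZl mpos `|q| (integrableD mpos i1 i2).
have Gub y x : (`](z / 2), (2 * z)[%classic : set R) y -> (`]0, +oo[%classic : set R) x -> `|partial1of2 f y x| <= G x.
  move=> /inI[y1 y2] /=; rewrite in_itv/= andbT => x0.
  rewrite partial1of2E; have [_ ->] := pd y x (lt_trans z2 y1) x0.
  rewrite normrM ler_wpM2l// ger0_norm ?k0//.
  rewrite /k -mulrDl -mulrDr ler_wpM2r ?expR_ge0// ler_wpM2l ?powR_ge0//.
  have g1 := powR_ge0 (x + z / 2) (q - 1); have g2 := powR_ge0 (x + 2 * z) (q - 1).
  have [qn|qp] := leP (q - 1) 0.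
  - have : (x + y) `^ (q - 1) <= (x + z / 2) `^ (q - 1); last lra.
    by apply: powR_anti => //; lra.
  - have : (x + y) `^ (q - 1) <= (x + 2 * z) `^ (q - 1); last lra.
    by apply: ge0_ler_powR; rewrite ?nnegrE; lra.
split; first exact: (derivable_under_integral mpos Ia intf derf G0 iG Gub).
rewrite -derive1E (differentiation_under_integral mpos Ia intf derf G0 iG Gub).
rewrite /Kummer_integral -RintegralZl//; last exact: integrable_Kummer.
apply: eq_Rintegral => x; rewrite inE/= in_itv/= andbT => x0.
by rewrite partial1of2E; case: (pd z x z0 x0).
Qed.

(* The integrand of the differential equation is
   [d/dx (- m x^(m+1) (x + z)^(m-1) e^(-x))]. *)
Lemma Kummer_integral_solution :
  Kummer_solution (- m) (- (2 * m)) (Kummer_integral m)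
    (fun z => m * Kummer_integral (m - 1) z)
    (fun z => m * ((m - 1) * Kummer_integral (m - 2) z)).
Proof.
move: (m0) (m1) => hm0 hm1; move=> z z0; have mm1 : m <= 1 by lra.
have mm2 : m - 1 <= 1 by lra.
have mm3 : m - 2 <= 1 by lra.
have e12 : m - 1 - 1 = m - 2 by ring.
split.
- exact: is_derive_Kummer_integral.
- have := is_deriveZ m (is_derive_Kummer_integral mm2 z0); rewrite e12.
  by [].
have i1 := integrable_Kummer mm1 z0; have i2 := integrable_Kummer mm2 z0.
have i3 := integrable_Kummer mm3 z0.
pose c1 := 2 * m + z; pose c2 := (m - 1) * z.
have j2 : leb.-integrable `]0, +oo[ (EFin \o (fun x => c1 * k (m - 1) z x)).
  by have := integrableZl mpos c1 i2.
have j3 : leb.-integrable `]0, +oo[ (EFin \o (fun x => c2 * k (m - 2) z x)).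
  by have := integrableZl mpos c2 i3.
have j23 : leb.-integrable `]0, +oo[ (EFin \o (fun x => c1 * k (m - 1) z x - c2 * k (m - 2) z x)).
  by have := integrableB mpos j2 j3.
have h : \int[leb]_(x in `]0, +oo[)
    (c1 * k (m - 1) z x - c2 * k (m - 2) z x - k m z x) = 0 - 0.
  apply: (@integrable_FTC2_pos _ _ (fun x => x `^ (m + 1) * (x + z) `^ (m - 1) * expR (- x))).
  - by have := integrableB mpos j23 i1.
  - move=> x x0; apply: continuousB; last by apply: ck => //; exact: ltW.
    apply: continuousB; (apply: continuousM; first exact: cst_continuous); apply: ck => //; exact: ltW.
  - move=> x x0; have xz : 0 < x + z by lra.
    have d := is_deriveM (is_deriveM (is_derive1_powR (m + 1) x0) (dS (m - 1) xz)) (dE x).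
    apply: (is_derive_eq d); rewrite /GRing.scale/= !fctE addrK e12 /k /c1 /c2.
    have -> : x `^ (m + 1) = x `^ m * x.
      by rewrite powRD ?(gt_eqF x0) ?implybT// powRr1// ltW.
    have p1 : (x + z) `^ (m - 1) = (x + z) `^ (m - 2) * (x + z).
      rewrite (_ : m - 1 = m - 2 + 1); last by ring.
      by rewrite powRD ?(gt_eqF xz) ?implybT// powRr1// ltW.
    have -> : (x + z) `^ m = (x + z) `^ (m - 2) * (x + z) * (x + z).
      rewrite -p1 {1}(_ : m = m - 1 + 1); last by ring.
      by rewrite powRD ?(gt_eqF xz) ?implybT// powRr1// ltW.
    by rewrite p1; ring.
  - rewrite -[X in _ --> X](mul0r (expR (- 0))); apply: cvgM; last first.
      by apply: cvg_at_right_filter; apply: is_derive_continuous (dE 0).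
    rewrite -[X in _ --> X](mul0r ((0 + z) `^ (m - 1))); apply: cvgM; first exact: powR_cvg0.
    apply: cvg_at_right_filter; apply: (is_derive_continuous (dS (m - 1) _)).
    by rewrite add0r.
  - apply: (@squeeze_cvgr _ _ _ _ (cst 0) (fun x => z `^ (m - 1) * (x `^ (m + 1) * expR (- x)))).
    + near=> x.
      have x0 : 0 < x by near: x; exact: nbhs_pinfty_gt.
      rewrite !mulr_ge0 ?powR_ge0 ?expR_ge0//=.
      rewrite mulrAC [leLHS]mulrC ler_wpM2r ?mulr_ge0 ?powR_ge0 ?expR_ge0//.
      by apply: powR_anti => //; lra.
    + exact: cvg_cst.
    + rewrite -(mulr0 (z `^ (m - 1))); apply: cvgM; first exact: cvg_cst.
      exact: cvg_pow_expN.
rewrite RintegralB// RintegralB// !RintegralZl// subr0 in h.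
rewrite /Kummer_integral.
set I1 := \int[leb]_(x in _) k m z x in h *.
set I2 := \int[leb]_(x in _) k (m - 1) z x in h *.
set I3 := \int[leb]_(x in _) k (m - 2) z x in h *.
have -> : z * (m * ((m - 1) * I3)) + (- (2 * m) - z) * (m * I2) - - m * I1 =
  - m * (c1 * I2 - c2 * I3 - I1) by rewrite /c1 /c2; ring.
by rewrite h mulr0.
Unshelve. all: by end_near. Qed.

Let gk0 : 0 < 2 * m + 1. Proof. move: (m0) => h; lra. Qed.

Let k_ge x z : 0 < z -> 0 < x -> x `^ (2 * m + 1 - 1) * expR (- x) <= k m z x.
Proof.
move: (m0) (m1) => hm0 hm1.
move=> z0 x0; rewrite addrK /k ler_wpM2r ?expR_ge0//.
rewrite (_ : 2 * m = m + m); last by ring.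
rewrite powRD ?(gt_eqF x0) ?implybT// ler_wpM2l ?powR_ge0//.
by apply: ge0_ler_powR; rewrite ?nnegrE; lra.
Qed.

Let k_le x z : 0 < z -> 0 < x ->
  k m z x <= x `^ (2 * m + 1 - 1) * expR (- x) + z `^ m * (x `^ (m + 1 - 1) * expR (- x)).
Proof.
move: (m0) (m1) => hm0 hm1 z0 x0; have xz : 0 < x + z by lra.
(* Subadditivity of the power [m < 1]: for [y = x] and [y = z] the ratio [y / (x + z)] is at most 1,
   hence at most its own power [m], and the two ratios add up to 1. *)
have sub : (x + z) `^ m <= x `^ m + z `^ m.
  have h y : 0 < y -> y <= x + z -> y / (x + z) * (x + z) `^ m <= y `^ m.
    move=> y0 yx; rewrite -[in leRHS](divfK (lt0r_neq0 xz) y).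
    have yz : 0 < y / (x + z) by rewrite divr_gt0.
    rewrite powRM ?(ltW yz) ?(ltW xz)// ler_wpM2r ?powR_ge0//.
    apply: ger1_powR; last lra.
    by rewrite yz/= ler_pdivrMr// mul1r.
  have h1 := h _ x0; have h2 := h _ z0.
  have e : (x + z) `^ m = x / (x + z) * (x + z) `^ m + z / (x + z) * (x + z) `^ m.
    by rewrite -mulrDl -mulrDl divff ?mul1r// gt_eqF.
  by rewrite e lerD// ?h1 ?h2//; lra.
rewrite !addrK (_ : 2 * m = m + m); last by ring.
rewrite powRD ?(gt_eqF x0) ?implybT//.
have -> : x `^ m * x `^ m * expR (- x) + z `^ m * (x `^ m * expR (- x)) =
  x `^ m * (x `^ m + z `^ m) * expR (- x) by ring.
by rewrite /k ler_wpM2r ?expR_ge0// ler_wpM2l ?powR_ge0.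
Qed.

Let Kummer_integral_bounds z : 0 < z ->
  Gamma (2 * m + 1) <= Kummer_integral m z <= Gamma (2 * m + 1) + z `^ m * Gamma (m + 1).
Proof.
move: (m0) (m1) => hm0 hm1; move=> z0; have mm1 : m <= 1 by lra.
have i1 := integrable_Kummer mm1 z0.
have i2 := integrable_Euler gk0; have i3 := integrable_Euler m11.
have i4 : leb.-integrable `]0, +oo[ (EFin \o (fun x => z `^ m * (x `^ (m + 1 - 1) * expR (- x)))).
  by have := integrableZl mpos (z `^ m) i3.
rewrite !Gamma_pos//; apply/andP; split.
  apply: le_Rintegral => // x /=; rewrite in_itv/= andbT => x0; exact: k_ge.
rewrite /Euler_integral -RintegralZl// -RintegralD//.
apply: le_Rintegral => //; first by have := integrableD mpos i2 i4.
by move=> x /=; rewrite in_itv/= andbT => x0; exact: k_le.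
Qed.

(** The growth is only that of [z^m]. The rate 1/8 is chosen for [Kummer_comparison], where [v^2]
    then costs no more than [e^(z/4)]; the factor 8 comes from [1 + z <= 8 (1 + z/8)]. *)
Lemma Kummer_integral_exp_bound : exists A, forall z, 0 < z ->
  Gamma (2 * m + 1) <= Kummer_integral m z <= A * expR (z / 8).
Proof.
move: (m0) (m1) => hm0 hm1.
exists (Gamma (2 * m + 1) + 8 * Gamma (m + 1)) => z z0.
have /andP[-> h] /= := Kummer_integral_bounds z0; apply: (le_trans h).
have G1 := Gamma_gt0 gk0; have G2 := Gamma_gt0 m11.
have e1 : 1 + z / 8 <= expR (z / 8) by exact: expR_ge1Dx.
have zm : z `^ m <= 1 + z by apply: powR_le1 => //; apply/andP; split; lra.
rewrite [leRHS]mulrDl lerD//; first by rewrite ler_peMr ?(ltW G1)//; lra.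
rewrite [leRHS]mulrAC ler_wpM2r ?(ltW G2)//; lra.
Qed.

Lemma cvg_Kummer_integral0 : Kummer_integral m z @[z --> 0^'+] --> Gamma (2 * m + 1).
Proof.
apply: (@squeeze_cvgr _ _ _ _ (cst (Gamma (2 * m + 1)))
  (fun z => Gamma (2 * m + 1) + z `^ m * Gamma (m + 1))).
- near=> z; apply: Kummer_integral_bounds.
  by near: z; exact: nbhs_right_gt.
- exact: cvg_cst.
- rewrite -[X in _ --> X]addr0; apply: cvgD; first exact: cvg_cst.
  rewrite -[X in _ --> X](mul0r (Gamma (m + 1))); apply: cvgM; last exact: cvg_cst.
  exact: powR_cvg0.
Unshelve. all: by end_near. Qed.

End Kummer_integral.

(** * Identification of the Tricomi function with the integral *)

Section Tricomi.
Context {R : realType}.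
Variable alpha : R.
Hypothesis halpha : 1 < alpha < 2.
Let m := (alpha - 1) / 2.

Let m0 : 0 < m. Proof. move: (halpha) => /andP[h1 h2]; rewrite /m; lra. Qed.
Let m1 : m < 1 / 2. Proof. move: (halpha) => /andP[h1 h2]; rewrite /m; lra. Qed.

Let a : R := (1 - alpha) / 2.
Let b : R := 1 - alpha.

Let a1 : -1 < a. Proof. move: (halpha) => /andP[h1 h2]; rewrite /a; lra. Qed.
Let a0 : a != 0. Proof. move: (halpha) => /andP[h1 h2]; rewrite lt_eqF// /a; lra. Qed.
Let b1 : -1 < b. Proof. move: (halpha) => /andP[h1 h2]; rewrite /b; lra. Qed.
Let b0 : b != 0. Proof. move: (halpha) => /andP[h1 h2]; rewrite lt_eqF// /b; lra. Qed.

(** The substitution [w = z^(1-b) v] turns Kummer's equation for [a], [b] into the one for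
    [1 + a - b], [2 - b]. *)
Let second_solution : exists w1 w2,
  Kummer_solution a b (fun z => z `^ (1 - b) * Kummer_Phi (1 + a - b) (2 - b) z) w1 w2.
Proof.
move: (halpha) => /andP[ha1 ha2].
have [||||v1 [v2 hv]] := @Kummer_Phi_solution R (1 + a - b) (2 - b);
  rewrite ?gt_eqF//; rewrite /a /b; try lra.
rewrite -/a -/b in hv *.
set v := Kummer_Phi _ _ in hv *.
(* The powers of [z] below are written as [p z] times a monomial, so that [ring] can factor the
   equation. *)
pose p z := z `^ (1 - b - 2).
have p1 (z : R) : 0 < z -> z `^ (1 - b - 1) = p z * z.
  move=> z0; rewrite /p -{3}(@powRr1 _ z) ?(ltW z0)// -powRD; last by rewrite (gt_eqF z0) implybT.
  by congr powR; ring.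
have p0 (z : R) : 0 < z -> z `^ (1 - b) = p z * z * z.
  move=> z0; rewrite -p1// -{3}(@powRr1 _ z) ?(ltW z0)// -powRD; last by rewrite (gt_eqF z0) implybT.
  by congr powR; ring.
exists (fun z => z `^ (1 - b) * v1 z + (1 - b) * z `^ (1 - b - 1) * v z),
  (fun z => z `^ (1 - b) * v2 z + 2 * (1 - b) * z `^ (1 - b - 1) * v1 z +
            (1 - b) * (1 - b - 1) * p z * v z) => z z0.
have [dv dv1 ev] := hv _ z0.
have d1 := is_derive1_powR (1 - b) z0; have d2 := is_derive1_powR (1 - b - 1) z0.
have e2 : 1 - b - 1 - 1 = 1 - b - 2 by ring.
split.
- by apply: (is_derive_eq (is_deriveM d1 dv)); rewrite /GRing.scale/=; ring.
- rewrite e2 in d2.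
  have d3 : is_derive z 1 (fun z : R => (1 - b) * z `^ (1 - b - 1)) ((1 - b) * ((1 - b - 1) * p z)).
    by apply: (is_derive_eq (is_deriveZ (1 - b) d2)).
  have d := is_deriveD (is_deriveM d1 dv1) (is_deriveM d3 dv).
  by apply: (is_derive_eq d); rewrite /GRing.scale/=; ring.
rewrite p0// p1//.
have -> : z * (p z * z * z * v2 z + 2 * (1 - b) * (p z * z) * v1 z +
     (1 - b) * (1 - b - 1) * p z * v z) +
   (b - z) * (p z * z * z * v1 z + (1 - b) * (p z * z) * v z) -
   a * (p z * z * z * v z) =
   p z * z * z * (z * v2 z + (2 - b - z) * v1 z - (1 + a - b) * v z) by ring.
by rewrite ev mulr0.
Qed.

(* Both sides solve Kummer's equation, and the growth bound excludes any other
   solution than a multiple of the integral; compare the limits at 0. *)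
Lemma Tricomi_Psi_integral (C B : R) :
  (forall z : R, 0 < z -> `|C * Tricomi_Psi a b z| <= B * expR (z / 2)) ->
  forall z, 0 < z ->
  C * Tricomi_Psi a b z = C / Gamma ((1 + alpha) / 2) * Kummer_integral m m z.
Proof.
move: (halpha) (m0) => /andP[ha1 ha2] hm0 hB.
have [u1 [u2 hu]] := Kummer_Phi_solution a1 a0 b1 b0.
have [v1 [v2 hv]] := second_solution.
set u := Kummer_Phi a b in hu *; set v := (fun z => z `^ _ * _) in hv *.
pose c1 := C * (Gamma (1 - b) / Gamma (1 + a - b)).
(* [c2] never has to be evaluated: the second solution carries [z^(1-b)] with [0 < 1 - b] and
   vanishes at 0, so that [c1] alone is matched with the limit of the integral. *)
pose c2 := C * (Gamma (b - 1) / Gamma a).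
have wE : (fun z => C * Tricomi_Psi a b z) = (fun z => c1 * u z + c2 * v z).
  by apply/funext => z; rewrite /Tricomi_Psi /c1 /c2 /v /u; ring.
have hw : Kummer_solution a b (fun z => C * Tricomi_Psi a b z)
    (fun z => c1 * u1 z + c2 * v1 z) (fun z => c1 * u2 z + c2 * v2 z).
  rewrite wE => z z0; have [du du1 eu] := hu _ z0; have [dv dv1 ev] := hv _ z0; split.
  - exact: (is_deriveD (is_deriveZ c1 du) (is_deriveZ c2 dv)).
  - exact: (is_deriveD (is_deriveZ c1 du1) (is_deriveZ c2 dv1)).
  - have -> : z * (c1 * u2 z + c2 * v2 z) + (b - z) * (c1 * u1 z + c2 * v1 z) -
      a * (c1 * u z + c2 * v z) = c1 * (z * u2 z + (b - z) * u1 z - a * u z) +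
      c2 * (z * v2 z + (b - z) * v1 z - a * v z) by ring.
    by rewrite eu ev !mulr0 addr0.
have hI := Kummer_integral_solution m0 m1.
rewrite (_ : - m = a) in hI; last by rewrite /m /a; lra.
rewrite (_ : - (2 * m) = b) in hI; last by rewrite /m /b; lra.
have [A hA] := Kummer_integral_exp_bound m0 m1.
have mg : 0 < 2 * m + 1 by lra.
have [|k hk] := Kummer_comparison _ hw hI (Gamma_gt0 mg) hA hB; first by rewrite /b; lra.
suff -> : C / Gamma ((1 + alpha) / 2) = k by [].
have am : 2 * m + 1 = alpha by rewrite /m; field.
have l1 : k * Kummer_integral m m z @[z --> 0^'+] --> k * Gamma alpha.
  rewrite -am; apply: cvgM; [exact: cvg_cst|exact: cvg_Kummer_integral0].
have l2 : k * Kummer_integral m m z @[z --> 0^'+] --> c1 * 1 + c2 * (0 * Kummer_Phi (1 + a - b) (2 - b) 0).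
  apply: (@cvg_trans _ ((fun z => c1 * u z + c2 * v z) @ 0^'+)).
    apply: near_eq_cvg; near=> z; rewrite -hk; last by near: z; exact: nbhs_right_gt.
    by have := congr1 (fun f => f z) wE.
  apply: cvgD; (apply: cvgM; first exact: cvg_cst).
    rewrite -(Kummer_Phi0 a1 a0 b1 b0); apply: cvg_at_right_filter.
    exact: continuous_Kummer_Phi.
  apply: cvgM; first by apply: powR_cvg0; rewrite /b; lra.
  apply: cvg_at_right_filter; apply: continuous_Kummer_Phi; rewrite ?gt_eqF//; rewrite /a /b; lra.
have : k * Gamma alpha = c1 * 1 + c2 * (0 * Kummer_Phi (1 + a - b) (2 - b) 0).
  by apply: (cvg_unique _ l1).
rewrite mul0r mulr0 addr0 mulr1 /c1.
rewrite (_ : 1 - b = alpha); last by rewrite /b; ring.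
rewrite (_ : 1 + a - b = (1 + alpha) / 2); last by rewrite /a /b; field.
have G0 : 0 < Gamma alpha by apply: Gamma_gt0; lra.
move=> h; apply: (mulIf (lt0r_neq0 G0)); rewrite h; ring.
Unshelve. all: by end_near. Qed.

(** The duplication formula at [alpha] puts the constant in the form that [Tricomi_Psi_integral]
    cancels: the covariance becomes the integral divided by [Gamma alpha]. *)
Lemma C_coefE : C_coef alpha = Gamma ((1 + alpha) / 2) / Gamma alpha.
Proof.
move: (halpha) => /andP[ha1 ha2].
have G0 : 0 < Gamma alpha by apply: Gamma_gt0; lra.
have G1 : 0 < Gamma (alpha / 2) by apply: Gamma_gt0; lra.
have := @Gamma_duplication R alpha; rewrite [1 + alpha]addrC => h.
rewrite /C_coef; apply/eqP; rewrite eqr_div ?lt0r_neq0//; apply/eqP.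
by rewrite mulrC [RHS]mulrC h//; [ring|lra].
Qed.

End Tricomi.

(** * Logarithmic substitution *)

Section log_substitution.
Context {R : realType}.
Notation leb := (@lebesgue_measure R).
Implicit Types (s t x : R).

Let dF s x : is_derive x 1 (fun x => s * expR (- x)) (- (s * expR (- x))).
Proof.
have dE : is_derive x 1 (fun t => expR (- t) : R) (- expR (- x)).
  by have := is_derive1_comp (is_derive_expR (- x)) (is_deriveNid x 1); rewrite mulrN1.
by apply: (is_derive_eq (is_deriveZ s dE)); rewrite /GRing.scale/= mulrN.
Qed.

Let image_exhaustion s (n : nat) : set R :=
  `[s * expR (- n.+1%:R), s * expR (- (n.+1%:R)^-1)].

Let image_exhaustionP s n x : 0 < s -> 0 < x ->
  image_exhaustion s n x <-> pos_exhaustion n (ln s - ln x).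
Proof.
move=> s0 x0; rewrite /image_exhaustion /pos_exhaustion /= !in_itv/=.
rewrite -{1 2}(lnK (x := x)) ?posrE// -{1 2}(lnK (x := s)) ?posrE// -!expRD !ler_expR.
move: (n.+1%:R^-1 : R) (n.+1%:R : R) => q p.
by split => /andP[h1 h2]; apply/andP; split; lra.
Qed.

(** The change of variable [u = s e^(-x)] is made between compact intervals, and both sides pass to
    the limit by monotone convergence. *)
Lemma integral_log_substitution (h : R -> R) s : 0 < s ->
  (forall x : R, 0 < x -> {for x, continuous h}) ->
  (forall x : R, 0 < x -> 0 <= h x) ->
  (\int[leb]_(u in `]0%R, s[) (h (ln s - ln u))%:E =
   \int[leb]_(x in `]0%R, +oo[) (s * (h x * expR (- x)))%:E)%E.
Proof.
move=> s0 ch h0.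
pose G u := h (ln s - ln u); pose H x := s * (h x * expR (- x)).
have cG u : 0 < u -> u < s -> {for u, continuous G}.
  move=> u0 us; have d1 := is_deriveB (is_derive_cst (ln s) u 1) (is_derive1_ln u0).
  apply: (@continuous_comp _ _ _ (fun u => ln s - ln u) h).
    exact: is_derive_continuous d1.
  by apply: ch; rewrite subr_gt0 ltr_ln ?posrE.
have cH x : 0 < x -> {for x, continuous H}.
  move=> x0; apply: continuousM; first exact: cst_continuous.
  apply: continuousM; first exact: ch.
  by apply: is_derive_continuous; have := is_derive1_comp (is_derive_expR (- x)) (is_deriveNid x 1).
have H0 x : 0 < x -> 0 <= H x.
  by move=> x0; rewrite mulr_ge0 ?(ltW s0)// mulr_ge0 ?h0 ?expR_ge0.
have cup : \bigcup_n image_exhaustion s n = `]0, s[%classic.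
  apply/seteqP; split => x /=.
    move=> [n _]; rewrite /image_exhaustion/= !in_itv/= => /andP[h1 h2].
    rewrite (lt_le_trans _ h1) ?mulr_gt0 ?expR_gt0//=.
    by rewrite (le_lt_trans h2)// gtr_pMr// expR_lt1 oppr_lt0 invr_gt0.
  rewrite in_itv/= => /andP[x0 xs].
  have : (`]0, +oo[%classic : set R) (ln s - ln x).
    by rewrite /= in_itv/= andbT subr_gt0 ltr_ln ?posrE.
  by rewrite -bigcup_pos_exhaustion => -[n _ hn]; exists n => //; apply/image_exhaustionP.
have nd : nondecreasing_seq (image_exhaustion s).
  apply/nondecreasing_seqP => n; apply/subsetPset => x /= hx.
  have x0 : 0 < x.
    move: hx; rewrite /image_exhaustion/= in_itv/= => /andP[+ _].
    by apply: lt_le_trans; rewrite mulr_gt0 ?expR_gt0.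
  apply/image_exhaustionP => //; have /image_exhaustionP := hx => /(_ s0 x0).
  by have /subsetPset := @nondecreasing_pos_exhaustion R _ _ (leqnSn n); exact.
have sub n : image_exhaustion s n `<=` `]0, s[ by rewrite -cup => x; exists n.
have mG : measurable_fun (`]0, s[ : set R) G.
  apply: open_continuous_measurable_fun; first exact: interval_open.
  by move=> u; rewrite inE/= in_itv/= => /andP[]; exact: cG.
have l1 : (\int[leb]_(u in image_exhaustion s n) (G u)%:E)%E @[n --> \oo] -->
    (\int[leb]_(u in `]0%R, s[) (G u)%:E)%E.
  rewrite -cup; apply: ge0_nondecreasing_set_cvg_integral => //.
  - by move=> n; exact: measurable_itv.
  - by move=> n; apply/measurable_EFinP; apply: measurable_funS mG => //; exact: sub.
  - move=> n x /sub /=; rewrite in_itv/= lee_fin => /andP[x0 xs].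
    by apply: h0; rewrite subr_gt0 ltr_ln ?posrE.
have l2 := cvg_integral_pos (pos_continuous_measurable cH) H0.
apply: (cvg_unique _ l1) => //.
rewrite (_ : (fun n : nat => _) = (fun n => \int[leb]_(x in pos_exhaustion n) (H x)%:E)%E)//.
apply/funext => n; rewrite /image_exhaustion /pos_exhaustion.
have F' : (fun x : R => s * expR (- x))^`()%classic = (fun x => - (s * expR (- x))).
  by apply/funext => x; rewrite derive1E; case: (dF s x).
have cF' x : {for x, continuous (fun x : R => - (s * expR (- x)))}.
  by apply: continuousN; exact: is_derive_continuous (dF s x).
rewrite (@integration_by_substitution_decreasing R (fun x => s * expR (- x)) G).
- apply: eq_integral => x; rewrite inE/= in_itv/= => /andP[x1 x2].
  have x0 : 0 < x by apply: lt_le_trans x1.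
  rewrite F' /H; congr EFin.
  change (h (ln s - ln (s * expR (- (x : R)))) * - - (s * expR (- (x : R))) = s * (h x * expR (- x))).
  rewrite lnM ?posrE ?expR_gt0// expRK opprK.
  by rewrite (_ : ln s - (ln s - x) = x); ring.
- exact: inv_natS_le_natS.
- by move=> x y _ _ xy; rewrite ltr_pM2l// ltr_expR ltrN2.
- by rewrite F' => x _; exact: cF'.
- rewrite F'; apply/cvg_ex; eexists; apply: cvg_at_right_filter; exact: cF'.
- rewrite F'; apply/cvg_ex; eexists; apply: cvg_at_left_filter; exact: cF'.
- split.
  + by move=> x _; case: (dF s x).
  + by apply: cvg_at_right_filter; apply: is_derive_continuous (dF s _).
  + by apply: cvg_at_left_filter; apply: is_derive_continuous (dF s _).
- apply: continuous_in_subspaceT => u; rewrite inE/= => us.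
  by have /= := sub n u us; rewrite in_itv/= => /andP[]; exact: cG.
Qed.

Lemma log_excess_ge s u : s <= u -> log_excess s u = 0.
Proof.
move=> su; rewrite /log_excess; case: ifPn => // s0; apply: max_r.
by rewrite subr_le0 ler_ln ?posrE// (lt_le_trans s0).
Qed.

Lemma log_excess_lt s u : 0 < u -> u < s -> log_excess s u = ln s - ln u.
Proof.
move=> u0 us; rewrite /log_excess (lt_trans u0 us); apply: max_l.
by rewrite subr_ge0 ler_ln ?posrE ?(lt_trans u0 us)// ltW.
Qed.

Lemma log_excess_ge0 s u : 0 <= log_excess s u.
Proof. by rewrite /log_excess; case: ifPn => // _; rewrite le_max lexx orbT. Qed.

Lemma measurable_log_excess s : measurable_fun setT (log_excess s).
Proof.
have [s0|/negbTE s0] := boolP (0 < s); last first.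
  rewrite (_ : log_excess s = cst 0); first exact: measurable_cst.
  by apply/funext => u; rewrite /log_excess s0.
rewrite (_ : log_excess s = fun u => Num.max (ln s - ln u) 0); last first.
  by apply/funext => u; rewrite /log_excess s0.
by apply: measurable_maxr => //; apply: measurable_funB.
Qed.

Let integral_log_excess_restrict (f : R -> R) s : (forall u, s <= u -> f u = 0) -> 0 < s ->
  (\int[leb]_(u in `]0%R, +oo[) (f u)%:E = \int[leb]_(u in `]0%R, s[) (f u)%:E)%E.
Proof.
move=> f0 s0; rewrite integral_mkcond [RHS]integral_mkcond; apply: eq_integral => u _.
rewrite !patchE; case: ifPn; rewrite ?inE ?notin_setE/= !in_itv/= ?andbT => u0.
- case: ifPn; rewrite ?inE ?notin_setE/= !in_itv/= u0//= => /negP; rewrite -leNgt => su.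
  by rewrite f0.
- case: ifPn => //; rewrite inE/= in_itv/= => /andP[u1 _].
  by rewrite u1 in u0.
Qed.

Variable m : R.
Hypotheses (m0 : 0 < m) (m1 : m < 1 / 2).

Lemma integral_log_excessM s t : 0 < s -> s < t ->
  (\int[leb]_(u in `]0%R, +oo[) (log_excess s u `^ m * log_excess t u `^ m)%:E =
   (s * Kummer_integral m m (ln (t / s)))%:E)%E.
Proof.
move=> s0 st; move: (m0) (m1) => hm0 hm1; have t0 : 0 < t by lra.
set z := ln (t / s); have z0 : 0 < z by rewrite ln_gt0// ltr_pdivlMr// mul1r.
rewrite (@integral_log_excess_restrict _ s)//; last first.
  by move=> u su; rewrite log_excess_ge// powR0 ?mul0r// gt_eqF.
have zE : z = ln t - ln s by rewrite /z ln_div.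
pose h x := x `^ m * (x + z) `^ m.
have ch x : 0 < x -> {for x, continuous h}.
  move=> x0; have xz : 0 < x + z by lra.
  apply: continuousM; first exact: is_derive_continuous (is_derive1_powR _ x0).
  have xz' : 0 < z + x by lra.
  have -> : (fun y : R => (y + z) `^ m) = (@powR R ^~ m) \o (fun y => z + y).
    by apply/funext => y /=; rewrite addrC.
  exact: is_derive_continuous (is_derive1_comp (is_derive1_powR m xz') (is_derive_shift z x)).
have h0 x : 0 < x -> 0 <= h x by move=> x0; rewrite mulr_ge0 ?powR_ge0.
have i1 : leb.-integrable `]0, +oo[ (EFin \o (fun x => x `^ m * (x + z) `^ m * expR (- x))).
  by apply: integrable_Kummer => //; lra.
apply: (etrans _ (etrans (integral_log_substitution s0 ch h0) _)).
  apply: eq_integral => u; rewrite inE/= in_itv/= => /andP[u0 us].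
  rewrite log_excess_lt// log_excess_lt ?(lt_trans us)// /h zE.
  by congr (_ * _ `^ _)%:E; ring.
under eq_integral do rewrite EFinM.
rewrite ge0_integralZl_EFin ?(ltW s0)//; last 2 first.
- by move=> x _; rewrite lee_fin !mulr_ge0 ?powR_ge0 ?expR_ge0.
- exact: (measurable_int _ i1).
rewrite EFinM; congr (_ * _)%E; rewrite /Kummer_integral /Rintegral fineK//.
by apply: integrable_fin_num.
Qed.

Lemma integral_log_excess_pow s p : 0 < s -> 0 < p ->
  (\int[leb]_(u in `]0%R, +oo[) (log_excess s u `^ p)%:E = (s * Gamma (p + 1))%:E)%E.
Proof.
move=> s0 p0; have p1 : 0 < p + 1 by lra.
rewrite (@integral_log_excess_restrict _ s)//; last first.
  by move=> u su; rewrite log_excess_ge// powR0 // gt_eqF.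
have ch x : 0 < x -> {for x, continuous (fun x : R => x `^ p)}.
  by move=> x0; exact: is_derive_continuous (is_derive1_powR _ x0).
have h0 x : 0 < x -> 0 <= x `^ p by move=> _; exact: powR_ge0.
have i1 : leb.-integrable `]0, +oo[ (EFin \o (fun x => x `^ p * expR (- x))).
  by have := integrable_Euler p1; rewrite addrK.
apply: (etrans _ (etrans (integral_log_substitution s0 ch h0) _)).
  apply: eq_integral => u; rewrite inE/= in_itv/= => /andP[u0 us].
  by rewrite log_excess_lt.
under eq_integral do rewrite EFinM.
rewrite ge0_integralZl_EFin ?(ltW s0)//; last 2 first.
- by move=> x _; rewrite lee_fin mulr_ge0 ?powR_ge0 ?expR_ge0.
- exact: (measurable_int _ i1).
rewrite EFinM; congr (_ * _)%E; rewrite Gamma_pos// /Euler_integral addrK /Rintegral fineK//.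
exact: integrable_fin_num.
Qed.

End log_substitution.

(** * Arrival times *)

Section density.
Context d d' (T : measurableType d) (T' : measurableType d') (R : realType).
Variables (mu : {measure set T -> \bar R}) (nu : {measure set T' -> \bar R}).
Variables (phi : T -> T') (g : T -> R).
Hypotheses (mphi : measurable_fun setT phi) (mg : measurable_fun setT g).
Hypothesis g0 : forall x, 0 <= g x.
Hypothesis nuE : forall A, measurable A ->
  nu A = (\int[mu]_(x in phi @^-1` A) (g x)%:E)%E.
Local Open Scope ereal_scope.

Let integral_density_indic A : measurable A ->
  \int[nu]_x (\1_A x)%:E = \int[mu]_x ((\1_A (phi x))%:E * (g x)%:E).
Proof.
move=> mA; have mphiA : measurable (phi @^-1` A).
  by rewrite -[X in measurable X]setTI; exact: mphi.
rewrite integral_indic// setIT nuE// integral_mkcond.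
apply: eq_integral => x _; rewrite patchE indicE.
rewrite (_ : (phi x \in A) = (x \in phi @^-1` A)).
  by case: ifPn => xA; rewrite ?mul1e ?mul0e.
by apply/idP/idP => /set_mem h; exact/mem_set.
Qed.

Import HBNNSimple.

Let integral_density_nnsfun (h : {nnsfun T' >-> R}) :
  \int[nu]_x (h x)%:E = \int[mu]_x ((h (phi x))%:E * (g x)%:E).
Proof.
under [LHS]eq_integral do rewrite fimfunE -fsumEFin//.
under [RHS]eq_integral.
  move=> x _; rewrite fimfunE -fsumEFin// ge0_mule_fsuml; last first.
    by move=> r; rewrite EFinM nnfun_muleindic_ge0.
  over.
have mi (r : R) : measurable_fun setT (fun x => (\1_(h @^-1` [set r]) x)%:E : \bar R).
  by apply/measurable_EFinP; exact: measurable_indic.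
have mi' (r : R) : measurable_fun setT (fun x => (\1_(h @^-1` [set r]) (phi x))%:E : \bar R).
  exact: (measurableT_comp (mi r) mphi).
rewrite !ge0_integral_fsum//; last 4 first.
- move=> r; apply: emeasurable_funM; last exact/measurable_EFinP.
  by under eq_fun do rewrite EFinM; apply: measurable_funeM.
- move=> r x _; apply: mule_ge0; last by rewrite lee_fin.
  by rewrite EFinM nnfun_muleindic_ge0.
- by move=> r; under eq_fun do rewrite EFinM; apply: measurable_funeM.
- by move=> r x _; rewrite EFinM nnfun_muleindic_ge0.
apply: eq_fsbigr => r _.
have [r0|r0] := leP 0%R r; last first.
  rewrite !integral0_eq// => x _; rewrite preimage_nnfun0// indic0 mulr0//.
  by rewrite mul0e.
under [LHS]eq_integral do rewrite EFinM.
under [RHS]eq_integral do rewrite EFinM -muleA.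
rewrite !ge0_integralZl_EFin//; last 2 first.
- by move=> x _; rewrite mule_ge0 ?lee_fin.
- by apply: emeasurable_funM => //; exact/measurable_EFinP.
by rewrite integral_density_indic.
Qed.

(** Indicators, then simple functions, then monotone limits. The map [phi] allows the two measures
    to live on different sigma-algebras over one set: later uses take it to be the identity from a
    space to the same space with a smaller sigma-algebra. *)
Lemma ge0_integral_density (f : T' -> \bar R) : (forall x, 0 <= f x) ->
  measurable_fun setT f -> \int[nu]_x f x = \int[mu]_x (f (phi x) * (g x)%:E).
Proof.
move=> f0 mf; pose h := nnsfun_approx measurableT mf.
have hf x : (h n x)%:E @[n --> \oo] --> f x by apply: cvg_nnsfun_approx.
have hnd x : {homo (fun n => (h n x)%:E) : a b / (a <= b)%N >-> a <= b}.
  by move=> a b ab; rewrite lee_fin; exact/lefP/nd_nnsfun_approx.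
have mh n : measurable_fun setT (fun x => (h n x)%:E) by exact/measurable_EFinP.
have mh' n : measurable_fun setT (fun x => (h n (phi x))%:E).
  exact: (measurableT_comp (mh n) mphi).
transitivity (\int[nu]_x lim ((h n x)%:E @[n --> \oo])).
  by apply: eq_integral => x _; apply/esym/cvg_lim => //; exact: hf.
rewrite monotone_convergence//; last by move=> n x _; rewrite lee_fin.
rewrite (_ : (fun n => _) = (fun n => \int[mu]_x ((h n (phi x))%:E * (g x)%:E))); last first.
  by apply/funext => n; exact: integral_density_nnsfun.
rewrite -monotone_convergence//.
- apply: eq_integral => x _; apply/cvg_lim => //.
  by under eq_fun do rewrite muleC; rewrite muleC; apply: cvgeZl => //; exact: hf.
- by move=> n; apply: emeasurable_funM => //; exact/measurable_EFinP.
- by move=> n x _; rewrite mule_ge0 ?lee_fin.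
- by move=> x _ a b ab; rewrite lee_wpmul2r ?lee_fin//; exact: hnd.
Qed.

End density.

Section translation.
Context {R : realType}.
Notation leb := (@lebesgue_measure R).
Local Open Scope ereal_scope.

Lemma ge0_integral_translation (f : R -> \bar R) (s : R) (D : set R) : measurable D ->
  measurable_fun D f -> (forall x, D x -> 0 <= f x) ->
  \int[leb]_(x in D) f x = \int[leb]_(x in (fun x => s + x)%R @^-1` D) f (s + x)%R.
Proof.
move=> mD mf f0.
have ms : measurable_fun setT ((fun x : R => s + x)%R : measurableTypeR R -> measurableTypeR R).
  exact: measurable_funD.
have f0' : {in D, forall x, 0 <= f x} by move=> x; rewrite inE; exact: f0.
have E := @ge0_integral_pushforward _ _ _ _ _ _ ms lebesgue_measure D f mD mf f0'.
rewrite -[RHS]E.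
apply: eq_measure_integral => A mA _.
apply: (@lebesgue_measure_unique R (image_measure leb ms)) => //.
move=> _ [[a b]] _ <-; rewrite /= /pushforward.
rewrite (_ : _ @^-1` _ = `](a - s)%R, (b - s)%R]%classic); last first.
  by apply/seteqP; split => x /=; rewrite !in_itv/= => /andP[h1 h2]; apply/andP; split; lra.
rewrite !lebesgue_measure_itv/= !lte_fin ltrD2r.
by case: ifPn => // _; rewrite -!EFinB; congr EFin; ring.
Qed.

End translation.

(** * An exponential clock with variable rate *)

Section exponential_clock.
Context {R : realType}.
Notation leb := (@lebesgue_measure R).
Variable lambda : R.
Hypothesis l0 : 0 < lambda.
Variable g : R -> R.
Hypotheses (mg : measurable_fun setT g) (g01 : forall x, 0 <= g x <= 1).

Let A (y : R) := \int[leb]_(x in `[0, y]) g x.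
Let f (y : R) := lambda * g y * expR (- lambda * A y).
(** Formally [f] is the derivative of [1 - expR (- lambda * A)], so [D] should be constant. As [g]
    is only measurable, [A] need not be differentiable everywhere, and the increments of [D] are
    estimated instead of a derivative. *)
Let D (y : R) := \int[leb]_(x in `[0, y]) f x + expR (- lambda * A y).

Let leb_itv (x y : R) : x <= y -> leb `[x, y] = (y - x)%:E.
Proof.
rewrite le_eqVlt => /predU1P[->|xy]; first by rewrite set_itv1 lebesgue_measure_set1 subrr.
by rewrite lebesgue_measure_itv/= lte_fin xy.
Qed.

Let bounded_integrable (h : R -> R) (c x y : R) : measurable_fun setT h ->
  (forall x, 0 <= h x <= c) -> leb.-integrable `[x, y] (EFin \o h).
Proof.
move=> mh hc; apply: measurable_bounded_integrable => //.
- have [xy|yx] := leP x y.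
    have : (leb `[x, y] < +oo)%E by rewrite leb_itv// ltry.
    by [].
 
  by rewrite set_itv_ge ?measure0// bnd_simp -ltNge.
- exact: measurable_funTS.
- exists c; split; first exact: num_real.
  move=> c' cc' z _ /=; case/andP: (hc z) => h1 h2; rewrite ger0_norm//.
  exact: le_trans (ltW cc').
Qed.

Let Rintegral_split (h : R -> R) (c x y : R) : measurable_fun setT h ->
  (forall x, 0 <= h x <= c) -> 0 <= x -> x <= y ->
  \int[leb]_(z in `[0, y]) h z = \int[leb]_(z in `[0, x]) h z + \int[leb]_(z in `[x, y]) h z.
Proof.
move=> mh hc x0 xy.
have ih a b := @bounded_integrable h c a b mh hc.
have /(_ (ih _ _)) := @Rintegral_itvB R h (BLeft 0) (BRight y) x.
rewrite !bnd_simp => /(_ x0 xy) h1.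
rewrite -(Rintegral_itv_obnd_cbnd (r := x)) -?h1; first by rewrite addrC subrK.
by apply: integrableS (ih x y) => //; exact: subset_itv_oc_cc.
Qed.

Let itv_le (h k : R -> R) (c c' x y : R) : measurable_fun setT h -> measurable_fun setT k ->
  (forall x, 0 <= h x <= c) -> (forall x, 0 <= k x <= c') ->
  (forall z, x <= z <= y -> h z <= k z) ->
  \int[leb]_(z in `[x, y]) h z <= \int[leb]_(z in `[x, y]) k z.
Proof.
move=> mh mk hc kc hk; apply: le_Rintegral => //.
- exact: bounded_integrable mh hc.
- exact: bounded_integrable mk kc.
Qed.

Let itv_cst (c x y : R) : x <= y -> \int[leb]_(z in `[x, y]) c = c * (y - x).
Proof.
move=> xy; have : \int[leb]_(z in `[x, y]) (cst c) z = c * fine (leb `[x, y]).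
  by apply: Rintegral_cst.
by rewrite leb_itv.
Qed.

Let A0 y : y < 0 -> A y = 0.
Proof.
move=> y0; rewrite /A set_itv_ge ?Rintegral_set0// bnd_simp -ltNge//.
Qed.

Let A_ge0 y : 0 <= A y.
Proof. by apply: Rintegral_ge0 => z _; case/andP: (g01 z). Qed.

Let A_le x y : 0 <= x -> x <= y -> A x <= A y <= A x + (y - x).
Proof.
move=> x0 xy; rewrite {2 3}/A (Rintegral_split mg g01 x0 xy) -/(A x).
rewrite lerDl lerD2l; apply/andP; split.
  by apply: Rintegral_ge0 => z _; case/andP: (g01 z).
rewrite -[leRHS]mul1r -itv_cst//; apply: (@itv_le _ _ 1 1) => //.
- by move=> z; rewrite ler01 lexx.
- by move=> z _; case/andP: (g01 z).
Qed.

Let A_nd : {homo A : x y / x <= y}.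
Proof.
move=> x y xy; have [x0|x0] := ltP x 0; first by rewrite A0// A_ge0.
by have /andP[] := A_le x0 xy.
Qed.

Let mA : measurable_fun setT A.
Proof. exact: nondecreasing_measurable. Qed.

Let mf : measurable_fun setT f.
Proof.
apply: measurable_funM; first exact: measurable_funM.
by apply: measurableT_comp => //; apply: measurable_funM.
Qed.

Let E_le1 y : expR (- lambda * A y) <= 1.
Proof. by rewrite -expR0 ler_expR mulNr oppr_le0 mulr_ge0 ?A_ge0 ?(ltW l0). Qed.

Let f01 y : 0 <= f y <= lambda.
Proof.
have /andP[h1 h2] := g01 y; rewrite /f !mulr_ge0 ?expR_ge0 ?(ltW l0)//=.
rewrite -mulrA ler_piMr ?(ltW l0)// mulr_ile1 ?expR_ge0//.
Qed.

(** The integral of [f] over [[x, y]] and the drop [Ex - Ey] both lie between [lambda * Ey * del]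
    and [lambda * Ex * del], so they differ by at most [lambda * del * (Ex - Ey)], which is itself
    of second order. *)
Let D_bound x y : 0 <= x -> x <= y -> `|D y - D x| <= lambda ^+ 2 * (y - x) ^+ 2.
Proof.
move=> x0 xy; move: (l0) => hl.
rewrite /D (Rintegral_split mf f01 x0 xy).
set Ex := expR (- lambda * A x); set Ey := expR (- lambda * A y).
have /andP[d0 d1] := A_le x0 xy.
pose del := A y - A x.
have gE : \int[leb]_(z in `[x, y]) g z = del.
  by rewrite /del /A (Rintegral_split mg g01 x0 xy) addrC addKr.
have gc (c : R) : 0 <= c -> \int[leb]_(z in `[x, y]) (lambda * c * g z) = lambda * c * del.
  by move=> c0; rewrite RintegralZl// ?gE//; exact: bounded_integrable mg g01.
have mgc (c : R) : measurable_fun setT (fun z => lambda * c * g z) by exact: measurable_funM.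
have gc01 (c : R) : 0 <= c -> forall z, 0 <= lambda * c * g z <= lambda * c.
  move=> c0 z; have /andP[h1 h2] := g01 z.
  by rewrite !mulr_ge0 ?(ltW hl)//= ler_piMr ?mulr_ge0 ?(ltW hl).
have Ex0 : 0 <= Ex by exact: expR_ge0.
have Ey0 : 0 <= Ey by exact: expR_ge0.
have up : \int[leb]_(z in `[x, y]) f z <= lambda * Ex * del.
  rewrite -gc//; apply: (itv_le mf (mgc _) f01 (gc01 _ Ex0)) => z /andP[xz zy].
  have /andP[h1 h2] := g01 z.
  have -> : f z = lambda * expR (- lambda * A z) * g z by rewrite /f mulrAC.
  apply: (ler_wpM2r h1); apply: (ler_wpM2l (ltW hl)).
  by rewrite ler_expR !mulNr lerN2; apply: (ler_wpM2l (ltW hl)); exact: A_nd.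
have lo : lambda * Ey * del <= \int[leb]_(z in `[x, y]) f z.
  rewrite -gc//; apply: (itv_le (mgc _) mf (gc01 _ Ey0) f01) => z /andP[xz zy].
  have /andP[h1 h2] := g01 z.
  have -> : f z = lambda * expR (- lambda * A z) * g z by rewrite /f mulrAC.
  apply: (ler_wpM2r h1); apply: (ler_wpM2l (ltW hl)).
  by rewrite ler_expR !mulNr lerN2; apply: (ler_wpM2l (ltW hl)); exact: A_nd.
set I := \int[leb]_(z in `[x, y]) f z in up lo *.
have Exy : Ex = Ey * expR (lambda * del) by rewrite -expRD; congr expR; rewrite /del; ring.
have Eyx : Ey = Ex * expR (- (lambda * del)) by rewrite -expRD; congr expR; rewrite /del; ring.
have k1 : Ey * (1 + lambda * del) <= Ex by rewrite Exy; apply: (ler_wpM2l Ey0); exact: expR_ge1Dx.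
have k2 : Ex * (1 - lambda * del) <= Ey by rewrite [leRHS]Eyx; apply: (ler_wpM2l Ex0); exact: expR_ge1Dx.
have Ex1 : Ex <= 1 by exact: E_le1.
have del0 : 0 <= del by rewrite subr_ge0.
have delyx : del <= y - x by rewrite lerBlDl.
have ld0 : 0 <= lambda * del by rewrite mulr_ge0// ltW.
have step : `|I - (Ex - Ey)| <= (lambda * del) * (Ex - Ey).
  by rewrite ler_norml; apply/andP; split; lra.
set J := \int[leb]_(z in `[0, x]) f z.
rewrite (_ : J + I + Ey - (J + Ex) = I - (Ex - Ey)); last by ring.
apply: (le_trans step); apply: (@le_trans _ _ ((lambda * del) ^+ 2)).
  rewrite expr2 ler_wpM2l//.
  have : Ex * (lambda * del) <= lambda * del by rewrite ler_piMl.
  lra.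
rewrite exprMn ler_wpM2l ?sqr_ge0// ler_pXn2r ?nnegrE// (le_trans del0)//.
Qed.

(* [D] has quadratic increments, hence is constant. *)
Let D_const y : 0 <= y -> D y = D 0.
Proof.
move=> y0; apply/eqP; rewrite -subr_eq0 -normr_le0.
apply/ler_addgt0Pr => e e0; rewrite add0r.
pose L := lambda ^+ 2 * y ^+ 2.
have L0 : 0 <= L by rewrite mulr_ge0 ?sqr_ge0.
(* The [n.+1] increments cost at most [L / n.+1^2] each, hence [L / n.+1 < e] together. *)
pose n := Num.truncn (L / e); have nL : L / e < n.+1%:R by exact: Num.Theory.truncnS_gt.
pose x (i : nat) := y * i%:R / n.+1%:R.
have n0 : 0 < n.+1%:R :> R by [].
have -> : D y - D 0 = \sum_(0 <= i < n.+1) (D (x i.+1) - D (x i)).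
  have x0 : x 0%N = 0 by rewrite /x mulr0 mul0r.
  have xn : x n.+1 = y by rewrite /x mulfK.
  by rewrite (telescope_sumr (fun i => D (x i)) (leq0n n.+1)) x0 xn.
apply: (le_trans (ler_norm_sum _ _ _)).
apply: (@le_trans _ _ (\sum_(0 <= i < n.+1) (L / n.+1%:R ^+ 2))).
  apply: ler_sum => i _.
  have e1 : x i.+1 - x i = y / n.+1%:R.
    by rewrite /x -mulrBl -mulrBr -natr1 addrC addKr mulr1.
  have xi0 : 0 <= x i by rewrite divr_ge0// mulr_ge0.
  have xii : x i <= x i.+1 by rewrite -subr_ge0 e1 divr_ge0.
  apply: (le_trans (D_bound xi0 xii)); rewrite e1 exprMn mulrA exprVn.
  by [].
have -> : \sum_(0 <= i < n.+1) L / n.+1%:R ^+ 2 = L / n.+1%:R.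
  rewrite sumr_const_nat subn0 -[LHS]mulr_natr; move: n0.
  by move: (n.+1%:R : R) => N N0; field; rewrite gt_eqF.
by rewrite ler_pdivrMr// mulrC -ler_pdivrMr// ltW.
Qed.

Lemma integral_exponential_clock_itv y : 0 <= y ->
  \int[leb]_(x in `[0, y]) (lambda * g x * expR (- lambda * \int[leb]_(z in `[0, x]) g z)) =
  1 - expR (- lambda * \int[leb]_(z in `[0, y]) g z).
Proof.
move=> y0; have := D_const y0; rewrite /D -/(A y) => h.
have A00 : A 0 = 0 by rewrite /A set_itv1 Rintegral_set1.
have i0 : \int[leb]_(x in `[0, 0]) f x = 0 by rewrite set_itv1 Rintegral_set1.
rewrite i0 A00 mulr0 expR0 add0r in h.
by rewrite -[LHS]/(\int[leb]_(x in `[0, y]) f x) -/(A y) -h addrK.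
Qed.

(** Beyond [tau] the rate is 1, so [A] grows linearly and [expR (- lambda * A)] tends to 0: no mass
    is lost at infinity. *)
Lemma integral_exponential_clock (tau : R) : (forall x, tau < x -> g x = 1) ->
  (\int[leb]_(x in `[0%R, +oo[)
    (lambda * g x * expR (- lambda * \int[leb]_(z in `[0%R, x]) g z))%:E = 1)%E.
Proof.
move=> gtau; move: (l0) => hl; rewrite -[LHS]/(\int[leb]_(x in `[0%R, +oo[) (f x)%:E)%E.
pose t0 := Num.max tau 0.
have A_ge y : t0 <= y -> y - t0 <= A y.
  move=> ty; have t00 : 0 <= t0 by rewrite le_max lexx orbT.
  rewrite /A (Rintegral_split mg g01 t00 ty).
  have -> : \int[leb]_(z in `[t0, y]) g z = \int[leb]_(z in `]t0, y]) g z.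
    rewrite Rintegral_itv_obnd_cbnd//.
    apply: integrableS (@bounded_integrable g 1 t0 y mg g01) => //.
    exact: subset_itv_oc_cc.
  have -> : \int[leb]_(z in `]t0, y]) g z = \int[leb]_(z in `]t0, y]) (cst 1 z).
    apply: eq_Rintegral => z; rewrite inE/= in_itv/= => /andP[tz _].
    by rewrite gtau// (le_lt_trans _ tz)// le_max lexx.
  rewrite Rintegral_itv_obnd_cbnd; last first.
    apply: integrableS (@bounded_integrable (cst 1) 1 t0 y _ _) => //.
    - exact: subset_itv_oc_cc.
    - by move=> z; rewrite ler01 lexx.
  by rewrite itv_cst// mul1r lerDr; exact: A_ge0.
have c1 : (\int[leb]_(x in `[0%R, n%:R]) (f x)%:E)%E @[n --> \oo] -->
    (\int[leb]_(x in `[0%R, +oo[) (f x)%:E)%E.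
  rewrite (_ : `[0%R, +oo[%classic = \bigcup_n `[0%R, n%:R]%classic); last first.
    apply/seteqP; split => x /=.
      rewrite in_itv/= andbT => x0; exists (Num.truncn x).+1 => //=.
      by rewrite in_itv/= x0/= ltW// Num.Theory.truncnS_gt.
    by move=> [n _ /=]; rewrite !in_itv/= andbT => /andP[].
  apply: ge0_nondecreasing_set_cvg_integral => //.
  - apply/nondecreasing_seqP => n; apply/subsetPset => x /=; rewrite !in_itv/=.
    by move=> /andP[-> h] /=; rewrite (le_trans h)// ler_nat.
  - by move=> n; apply/measurable_EFinP; exact: measurable_funTS.
  - by move=> n x _; rewrite lee_fin; case/andP: (f01 x).
apply: (cvg_unique _ c1) => //.
rewrite (_ : (fun n : nat => _) = (fun n : nat => (1 - expR (- lambda * A n%:R))%:E)); last first.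
  apply/funext => n; rewrite -integral_exponential_clock_itv//.
  rewrite /Rintegral fineK//; apply: integrable_fin_num => //.
  exact: bounded_integrable mf f01.
apply: cvg_EFin; first exact: nearW.
rewrite /comp/= -[X in _ --> X]subr0; apply: cvgB; first exact: cvg_cst.
apply: (@squeeze_cvgr _ _ _ _ (cst 0) (fun n : nat => expR (lambda * t0) * expR (- (n%:R * lambda)))).
- near=> n; rewrite expR_ge0/= -expRD ler_expR.
  have nt : t0 <= n%:R by near: n; exact: nbhs_infty_ger.
  have := ler_wpM2l (ltW hl) (A_ge _ nt); lra.
- exact: cvg_cst.
- rewrite -(mulr0 (expR (lambda * t0))); apply: cvgM; first exact: cvg_cst.
  rewrite (_ : (fun n : nat => _) = (fun n : nat => expR (- lambda) ^+ n)); last first.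
    by apply/funext => n; rewrite -expRM_natl mulrN.
  by apply: cvg_expr; rewrite ger0_norm ?expR_ge0// expR_lt1 oppr_lt0.
Unshelve. all: by end_near. Qed.

End exponential_clock.

Section independent_law.
Context d d' (Omega : measurableType d) (E : measurableType d') (R : realType).
Variable P : probability Omega R.
Variables (W : Omega -> E) (Y : Omega -> R).
Hypotheses (mW : measurable_fun setT W) (mY : measurable_fun setT Y).
Local Open Scope ereal_scope.

Let cst_law (w : E) : {measure set R -> \bar R} := image_measure P mY.

Let measurable_cst_law U : measurable U ->
  measurable_fun [set: E] (cst_law ^~ U : _ -> \bar R).
Proof. by move=> mU; exact: measurable_cst. Qed.

HB.instance Definition _ := isKernel.Build _ _ _ _ R cst_law measurable_cst_law.

Let cst_law_prob z : cst_law z setT = 1.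
Proof. by rewrite /cst_law /= /pushforward preimage_setT probability_setT. Qed.

HB.instance Definition _ := Kernel_isProbability.Build _ _ _ _ R cst_law cst_law_prob.

Variable G : set (set E).
Hypotheses (GI : setI_closed G) (GT : G setT) (Gm : measurable = <<s G >>).
Hypothesis PWY : forall C A, G C -> measurable A ->
  P (W @^-1` C `&` Y @^-1` A) = P (W @^-1` C) * P (Y @^-1` A).

Lemma independent_law_integral (f : E * R -> \bar R) :
  (forall z, 0 <= f z) -> measurable_fun setT f ->
  \int[P]_w f (W w, Y w) = \int[P]_w \int[image_measure P mY]_y f (W w, y).
Proof.
apply: (@conditional_law_integral _ _ _ _ _ P cst_law W Y mW mY G GI GT Gm).
move=> C A GC mA; rewrite PWY// integral_cst; first by rewrite muleC.
by rewrite -[X in measurable X]setTI; apply: mW => //; rewrite Gm; exact: sub_sigma_algebra.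
Qed.

End independent_law.

Lemma ge0_integral_cvg_le d (T : measurableType d) (R : realType)
    (mu : {measure set T -> \bar R}) (f_ : (T -> R)^nat) (f : T -> R) (c : \bar R) :
  (forall n, measurable_fun setT (f_ n)) -> (forall n x, 0 <= f_ n x) ->
  (forall x, f_ n x @[n --> \oo] --> f x) ->
  (\forall n \near \oo, (\int[mu]_x (f_ n x)%:E <= c)%E) ->
  (\int[mu]_x (f x)%:E <= c)%E.
Proof.
move=> mf f0 cf bound.
have mf' n : measurable_fun setT (EFin \o f_ n) by exact/measurable_EFinP.
have f0' n x : setT x -> (0 <= (EFin \o f_ n) x)%E by rewrite lee_fin.
have h := fatou mu measurableT mf' f0'.
rewrite (eq_integral (fun x => limn_einf (fun n => (f_ n x)%:E))); last first.
  move=> x _; have /cvg_limn_einf_sup[-> //] : (f_ n x)%:E @[n --> \oo] --> (f x)%:E.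
  by apply: cvg_EFin; [exact: nearW|exact: cf].
apply: (le_trans h).
rewrite limn_einf_lim; apply: lime_le.
  by apply: is_cvg_einfs.
near=> n.
apply: (@le_trans _ _ (\int[mu]_x (f_ n x)%:E)%E); last by near: n.
by apply: ereal_inf_lbound; exists n => /=.
Unshelve. all: by end_near. Qed.

(** A sub-sigma-algebra is handled as a second measurable type on the same carrier. Through this
    identity map, the past can be taken as the random element [W] of [conditional_law_integral]. *)
Lemma measurable_g_sigma_algebra d (Omega : measurableType d) (G : set (set Omega)) :
  G `<=` measurable -> measurable_fun setT (id : Omega -> g_sigma_algebraType G).
Proof.
move=> GM _ A mA; rewrite setTI preimage_id.
move: A mA; apply: smallest_sub => //.
exact: sigma_algebra_measurable.
Qed.

Section exponential_shift.
Context {R : realType}.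
Notation leb := (@lebesgue_measure R).
Variables (lambda tau : R) (q : R -> R).
Hypotheses (l0 : 0 < lambda) (mq : measurable_fun setT q).
Hypotheses (q01 : forall x, 0 <= q x <= 1) (q_supp : forall x, ~~ (0 <= x <= tau) -> q x = 0).

Lemma integrable_bounded_support : leb.-integrable setT (EFin \o q).
Proof.
have i1 : leb.-integrable `[0, tau] (EFin \o q).
  apply: measurable_bounded_integrable => //.
  - have [xy|yx] := leP 0 tau.
      have : (leb `[0%R, tau] < +oo)%E.
        rewrite lebesgue_measure_itv/=; case: ifP => // _; exact: ltry.
      by [].
    by rewrite set_itv_ge ?measure0// bnd_simp -ltNge.
  - exact: measurable_funTS.
  - exists 1; split; first exact: num_real.
    move=> c' cc' z _ /=; case/andP: (q01 z) => h1 h2; rewrite ger0_norm//.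
    exact: le_trans (ltW cc').
have m1 : measurable (`[0, tau]%classic : set (measurableTypeR R)) by exact: measurable_itv.
have -> : EFin \o q = (EFin \o q) \_ `[0, tau].
  apply/funext => x; rewrite patchE; case: ifPn => //.
  by rewrite notin_setE /= in_itv/= => /negP /q_supp ->.
exact/(integrable_mkcond _ m1).
Qed.

Let Q s := \int[leb]_(x in `[s, +oo[) q x.

Let iq (D : set (measurableTypeR R)) : measurable D -> leb.-integrable D (EFin \o q).
Proof. by move=> mD; apply: integrableS integrable_bounded_support. Qed.

Let Q_split s t : s <= t -> Q s = \int[leb]_(x in `[s, t]) q x + Q t.
Proof.
move=> st.
have := @Rintegral_itvB R q (BLeft s) (BInfty _ false) t (iq (measurable_itv _)).
rewrite !bnd_simp => /(_ st isT) h.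
rewrite /Q -(Rintegral_itv_obnd_cbnd (r := t)); last by apply: iq; exact: measurable_itv.
by rewrite -h addrC subrK.
Qed.

Lemma tail_integral_ge0 s : 0 <= Q s.
Proof. by apply: Rintegral_ge0 => z _; case/andP: (q01 z). Qed.

Lemma measurable_tail_integral : measurable_fun setT Q.
Proof.
apply: nonincreasing_measurable => // x y xy; rewrite (Q_split xy) lerDr.
by apply: Rintegral_ge0 => z _; case/andP: (q01 z).
Qed.

Lemma tail_integral_eq0 s : tau < s -> Q s = 0.
Proof.
move=> ts; rewrite /Q (_ : \int[leb]_(x in _) q x = \int[leb]_(x in `[s, +oo[) (cst 0 x)).
  by rewrite /Rintegral integral0.
apply: eq_Rintegral => x; rewrite inE/= in_itv/= andbT => sx.
by rewrite q_supp// negb_and -ltNge -ltNge (lt_le_trans ts)// orbT.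
Qed.

(** From [s] on, the clock with rate [1 - q] has run for [y - (Q s - Q (s + y))] at [s + y], so
    after division by [expR (- lambda * Q s)] the integrand is the density of
    [integral_exponential_clock]. This is one step of the martingale along the arrivals. *)
Lemma exponential_tail_shift s :
  (\int[leb]_(y in `[0%R, +oo[)
    ((1 - q (s + y)) * expR (- lambda * Q (s + y)) * (lambda * expR (- lambda * y)))%:E =
   (expR (- lambda * Q s))%:E)%E.
Proof.
pose g y := 1 - q (s + y).
have mqs : measurable_fun setT (fun y => q (s + y)).
  by apply: measurableT_comp => //; exact: measurable_funD.
have mg : measurable_fun setT g by exact: measurable_funB.
have g01 x : 0 <= g x <= 1 by rewrite /g; have := q01 (s + x); lra.
have gtau x : tau - s < x -> g x = 1.
  by move=> h; rewrite /g q_supp ?subr0// negb_and -ltNge -ltNge; apply/orP; right; lra.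
have A y : 0 <= y -> \int[leb]_(z in `[0, y]) g z = y - (Q s - Q (s + y)).
  move=> y0.
  have c1 : leb.-integrable `[0, y] (EFin \o cst (1 : R)).
    apply: measurable_bounded_integrable => //.
    - have : (leb `[0%R, y] < +oo)%E.
        rewrite lebesgue_measure_itv/=; case: ifP => // _; exact: ltry.
      by [].
    - by exists 1; split; [exact: num_real|move=> c c1 z _ /=; rewrite normr1 ltW].
  have ev : (\int[leb]_(z in `[0%R, y]) (q (s + z))%:E = \int[leb]_(z in `[s, (s + y)%R]) (q z)%:E)%E.
    rewrite (@ge0_integral_translation R (EFin \o q) s)//; last 2 first.
    - by apply/measurable_EFinP; exact: measurable_funTS.
    - by move=> z _; rewrite lee_fin; case/andP: (q01 z).
    congr (integral _ _ _); apply/seteqP; split => z /=; rewrite !in_itv/= => /andP[h1 h2]; apply/andP; split; lra.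
  have iqs : leb.-integrable `[0, y] (EFin \o (fun z => q (s + z))).
    apply/integrableP; split; first by apply/measurable_EFinP; exact: measurable_funTS.
    have -> : (\int[leb]_(x in `[0%R, y]) `|(EFin \o (fun z => q (s + z))) x| =
        \int[leb]_(z in `[0%R, y]) (q (s + z))%:E)%E.
      by apply: eq_integral => z _ /=; rewrite ger0_norm//; case/andP: (q01 (s + z)).
    rewrite ev; have /integrableP[_] := iq (measurable_itv `[s, s + y]).
    apply: le_lt_trans; apply: ge0_le_integral => //.
    - by move=> z _; rewrite lee_fin; case/andP: (q01 z).
    - by apply/measurable_EFinP; exact: measurable_funTS.
    - by apply: measurableT_comp => //; apply/measurable_EFinP; exact: measurable_funTS.
    - by move=> z _ /=; rewrite lee_fin ler_norm.
  rewrite /g RintegralB//.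
  have -> : \int[leb]_(x in `[0, y]) (cst 1 x) = y.
    have : \int[leb]_(z in `[0, y]) (cst 1) z = 1 * fine (leb `[0, y]) by apply: Rintegral_cst.
    rewrite mul1r lebesgue_measure_itv/= lte_fin; case: ifPn => //= h; first by rewrite subr0.
    by move=> ->; apply/eqP; rewrite eq_le y0 leNgt h.
  congr (_ - _); rewrite {1}(Q_split (_ : s <= s + y)) ?lerDl//.
  by rewrite [RHS]addrK /Rintegral ev.
have := integral_exponential_clock l0 mg g01 gtau.
move=> /(congr1 (fun x => (expR (- lambda * Q s))%:E * x)%E); rewrite mule1 => <-.
rewrite -ge0_integralZl_EFin ?expR_ge0//; last 2 first.
- move=> x; rewrite /= in_itv/= andbT => x0; rewrite lee_fin !mulr_ge0 ?expR_ge0 ?(ltW l0)//.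
  by case/andP: (g01 x).
- apply/measurable_EFinP; apply: (@eq_measurable_fun _ _ _ _ _
    (fun y => lambda * g y * expR (- lambda * (y - (Q s - Q (s + y)))))).
    by move=> y; rewrite inE/= in_itv/= andbT => y0; rewrite A.
  apply: measurable_funTS; apply: measurable_funM; first exact: measurable_funM.
  apply: measurableT_comp => //; apply: measurable_funM => //.
  apply: measurable_funB => //; apply: measurable_funB => //.
  apply: measurableT_comp; first exact: measurable_tail_integral.
  exact: measurable_funD.
apply: eq_integral => y; rewrite inE/= in_itv/= andbT => y0.
rewrite A// -EFinM; congr EFin; rewrite -/(g y).
have -> : expR (- lambda * (y - (Q s - Q (s + y)))) =
   expR (- lambda * Q (s + y)) * expR (- lambda * y) / expR (- lambda * Q s).
  by rewrite -expRD -expRB; congr expR; ring.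
by field; rewrite gt_eqF// expR_gt0.
Qed.

End exponential_shift.

(** * Conditioning on past arrivals, Laplace functional and Campbell's inequality *)

Section Poisson_arrivals.
Context {R : realType} d (Omega : measurableType d) (P : probability Omega R).
Notation leb := (@lebesgue_measure R).
Variables (lambda : R) (T : nat -> {RV P >-> R}).
Hypotheses (l0 : 0 < lambda) (hT : Poisson_arrival_times lambda T).

Let xi (j : nat) : Omega -> R := interarrival T j.
Let S (n : nat) (w : Omega) : R := \sum_(0 <= j < n) xi j w.

Let S0 w : S 0 w = 0. Proof. by rewrite /S big_geq. Qed.
Let SS n w : S n.+1 w = S n w + xi n w. Proof. by rewrite /S big_nat_recr. Qed.

Let TS j w : T j w = S j.+1 w.
Proof.
elim: j => [|j IH]; first by rewrite SS S0 add0r.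
by rewrite SS -IH /xi /interarrival addrC subrK.
Qed.

Let mxi j : measurable_fun setT (xi j).
Proof. by rewrite /xi /interarrival; case: j => [|j] //=; exact: measurable_funB. Qed.

(** A pi-system for the first [n] interarrival times; [En n] is the sample space with that past as
    its sigma-algebra. *)
Let cyl (n : nat) : set (set Omega) := [set C | exists A : nat -> set R,
  (forall j, measurable (A j)) /\ C = \bigcap_(j in [set` iota 0 n]) (xi j @^-1` A j)].

Let cyl_measurable n : cyl n `<=` measurable.
Proof.
move=> _ [A [mA ->]]; apply: bigcap_measurableType => j _.
by rewrite -[X in measurable X]setTI; exact: mxi.
Qed.

Let En n := g_sigma_algebraType (cyl n).

Let mid n : measurable_fun setT (id : Omega -> En n).
Proof. exact: measurable_g_sigma_algebra (@cyl_measurable n). Qed.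

Let mxiE n j : (j < n)%N -> measurable_fun setT (xi j : En n -> R).
Proof.
move=> jn _ A mA; rewrite setTI; apply: sub_sigma_algebra.
exists (fun i => if i == j then A else setT); split; first by move=> i; case: ifP.
apply/seteqP; split => w /=.
  by move=> Aw i _ /=; case: ifPn => // /eqP ->.
by move=> /(_ j); rewrite /= mem_iota/= add0n jn eqxx; apply.
Qed.

Let mSE n k : (k <= n)%N -> measurable_fun setT (S k : En n -> R).
Proof.
elim: k => [|k IH] kn.
  by rewrite (_ : S 0 = cst 0)//; apply/funext => w; rewrite S0.
rewrite (_ : S k.+1 = fun w => S k w + xi k w); last by apply/funext => w; rewrite SS.
by apply: measurable_funD; [apply: IH; exact: ltnW|exact: mxiE].
Qed.

(** Given the past, the next interarrival time is exponential. Independence has to be checked on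
    cylinders only, where prescribing [A] at index [n] gives a cylinder on [n.+1] coordinates. *)
Let clock n (f : En n * R -> \bar R) : (forall z, (0 <= f z)%E) -> measurable_fun setT f ->
  (\int[P]_w f (w, xi n w) =
   \int[P]_w \int[leb]_(y in `[0%R, +oo[) (f (w, y) * (lambda * expR (- lambda * y))%:E))%E.
Proof.
move=> f0 mf.
rewrite (@independent_law_integral _ _ _ _ _ P (id : Omega -> En n) (xi n) (@mid n) (@mxi n) (cyl n))//.
- apply: eq_integral => w _.
  have mfw : measurable_fun setT (fun y => f (w, y)).
    exact: (measurableT_comp mf (pair1_measurable (w : En n))).
  transitivity (\int[leb]_y (f (w, y) * (exponential_pdf lambda y)%:E))%E.
    have e0 y : 0 <= exponential_pdf lambda y by apply: exponential_pdf_ge0; exact: ltW.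
    have me := measurable_exponential_pdf lambda.
    have hnu A : measurable A -> image_measure P (mxi n) A =
        (\int[leb]_(y in A) (exponential_pdf lambda y)%:E)%E.
      by move=> mA; have [_ h] := hT; exact: h.
    have mid' : measurable_fun setT (id : measurableTypeR R -> R) by exact: measurable_id.
    exact: (ge0_integral_density mid' me e0 hnu (fun y => f0 (w, y)) mfw).
  rewrite [RHS]integral_mkcond; apply: eq_integral => y _.
  rewrite /exponential_pdf !patchE; case: ifPn => // _; exact: mule0.
- move=> _ _ [A [mA ->]] [B [mB ->]]; exists (fun j => A j `&` B j); split.
    by move=> j; exact: measurableI.
  by apply/seteqP; split => w /=; [move=> [hA hB] j hj; split; [exact: hA|exact: hB]|
    move=> h; split => j /h []].
- exists (fun=> setT); split => //; apply/seteqP; split => //.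
- move=> _ A [B [mB ->]] mA; rewrite preimage_id.
  have [hI _] := hT.
  pose B' j := if j == n then A else B j.
  have mB' j : measurable (B' j) by rewrite /B'; case: ifP.
  have h1 := hI (iota 0 n.+1) B' (iota_uniq _ _) mB'.
  have h2 := hI (iota 0 n) B (iota_uniq _ _) mB.
  have B'n : B' n = A by rewrite /B' eqxx.
  have B'j j : (j < n)%N -> B' j = B j by move=> jn; rewrite /B' ltn_eqF.
  rewrite -addn1 iotaD add0n /= big_cat big_seq1/= B'n in h1.
  rewrite (eq_big_seq (fun j => P (xi j @^-1` B j))) in h1; last first.
    by move=> j; rewrite mem_iota/= add0n => jn; rewrite B'j.
  rewrite h2 -[RHS]h1; congr (P _); apply/seteqP; split => w /=.
    move=> [hB hA] j /=; rewrite mem_cat mem_seq1 => /orP[jn|/eqP->]; last by rewrite B'n.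
    rewrite B'j; first exact: hB.
    by move: jn; rewrite mem_iota.
  move=> h; split.
    move=> j /= jn; have := h j; rewrite /= mem_cat jn => /(_ isT).
    by rewrite B'j//; move: jn; rewrite /= mem_iota.
  by have := h n; rewrite /= mem_cat mem_seq1 eqxx orbT B'n; apply.
Qed.

Let mS n : measurable_fun setT (S n).
Proof. by apply: measurable_sum => j; exact: mxi. Qed.

Let Pcst (c : R) : (\int[P]_w c%:E = c%:E)%E.
Proof.
transitivity (c%:E * P setT)%E; last by rewrite probability_setT mule1.
exact: integral_cst.
Qed.

(** The Laplace transform at 1 of one interarrival time; its powers bound the chance of [n] arrivals
    before a fixed time. *)
Let r := lambda / (lambda + 1).

Let r01 : 0 <= r < 1.
Proof. by move: (l0) => h; rewrite divr_ge0/= ?ltr_pdivrMr; lra. Qed.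

Let integral_exp_clock :
  (\int[leb]_(y in `[0%R, +oo[) (expR (- y) * (lambda * expR (- lambda * y)))%:E = r%:E)%E.
Proof.
move: (l0) => hl; have l1 : 0 < lambda + 1 by lra.
have := @integral_exponential_clock R _ l1 (cst 1) (measurable_cst _) _ 0.
have h01 (x : R) : 0 <= cst (1 : R) x <= 1 by rewrite /= ler01 lexx.
move=> /(_ h01) /(_ (fun _ _ => erefl)) h.
have c1 (y : R) : 0 <= y -> \int[leb]_(z in `[0, y]) (cst 1 z) = y.
  move=> y0; have : \int[leb]_(z in `[0, y]) (cst 1) z = 1 * fine (leb `[0, y]) by apply: Rintegral_cst.
  rewrite mul1r lebesgue_measure_itv/= lte_fin; case: ifPn => //= h1; first by rewrite subr0.
  by move=> ->; apply/eqP; rewrite eq_le y0 leNgt h1.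
have := congr1 (fun x => r%:E * x)%E h; rewrite mule1 => <-.
rewrite -ge0_integralZl_EFin//; last 3 first.
- by move=> x _; rewrite lee_fin !mulr_ge0 ?expR_ge0 ?ltW.
- apply/measurable_EFinP; apply: (@eq_measurable_fun _ _ _ _ _
    (fun y => (lambda + 1) * expR (- (lambda + 1) * y))).
    by move=> y; rewrite inE/= in_itv/= andbT => y0; rewrite c1// mulr1.
  apply: measurable_funTS; apply: measurable_funM => //.
  by apply: measurableT_comp => //; exact: measurable_funM.
- by case/andP: r01.
apply: eq_integral => y; rewrite inE/= in_itv/= andbT => y0.
rewrite c1// -EFinM; congr EFin; rewrite mulrCA -expRD /r mulr1.
rewrite (_ : - y + - lambda * y = - (lambda + 1) * y); last by ring.
by field; rewrite gt_eqF.
Qed.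

Let E_exp n : (\int[P]_w (expR (- S n w))%:E = (r ^+ n)%:E)%E.
Proof.
elim: n => [|n IH].
  under eq_integral do rewrite S0 oppr0 expR0.
  by rewrite Pcst expr0.
pose f (z : En n * R) := (expR (- (S n z.1 + z.2)))%:E.
have f0 z : (0 <= f z)%E by rewrite lee_fin expR_ge0.
have mf : measurable_fun setT f.
  apply/measurable_EFinP; apply: measurableT_comp => //; apply: measurableT_comp => //.
  apply: measurable_funD => //.
  by apply: (measurableT_comp (mSE (leqnn n))).
transitivity (\int[P]_w f (w, xi n w))%E.
  by apply: eq_integral => w _; rewrite /f /= -SS.
have r_ge0 : 0 <= r by case/andP: r01.
rewrite clock// exprS EFinM -IH -ge0_integralZl_EFin ?expR_ge0//; last first.
- by apply/measurable_EFinP; apply: measurableT_comp => //; exact: measurableT_comp.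
apply: eq_integral => w _; rewrite muleC -integral_exp_clock -ge0_integralZl_EFin ?expR_ge0//; last 2 first.
- by move=> y _; rewrite lee_fin !mulr_ge0 ?expR_ge0// ltW.
- apply/measurable_EFinP; apply: measurable_funTS; apply: measurable_funM.
    by apply: measurableT_comp => //; exact: measurableT_comp.
  by apply: measurable_funM => //; apply: measurableT_comp => //.
by apply: eq_integral => y _; rewrite /f /= -!EFinM opprD expRD !mulrA.
Qed.

(** Chernoff's bound: Markov's inequality for [expR (- S n)]. *)
Let P_S_le n a : (P [set w | (S n w <= a)%R] <= (expR a * r ^+ n)%:E)%E.
Proof.
have mA : measurable [set w | (S n w <= a)%R].
  rewrite (_ : [set w | _] = S n @^-1` `]-oo, a]); first by rewrite -[X in measurable X]setTI; apply: mS.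
  by apply/seteqP; split => w /=; rewrite in_itv/=.
rewrite EFinM -E_exp -ge0_integralZl_EFin ?expR_ge0//; last first.
- by apply/measurable_EFinP; apply: measurableT_comp => //; exact: measurableT_comp.
rewrite -[leLHS]mul1e -integral_cst//.
apply: (@le_trans _ _ (\int[P]_(w in [set w | (S n w <= a)%R]) ((expR a)%:E * (expR (- S n w))%:E))%E).
  apply: ge0_le_integral => //.
  - by apply: measurable_funTS; apply/measurable_EFinP; apply: measurable_funM => //; apply: measurableT_comp => //; exact: measurableT_comp.
  - by move=> w /= Sa; rewrite -EFinM lee_fin -expRD -[leLHS]expR0 ler_expR; lra.
apply: ge0_subset_integral => //.
by apply/measurable_EFinP; apply: measurable_funM => //; apply: measurableT_comp => //; exact: measurableT_comp.
Qed.

Let cvg_P_S_le a : (expR a * r ^+ n)%:E @[n --> \oo] --> 0%:E.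
Proof.
apply: cvg_EFin; first exact: nearW.
rewrite /comp /= -[X in _ --> X](mulr0 (expR a)); apply: cvgM; first exact: cvg_cst.
by have /andP[r0 r1] := r01; apply: cvg_expr; rewrite ger0_norm.
Qed.

Let ae_xi_gt0 j : {ae P, forall w, 0 < xi j w}.
Proof.
have m0 : measurable (`]-oo, 0]%classic : set R) by exact: measurable_itv.
exists (xi j @^-1` `]-oo, 0]); split.
- by rewrite -[X in measurable X]setTI; apply: mxi.
- have [_ h] := hT; have -> := h j _ m0; rewrite /exponential_prob -integral_itv_bndo_bndc; last first.
    by apply: measurable_funTS; apply/measurable_EFinP; exact: measurable_exponential_pdf.
  rewrite integral0_eq// => x /=; rewrite in_itv/= => x0.
  by rewrite lt0_exponential_pdf.
- by move=> w /= /negP; rewrite -leNgt in_itv.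
Qed.

Let ae_S_unbounded (N : nat) : {ae P, forall w, exists n, N%:R < S n w}.
Proof.
exists (\bigcap_n [set w | (S n w <= N%:R)%R]).
have mA n : measurable [set w | (S n w <= N%:R)%R].
  rewrite (_ : [set w | _] = S n @^-1` `]-oo, N%:R]); first by rewrite -[X in measurable X]setTI; apply: mS.
  by apply/seteqP; split => w /=; rewrite in_itv/=.
have mI : measurable (\bigcap_n [set w | (S n w <= N%:R)%R]) by exact: bigcap_measurableType.
split => //; last first.
  move=> w /= h n _ /=; rewrite leNgt; apply/negP => hn; apply: h; by exists n.
apply/eqP; rewrite eq_le measure_ge0 andbT.
apply: (cvge_ge _ (cvg_P_S_le N%:R)); apply: nearW => n.
apply: le_trans (P_S_le n N%:R); apply: le_measure; rewrite ?inE//.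
by move=> w /(_ n); apply.
Qed.

(** Outside a null set only finitely many arrivals precede any level, which makes every shot noise
    series a finite sum. *)
Lemma ae_arrival_times : {ae P, forall w, (forall j, 0 < T j w) /\
  forall a : R, exists n, forall j, (n <= j)%N -> a < T j w}.
Proof.
have := ae_foralln ae_xi_gt0; have := ae_foralln ae_S_unbounded.
apply: filterS2 => w hS hxi.
have Snd m n : (m <= n)%N -> S m w <= S n w.
  move=> mn; rewrite -(subnKC mn); elim: (n - m)%N => [|k IH]; first by rewrite addn0.
  by rewrite addnS SS (le_trans IH)// lerDl ltW.
split.
  move=> j; rewrite TS; apply: (@lt_le_trans _ _ (S 1 w)); last exact: Snd.
  by rewrite SS S0 add0r.
move=> a; have [n hn] := hS (Num.truncn a).+1; exists n => j nj.
rewrite TS (lt_le_trans (Num.Theory.truncnS_gt a))// (le_trans (ltW hn))// Snd//.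
exact: leqW.
Qed.

Section Laplace.
Variables (tau : R) (q : R -> R).
Hypothesis mq : measurable_fun setT q.
Hypotheses (q01 : forall x, 0 <= q x <= 1) (q_supp : forall x, ~~ (0 <= x <= tau) -> q x = 0).

Let Q s := \int[leb]_(x in `[s, +oo[) q x.
Let G s := expR (- lambda * Q s).
Let M n w := \prod_(0 <= j < n) (1 - q (S j.+1 w)).

Let MS n w : M n.+1 w = M n w * (1 - q (S n.+1 w)).
Proof. by rewrite /M big_nat_recr. Qed.

Let M01 n w : 0 <= M n w <= 1.
Proof.
elim: n => [|n /andP[IH1 IH2]]; first by rewrite /M big_geq// ler01 lexx.
have /andP[h1 h2] := q01 (S n.+1 w).
by rewrite MS mulr_ge0 ?subr_ge0//= mulr_ile1 ?subr_ge0// gerBl.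
Qed.

Let mG : measurable_fun setT G.
Proof.
apply: measurableT_comp => //; apply: measurable_funM => //.
exact: measurable_tail_integral mq q01 q_supp.
Qed.

Let G01 s : 0 <= G s <= 1.
Proof.
rewrite expR_ge0/= -expR0 ler_expR mulNr oppr_le0 mulr_ge0//; first exact: ltW.
exact: tail_integral_ge0.
Qed.

Let m1q : measurable_fun setT (fun x => 1 - q x).
Proof. exact: measurable_funB. Qed.

Let mME n k : (k <= n)%N -> measurable_fun setT (M k : En n -> R).
Proof.
elim: k => [|k IH] kn.
  by rewrite (_ : M 0 = cst 1)//; apply/funext => w; rewrite /M big_geq.
rewrite (_ : M k.+1 = fun w => M k w * (1 - q (S k.+1 w))); last by apply/funext => w; rewrite MS.
apply: measurable_funM; first by apply: IH; exact: ltnW.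
by apply: (measurableT_comp m1q); exact: mSE.
Qed.

Let mM n : measurable_fun setT (M n).
Proof.
elim: n => [|n IH].
  by rewrite (_ : M 0 = cst 1)//; apply/funext => w; rewrite /M big_geq.
rewrite (_ : M n.+1 = fun w => M n w * (1 - q (S n.+1 w))); last by apply/funext => w; rewrite MS.
by apply: measurable_funM => //; apply: (measurableT_comp m1q).
Qed.

(* [G (S n w)] is the conditional expectation, given the first [n] arrivals, of
   the product of the factors [1 - q] over all the later arrivals. *)
Let martingale n : (\int[P]_w (M n w * G (S n w))%:E = (G 0)%:E)%E.
Proof.
elim: n => [|n IH].
  under eq_integral do rewrite S0 /M big_geq// mul1r.
  exact: Pcst.
pose f (z : En n * R) := (M n z.1 * ((1 - q (S n z.1 + z.2)) * G (S n z.1 + z.2)))%:E.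
have f0 z : (0 <= f z)%E.
  rewrite lee_fin mulr_ge0//; first by case/andP: (M01 n z.1).
  rewrite mulr_ge0//; last by case/andP: (G01 (S n z.1 + z.2)).
  by rewrite subr_ge0; case/andP: (q01 (S n z.1 + z.2)).
have mSn2 : measurable_fun setT (fun z : En n * R => S n z.1 + z.2).
  apply: measurable_funD => //.
  by apply: (measurableT_comp (mSE (leqnn n))).
have mf : measurable_fun setT f.
  apply/measurable_EFinP; apply: measurable_funM.
    by apply: (measurableT_comp (mME (leqnn n))).
  by apply: measurable_funM; [apply: (measurableT_comp m1q)|apply: (measurableT_comp mG)].
transitivity (\int[P]_w f (w, xi n w))%E.
  by apply: eq_integral => w _; rewrite /f /= MS -SS mulrA.
rewrite clock// -IH; apply: eq_integral => w _.
have h := exponential_tail_shift l0 mq q01 q_supp (S n w).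
have Mn0 : 0 <= M n w by case/andP: (M01 n w).
rewrite EFinM /G -h -ge0_integralZl_EFin//; last 2 first.
- move=> y _; rewrite lee_fin !mulr_ge0 ?expR_ge0 ?(ltW l0)//.
  by rewrite subr_ge0; case/andP: (q01 (S n w + y)).
- apply/measurable_EFinP; apply: measurable_funTS; apply: measurable_funM.
    apply: measurable_funM.
      by apply: (measurableT_comp m1q); exact: measurable_funD.
    by apply: (measurableT_comp mG); exact: measurable_funD.
  apply: measurable_funM => //; apply: measurableT_comp => //.
by apply: eq_integral => y _; rewrite /f /= -!EFinM !mulrA.
Qed.

(** The martingale with its factor [G <= 1] dropped. Being valid for each [n], it serves
    [Campbell_le] before any limit is taken. *)
Lemma Laplace_functional_ge n :
  ((expR (- lambda * \int[leb]_(x in `[0%R, +oo[) q x))%:E <=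
   \int[P]_w (\prod_(0 <= j < n) (1 - q (T j w)))%:E)%E.
Proof.
rewrite -[leLHS](martingale n); apply: ge0_le_integral => //.
- by move=> w _; rewrite lee_fin mulr_ge0//; [case/andP: (M01 n w)|case/andP: (G01 (S n w))].
- by apply/measurable_EFinP; apply: measurable_funM => //; apply: (measurableT_comp mG).
- by apply/measurable_EFinP; apply: measurable_prod => j _; apply: (measurableT_comp m1q).
- move=> w _; rewrite lee_fin (_ : \prod_(0 <= j < n) (1 - q (T j w)) = M n w).
    by rewrite ler_piMr//; [case/andP: (M01 n w)|case/andP: (G01 (S n w))].
  by apply: eq_bigr => j _; rewrite TS.
Qed.

(** Dropping the factor [G (S n w)] matters only where [S n w <= tau], because [G] is 1 beyond
    [tau]; that event has vanishing probability. *)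
Lemma cvg_Laplace_functional :
  (\int[P]_w (\prod_(0 <= j < n) (1 - q (T j w)))%:E)%E @[n --> \oo] -->
  (expR (- lambda * \int[leb]_(x in `[0%R, +oo[) q x))%:E.
Proof.
apply: (@squeeze_cvge _ _ _ _ (cst (G 0)%:E) _ (fun n => (G 0)%:E + (expR tau * r ^+ n)%:E)%E).
- apply: nearW => n; rewrite Laplace_functional_ge/=.
  rewrite -[X in (_ <= X + _)%E](martingale n).
  apply: (@le_trans _ _ (\int[P]_w (M n w * G (S n w))%:E + P [set w | (S n w <= tau)%R])%E); last first.
    by rewrite leeD2l// P_S_le.
  have mA : measurable [set w | (S n w <= tau)%R].
    rewrite (_ : [set w | _] = S n @^-1` `]-oo, tau]); first by rewrite -[X in measurable X]setTI; apply: mS.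
    by apply/seteqP; split => w /=; rewrite in_itv/=.
  rewrite -[X in (_ + P X)%E]setIT -integral_indic// -ge0_integralD//; last 3 first.
  + by move=> w _; rewrite lee_fin mulr_ge0//; [case/andP: (M01 n w)|case/andP: (G01 (S n w))].
  + by apply/measurable_EFinP; apply: measurable_funM => //; apply: (measurableT_comp mG).
  + by apply/measurable_EFinP; exact: measurable_indic.
  apply: ge0_le_integral => //.
  + move=> w _; rewrite lee_fin; apply: prodr_ge0 => j _.
    by rewrite subr_ge0; case/andP: (q01 (T j w)).
  + by apply/measurable_EFinP; apply: measurable_prod => j _; apply: (measurableT_comp m1q).
  + apply: emeasurable_funD.
      by apply/measurable_EFinP; apply: measurable_funM => //; apply: (measurableT_comp mG).
    by apply/measurable_EFinP; exact: measurable_indic.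
  + move=> w _; rewrite -EFinD lee_fin (_ : \prod_(0 <= j < n) (1 - q (T j w)) = M n w); last first.
      by apply: eq_bigr => j _; rewrite TS.
    have /andP[h1 h2] := M01 n w; have /andP[h3 h4] := G01 (S n w).
    rewrite indicE; case: (boolP (w \in _)) => [_|].
      by rewrite /=; have := mulr_ge0 h1 h3; lra.
    rewrite notin_setE /= => /negP; rewrite -ltNge => ts.
    by rewrite addr0 /G /Q (tail_integral_eq0 q_supp ts) mulr0 expR0 mulr1.
- exact: cvg_cst.
- rewrite -[X in _ --> X]adde0; apply: cvgeD; [by []|exact: cvg_cst|exact: cvg_P_S_le].
Qed.

End Laplace.

(* Divide [E (1 - exp (- t Z)) <= lambda * int (1 - exp (- t phi))] by [t], and
   let [t] tend to 0. *)
Lemma Campbell_le tau (phi : R -> R) n : measurable_fun setT phi -> (forall x, 0 <= phi x) ->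
  (forall x, ~~ (0 <= x <= tau) -> phi x = 0) ->
  (\int[P]_w (\sum_(0 <= j < n) phi (T j w))%:E <=
   lambda%:E * \int[leb]_(x in `[0%R, +oo[) (phi x)%:E)%E.
Proof.
move=> mphi phi0 phi_supp; move: (l0) => hl.
pose Z w := \sum_(0 <= j < n) phi (T j w).
have Z0 w : 0 <= Z w by apply: sumr_ge0 => j _.
have mZ : measurable_fun setT Z.
  by apply: measurable_sum => j; apply: (measurableT_comp mphi).
(* With [t = 1 / k.+1], [f k = Z / (1 + t Z)] lies below [(1 - exp (- t Z)) / t] by [1 + x <= e^x],
   and it converges to [Z]. *)
pose f (k : nat) w := Z w / (1 + Z w / k.+1%:R).
have k0 (k : nat) : 0 < k.+1%:R :> R by [].
have kZ (k : nat) w : 0 <= Z w / k.+1%:R by rewrite divr_ge0.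
have mf k : measurable_fun setT (f k).
  apply: measurable_funM => //.
  rewrite (_ : (fun w => _) = fun w => (1 + Z w / k.+1%:R) `^ (-1)); last first.
    by apply/funext => w; rewrite powR_inv1// addr_ge0.
  apply: (measurableT_comp (measurable_powR (-1))).
  by apply: measurable_funD => //; apply: measurable_funM.
have f0 k w : 0 <= f k w by rewrite divr_ge0// addr_ge0.
have bound k : (\int[P]_w (f k w)%:E <= lambda%:E * \int[leb]_(x in `[0%R, +oo[) (phi x)%:E)%E.
  pose t : R := k.+1%:R^-1; have t0 : 0 < t by rewrite invr_gt0.
  pose q x := 1 - expR (- (t * phi x)).
  have mq : measurable_fun setT q.
    apply: measurable_funB => //; apply: measurableT_comp => //.
    by apply: measurableT_comp => //; exact: measurable_funM.
  have q01 x : 0 <= q x <= 1.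
    rewrite /q subr_ge0 -[X in _ <= X]expR0 ler_expR oppr_le0 mulr_ge0 ?(ltW t0)//=.
  have q_supp x : ~~ (0 <= x <= tau) -> q x = 0.
    by move=> /phi_supp h; rewrite /q h mulr0 oppr0 expR0 subrr.
  have q_le x : q x <= t * phi x.
    by have := expR_ge1Dx (- (t * phi x)); rewrite /q; lra.
  pose M w := expR (- (t * Z w)).
  have prodE w : \prod_(0 <= j < n) (1 - q (T j w)) = M w.
    rewrite /M /Z mulr_sumr -sumrN expR_sum; apply: eq_bigr => j _.
    by rewrite /q; ring.
  have M1 w : M w <= 1 by rewrite -[X in _ <= X]expR0 ler_expR oppr_le0 mulr_ge0 ?(ltW t0).
  have mM : measurable_fun setT M.
    by apply: measurableT_comp => //; apply: measurableT_comp => //; exact: measurable_funM.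
  have h1 := Laplace_functional_ge mq q01 q_supp n.
  have h2 : (\int[P]_w (1 - M w)%:E + \int[P]_w (M w)%:E = 1)%E.
    rewrite -ge0_integralD//; last 4 first.
    - by move=> w _; rewrite lee_fin subr_ge0.
    - by apply/measurable_EFinP; exact: measurable_funB.
    - by move=> w _; rewrite lee_fin expR_ge0.
    - exact/measurable_EFinP.
    rewrite -[RHS](Pcst 1); apply: eq_integral => w _; rewrite -EFinD; congr EFin; ring.
  have h3 : (\int[P]_w (1 - M w)%:E <= (lambda * \int[leb]_(x in `[0%R, +oo[) q x)%:E)%E.
    move: h1; under eq_integral do rewrite prodE.
    have := expR_ge1Dx (- lambda * \int[leb]_(x in `[0%R, +oo[) q x).
    move: (expR _) => e; move: (Rintegral _ _ _) => I eI.
    have : (0 <= \int[P]_w (M w)%:E)%E by apply: integral_ge0 => w _; rewrite lee_fin expR_ge0.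
    have : (0 <= \int[P]_w (1 - M w)%:E)%E by apply: integral_ge0 => w _; rewrite lee_fin subr_ge0.
    move: h2; move: (integral P _ _) (integral P _ _) => [a| |] [b| |] //=.
    move=> /eqP; rewrite -EFinD eqe => /eqP ab _ _; rewrite !lee_fin; lra.
  apply: (@le_trans _ _ ((t^-1)%:E * \int[P]_w (1 - M w)%:E)%E).
    rewrite -ge0_integralZl_EFin ?invr_ge0 ?(ltW t0)//; last 2 first.
    - by move=> w _; rewrite lee_fin subr_ge0.
    - by apply/measurable_EFinP; exact: measurable_funB.
    apply: ge0_le_integral => //.
    - by move=> w _; rewrite lee_fin.
    - exact/measurable_EFinP.
    - by apply/measurable_EFinP; apply: measurable_funM => //; exact: measurable_funB.
    move=> w _; rewrite -EFinM lee_fin /f.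
    have tz : 0 <= t * Z w by rewrite mulr_ge0 ?(ltW t0).
    have -> : Z w / (1 + Z w / k.+1%:R) = t^-1 * (1 - (1 + t * Z w)^-1).
      have -> : Z w / k.+1%:R = t * Z w by rewrite mulrC.
      by field; rewrite !lt0r_neq0//; lra.
    apply: (ler_wpM2l (_ : 0 <= t^-1)); first by rewrite invr_ge0 ltW.
    rewrite lerD2l lerN2 /M expRN lef_pV2 ?posrE ?expR_gt0//; last lra.
    exact: expR_ge1Dx.
  apply: (@le_trans _ _ ((t^-1 * lambda)%:E * (\int[leb]_(x in `[0%R, +oo[) q x)%:E)%E).
    by rewrite -EFinM -mulrA EFinM lee_wpmul2l// lee_fin invr_ge0 ltW.
  have iq : leb.-integrable `[0%R, +oo[ (EFin \o q).
    by apply: integrableS (integrable_bounded_support mq q01 q_supp).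
  rewrite /Rintegral fineK; last exact: integrable_fin_num.
  rewrite -!ge0_integralZl_EFin ?mulr_ge0 ?invr_ge0 ?(ltW t0)//; last first.
  - exact: ltW.
  - by apply/measurable_EFinP; exact: measurable_funTS.
  - by move=> x _; rewrite lee_fin; case/andP: (q01 x).
  - exact: ltW.
  - by apply/measurable_EFinP; exact: measurable_funTS.
  - by move=> x _; rewrite lee_fin.
  apply: ge0_le_integral => //.
  - by move=> x _; rewrite -EFinM lee_fin mulr_ge0 ?mulr_ge0 ?invr_ge0 ?(ltW t0) ?(ltW l0)//; case/andP: (q01 x).
  - by apply/measurable_EFinP; apply: measurable_funM => //; exact: measurable_funTS.
  - by apply/measurable_EFinP; apply: measurable_funM => //; exact: measurable_funTS.
  move=> x _; rewrite -!EFinM lee_fin mulrAC -ler_pdivlMr//.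
  rewrite [lambda * _]mulrC mulfK ?lt0r_neq0// ler_pdivrMl//.
apply: (ge0_integral_cvg_le mf f0 _ (nearW _ bound)) => w.
rewrite /f -[X in _ --> X]divr1; apply: cvgM; first exact: cvg_cst.
apply: cvgV => //; rewrite -[X in _ --> X]addr0; apply: cvgD; first exact: cvg_cst.
rewrite -[X in _ --> X](mulr0 (Z w)); apply: cvgM; first exact: cvg_cst.
exact: cvg_harmonic.
Qed.

End Poisson_arrivals.

(** * Sums of conditionally independent noises *)

Section conditional_noise.
Context {R : realType} d (Omega : measurableType d) (P : probability Omega R).
Variables (T X : nat -> {RV P >-> R}) (F : R.-pker R ~> R).
Hypothesis hX : conditionally_independent_noises T X F.
Local Open Scope ereal_scope.

Let arrival_system : set (set Omega) :=
  \bigcup_j preimage_set_system setT (T j) measurable.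

Let arrival_system_measurable : arrival_system `<=` measurable.
Proof. by move=> _ [j _ [A mA <-]]; rewrite setTI -[X in measurable X]setTI; exact: measurable_funP. Qed.

Let Sg := g_sigma_algebraType arrival_system.

Let mSg : measurable_fun setT (id : Omega -> Sg).
Proof. exact: measurable_g_sigma_algebra. Qed.

Let mTSg j : measurable_fun setT (T j : Sg -> R).
Proof. by move=> _ A mA; rewrite setTI; apply: sub_sigma_algebra; exists j => //; exists A => //; rewrite setTI. Qed.

Let arrival_measurable G : generated_sigma_algebra T G -> measurable (G : set Omega).
Proof.
move=> mG; have : measurable ((id : Omega -> Sg) @^-1` G).
  by rewrite -[X in measurable X]setTI; exact: mSg.
by rewrite preimage_id.
Qed.

Let noise_event (s : seq nat) (A : nat -> set R) : set Omega :=
  \bigcap_(j in [set` s]) (X j @^-1` A j).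

Let noise_event_measurable s A : (forall j, measurable (A j)) -> measurable (noise_event s A).
Proof.
move=> mA; apply: bigcap_measurableType => j _.
by rewrite -[X in measurable X]setTI; exact: measurable_funP.
Qed.

Let Pi (k : nat) : set (set Omega) := [set C | exists G A,
  [/\ generated_sigma_algebra T G, forall j, measurable (A j) &
      C = G `&` noise_event (iota 0 k) A]].

(** The sigma-algebra of all the arrival times, later ones included, and of the first [k] noises:
    the conditional independence is given the whole sequence of arrivals. *)
Definition noise_history k := g_sigma_algebraType (Pi k).

Let Pi_measurable k : Pi k `<=` measurable.
Proof.
move=> _ [G [A [hG mA ->]]]; apply: measurableI; first exact: arrival_measurable.
exact: noise_event_measurable.
Qed.

Let mid k : measurable_fun setT (id : Omega -> noise_history k).
Proof. exact: measurable_g_sigma_algebra (@Pi_measurable k). Qed.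

Let SgT : generated_sigma_algebra T setT.
Proof. exact: (@measurableT _ Sg). Qed.

Lemma measurable_history_arrival k j : measurable_fun setT (T j : noise_history k -> R).
Proof.
move=> _ A mA; rewrite setTI; apply: sub_sigma_algebra.
exists (T j @^-1` A), (fun=> setT); split => //.
- have := @mTSg j measurableT A mA; rewrite setTI; exact.
- by apply/seteqP; split => w //= [].
Qed.

Lemma measurable_history_noise k j : (j < k)%N ->
  measurable_fun setT (X j : noise_history k -> R).
Proof.
move=> jk _ A mA; rewrite setTI; apply: sub_sigma_algebra.
exists setT, (fun i => if i == j then A else setT); split => //.
  by move=> i; case: ifP.
rewrite setTI; apply/seteqP; split => w /=.
  by move=> Aw i _ /=; case: ifPn => // /eqP ->.
by move=> /(_ j); rewrite /= mem_iota/= add0n jk eqxx; apply.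
Qed.

Let law k (w : noise_history k) : {measure set R -> \bar R} := F (T k w).

Let measurable_law k U : measurable U ->
  measurable_fun [set: noise_history k] (@law k ^~ U : _ -> \bar R).
Proof.
move=> mU; apply: (measurableT_comp (measurable_kernel F U mU)).
exact: measurable_history_arrival.
Qed.

HB.instance Definition _ k := isKernel.Build _ _ _ _ R (@law k) (@measurable_law k).

Let law_prob k z : @law k z setT = 1.
Proof. exact: prob_kernel. Qed.

HB.instance Definition _ k := Kernel_isProbability.Build _ _ _ _ R (@law k) (@law_prob k).

Let Z (s : seq nat) (A : nat -> set R) w : R := (\prod_(j <- s) fine (F (T j w) (A j)))%R.

Let Z0 s A w : (0 <= Z s A w)%R.
Proof. by apply: prodr_ge0 => j _; exact: fine_ge0. Qed.

Let mZ s A : (forall j, measurable (A j)) -> measurable_fun setT (Z s A).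
Proof.
move=> mA; apply: measurable_prod => j _.
apply: (measurableT_comp (f := @fine R)) => //.
by apply: (measurableT_comp (measurable_kernel F (A j) (mA j))).
Qed.

(* Both sides are the measure [B |-> P (B `&` noise_event s A)] on the
   sigma-algebra of the arrival times, with density the indicator of the event
   on the left and [Z s A] on the right. *)
Let integral_noise_event s A (f : Sg -> \bar R) : uniq s -> (forall j, measurable (A j)) ->
  (forall w, 0 <= f w) -> measurable_fun setT f ->
  \int[P]_w (f w * (\1_(noise_event s A) w)%:E) = \int[P]_w (f w * (Z s A w)%:E).
Proof.
move=> us mA f0 mf; pose D := noise_event s A.
have mD : measurable D by exact: noise_event_measurable.
pose nu : {measure set Sg -> \bar R} := image_measure (mrestr P mD) mSg.
have [_ hZ] := hX us mA.
transitivity (\int[nu]_w f w).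
  apply/esym; apply: (@ge0_integral_density _ _ _ _ _ P nu id (\1_D) mSg) => //.
  move=> B mB; rewrite preimage_id integral_indic//; last exact: arrival_measurable.
  by rewrite /nu /image_measure /= /pushforward /mrestr preimage_id setIC.
have hnu B : measurable B -> nu B = \int[P]_(w in id @^-1` B) (Z s A w)%:E.
  move=> mB; rewrite preimage_id hZ//.
  by rewrite /nu /image_measure /= /pushforward /mrestr preimage_id setIC.
exact: (ge0_integral_density mSg (mZ s mA) (@Z0 s A) hnu f0 mf).
Qed.

(** On the pi-system, conditional independence gives a product of [k.+1] kernel factors. The last
    one is split off as the conditional law of [X k], and [integral_noise_event] turns the other
    factors back into the indicator of the event of the first [k] noises. *)
Lemma conditional_noise_integral k (f : noise_history k * R -> \bar R) :
  (forall z, 0 <= f z) -> measurable_fun setT f ->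
  \int[P]_w f (w, X k w) = \int[P]_w \int[F (T k w)]_y f (w, y).
Proof.
move=> f0 mf.
apply: (@conditional_law_integral _ _ _ _ _ P (@law k) (id : Omega -> noise_history k)
  (X k) (@mid k) _ (Pi k)) => //.
- move=> _ _ [G1 [A1 [h1 m1 ->]]] [G2 [A2 [h2 m2 ->]]].
  exists (G1 `&` G2), (fun j => A1 j `&` A2 j); split.
  + exact: (@measurableI _ Sg).
  + by move=> j; exact: measurableI.
  + apply/seteqP; split => w /=.
      move=> [[g1 a1] [g2 a2]]; split => // j hj; split; [exact: a1|exact: a2].
    by move=> [[g1 g2] h]; split; split => // j /h[].
- exists setT, (fun=> setT); split => //; apply/seteqP; split => //.
- move=> _ A [G [B [hG mB ->]]] mA; rewrite preimage_id.
  have mG := arrival_measurable hG.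
  pose B' j := if j == k then A else B j.
  have mB' j : measurable (B' j) by rewrite /B'; case: ifP.
  have B'k : B' k = A by rewrite /B' eqxx.
  have B'j j : (j < k)%N -> B' j = B j by move=> jk; rewrite /B' ltn_eqF.
  have noiseS : noise_event (iota 0 k) B `&` X k @^-1` A = noise_event (iota 0 k.+1) B'.
    rewrite -addn1 iotaD add0n /=; apply/seteqP; split => w /=.
      move=> [hB hA] j /=; rewrite mem_cat mem_seq1 => /orP[jk|/eqP->]; last by rewrite B'k.
      rewrite B'j; first exact: hB.
      by move: jk; rewrite mem_iota.
    move=> h; split.
      move=> j /= jk; have := h j; rewrite /= mem_cat jk => /(_ isT).
      by rewrite B'j//; move: jk; rewrite /= mem_iota.
    by have := h k; rewrite /= mem_cat mem_seq1 eqxx orbT B'k; apply.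
  have ZS w : Z (iota 0 k.+1) B' w = (Z (iota 0 k) B w * fine (F (T k w) A))%R.
    rewrite /Z -addn1 iotaD add0n big_cat big_seq1/= B'k; congr (_ * _)%R.
    by apply: eq_big_seq => j; rewrite mem_iota/= add0n => jk; rewrite B'j.
  have [_ hZ] := hX (iota_uniq 0 k.+1) mB'.
  rewrite -setIA noiseS setIC -hZ//.
  pose g (w : Sg) : \bar R := (\1_G w)%:E * F (T k w) A.
  have mg : measurable_fun setT g.
    apply: emeasurable_funM; first by apply/measurable_EFinP; exact: measurable_indic.
    by apply: (measurableT_comp (measurable_kernel F A mA)).
  have g0 w : 0 <= g w by rewrite mule_ge0 ?lee_fin.
  have := integral_noise_event (iota_uniq 0 k) mB g0 mg.
  have Ffin w : F (T k w) A \is a fin_num.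
    rewrite ge0_fin_numE//; apply: (@le_lt_trans _ _ 1); last exact: ltry.
    have <- : F (T k w) setT = 1 by exact: prob_kernel.
    by apply: le_measure; rewrite ?inE.
  have -> : \int[P]_w (g w * (Z (iota 0 k) B w)%:E) =
      \int[P]_(w in G) (\prod_(j <- iota 0 k.+1) fine (F (T j w) (B' j)))%:E.
    rewrite [RHS]integral_mkcond; apply: eq_integral => w _.
    rewrite patchE /g indicE -/(Z _ _ w) ZS; case: ifPn => _; last by rewrite !mul0e.
    by rewrite mul1e EFinM muleC fineK.
  move=> <-; rewrite [RHS]integral_mkcond; apply: eq_integral => w _.
  rewrite patchE /g !indicE in_setI; case: (w \in G); last by rewrite mul0e mul0e.
  by rewrite mul1e; case: (w \in _); rewrite ?mule1 ?mule0.
Qed.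

Lemma measurable_noise_integral k (f : noise_history k * R -> \bar R) :
  (forall z, 0 <= f z) -> measurable_fun setT f ->
  measurable_fun [set: Omega] (fun w => \int[F (T k w)]_y f (w, y)).
Proof.
move=> f0 mf.
have h : measurable_fun setT (fun w : noise_history k => \int[@law k w]_y f (w, y)).
  exact: (measurable_fun_integral_finite_kernel f (@law k) f0 mf).
exact: (measurableT_comp h (@mid k)).
Qed.

End conditional_noise.

(** * Taylor bounds for cosine, sine and the exponential *)

Section Taylor.
Context {R : realType}.
Implicit Types x z : R.

Lemma ge0_is_derive_le (f f' : R -> R) x : (forall x, is_derive x 1 f (f' x)) ->
  (forall x, 0 <= x -> 0 <= f' x) -> 0 <= x -> f 0 <= f x.
Proof.
move=> df f'0 x0.
have cf : {within `[0, x], continuous f}.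
  apply: continuous_subspaceT => y; apply: differentiable_continuous.
  by apply/derivable1_diffP; have [] := df y.
have [c] := MVT_segment x0 (fun y _ => df y) cf.
rewrite in_itv/= => /andP[c0 _] h.
by rewrite -subr_ge0 h subr0 mulr_ge0// f'0.
Qed.

(** This bound and the next three integrate one another, starting from [cos x <= 1]. *)
Let sin_le z : 0 <= z -> sin z <= z.
Proof.
move=> z0; pose f (z : R) := z - sin z.
have df x : is_derive x 1 f (1 - cos x).
  by apply: (is_derive_eq (is_deriveB _ _)).
have h x : 0 <= x -> 0 <= 1 - cos x by rewrite subr_ge0 cos_le1.
by have := ge0_is_derive_le df h z0; rewrite /f sin0 subrr subr_ge0.
Qed.

Let cos_ge z : 0 <= z -> 1 - z ^+ 2 / 2 <= cos z.
Proof.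
move=> z0; pose f (z : R) := cos z + 2^-1 * z ^+ 2 - 1.
have df x : is_derive x 1 f (x - sin x).
  apply: (is_derive_eq (is_deriveB (is_deriveD _ _) _)); rewrite /GRing.scale/=; by field.
have := ge0_is_derive_le df _ z0; rewrite /f cos0 expr0n/=.
have h x : 0 <= x -> 0 <= x - sin x by move=> /sin_le; lra.
move=> /(_ h); lra.
Qed.

Let sin_ge z : 0 <= z -> z - z ^+ 3 / 6 <= sin z.
Proof.
move=> z0; pose f (z : R) := sin z + 6^-1 * z ^+ 3 - z.
have df x : is_derive x 1 f (cos x + 2^-1 * x ^+ 2 - 1).
  apply: (is_derive_eq (is_deriveB (is_deriveD _ _) _)); rewrite /GRing.scale/=; by field.
have := ge0_is_derive_le df _ z0; rewrite /f sin0 expr0n/=.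
have h x : 0 <= x -> 0 <= cos x + 2^-1 * x ^+ 2 - 1 by move=> /cos_ge; lra.
move=> /(_ h); lra.
Qed.

Let cos_le z : 0 <= z -> cos z <= 1 - z ^+ 2 / 2 + z ^+ 4 / 24.
Proof.
move=> z0; pose f (z : R) := 24^-1 * z ^+ 4 - 2^-1 * z ^+ 2 - cos z.
have df x : is_derive x 1 f (6^-1 * x ^+ 3 - x + sin x).
  apply: (is_derive_eq (is_deriveB (is_deriveB _ _) _)); rewrite /GRing.scale/=; by field.
have := ge0_is_derive_le df _ z0; rewrite /f cos0 !expr0n/=.
have h x : 0 <= x -> 0 <= 6^-1 * x ^+ 3 - x + sin x by move=> /sin_ge; lra.
move=> /(_ h); lra.
Qed.

Lemma cos_Taylor z : `|cos z - (1 - z ^+ 2 / 2)| <= z ^+ 4 / 24.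
Proof.
wlog z0 : z / 0 <= z => [h|].
  have [/h//|/ltW z0] := leP 0 z.
  by have := h (- z); rewrite cosN sqrrN (_ : (- z) ^+ 4 = z ^+ 4); [rewrite oppr_ge0 => /(_ z0)|ring].
rewrite ler_norml; have := cos_le z0; have := cos_ge z0; have : 0 <= z ^+ 4 by exact: exprn_ge0.
lra.
Qed.

Lemma sin_Taylor z : `|sin z - z| <= `|z| ^+ 3 / 6.
Proof.
wlog z0 : z / 0 <= z => [h|].
  have [/h//|/ltW z0] := leP 0 z.
  by have := h (- z); rewrite sinN normrN -opprD normrN oppr_ge0 => /(_ z0).
rewrite (ger0_norm z0) ler_norml; have := sin_le z0; have := sin_ge z0.
have : 0 <= z ^+ 3 by exact: exprn_ge0.
lra.
Qed.

Lemma expRN_Taylor x : 0 <= x -> `|expR (- x) - (1 - x)| <= x ^+ 2 / 2.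
Proof.
move=> x0; pose f (z : R) := 2^-1 * z ^+ 2 - z - expR (- z).
have df z : is_derive z 1 f (z - 1 + expR (- z)).
  apply: (is_derive_eq (is_deriveB (is_deriveB _ _) _)); rewrite /GRing.scale/=; by field.
have := ge0_is_derive_le df _ x0; rewrite /f !expr0n/= oppr0 expR0.
have h z : 0 <= z -> 0 <= z - 1 + expR (- z).
  by move=> _; have := expR_ge1Dx (- z); lra.
move=> /(_ h) h1; rewrite ler_norml; have := expR_ge1Dx (- x); have : 0 <= x ^+ 2 by exact: exprn_ge0.
lra.
Qed.

(** The cubic remainder of the sine is split by [2 |z|^3 <= e z^2 + z^4 / e], because only moments
    of orders 2 and 4 are controlled uniformly; [e] stays free until the end. *)
Lemma cos_shift_Taylor A z e : 0 < e ->
  `|cos (A + z) - (cos A * (1 - z ^+ 2 / 2) - sin A * z)| <=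
  z ^+ 4 / 24 + (e * z ^+ 2 + e^-1 * z ^+ 4) / 12.
Proof.
move=> e0; rewrite cosD.
have -> : cos A * cos z - sin A * sin z - (cos A * (1 - z ^+ 2 / 2) - sin A * z) =
  cos A * (cos z - (1 - z ^+ 2 / 2)) - sin A * (sin z - z) by ring.
apply: (le_trans (ler_normB _ _)); rewrite !normrM.
have cA : `|cos A| <= 1 by rewrite ler_norml cos_le1 cos_geN1.
have sA : `|sin A| <= 1 by rewrite ler_norml sin_le1 sin_geN1.
apply: lerD.
  by apply: le_trans (cos_Taylor z); exact: ler_piMl.
apply: (@le_trans _ _ (`|z| ^+ 3 / 6)).
  by apply: le_trans (sin_Taylor z); exact: ler_piMl.
have := sqr_ge0 (e - `|z|); move=> h.
have hz : 0 <= `|z| ^+ 2 by exact: exprn_ge0.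
have -> : (e * z ^+ 2 + e^-1 * z ^+ 4) / 12 = `|z| ^+ 2 * e^-1 * (e ^+ 2 + `|z| ^+ 2) / 12.
  rewrite (_ : z ^+ 4 = (z ^+ 2) ^+ 2); last by ring.
  rewrite -(real_normK (num_real z)); field; exact: lt0r_neq0.
have -> : `|z| ^+ 3 / 6 = `|z| ^+ 2 * e^-1 * (2 * e * `|z|) / 12.
  by field; exact: lt0r_neq0.
rewrite ler_pM2r//; apply: (ler_wpM2l (_ : 0 <= `|z| ^+ 2 * e^-1)).
  by rewrite mulr_ge0// invr_ge0 ltW.
by move: h; rewrite sqrrB; lra.
Qed.

End Taylor.

Section one_step.
Context {R : realType} (mu : {measure set R -> \bar R}).
Hypothesis mu1 : mu setT = 1%E.
Hypothesis hint : forall r : nat, (1 <= r <= 4)%N ->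
  mu.-integrable [set: R] (EFin \o (fun x : R => x ^+ r)).
Hypothesis hmean : \int[mu]_x (x ^+ 1) = 0.
Let K2 := \int[mu]_x (x ^+ 2).
Let K4 := \int[mu]_x (x ^+ 4).

Let iZ (c : R) r : (1 <= r <= 4)%N -> mu.-integrable [set: R] (EFin \o (fun x : R => c * x ^+ r)).
Proof. by move=> hr; exact: (integrableZl measurableT c (hint hr)). Qed.

Let icst (c : R) : mu.-integrable [set: R] (EFin \o (fun=> c)).
Proof.
apply/integrableP; split; first by apply/measurable_EFinP; exact: measurable_cst.
have -> : (\int[mu]_x `|(EFin \o (fun=> c)) x| = `|c|%:E * mu setT)%E.
  exact: integral_cst.
by rewrite mu1 mule1 ltry.
Qed.

Let Icst (c : R) : \int[mu]_x c = c.
Proof.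
rewrite /Rintegral (_ : \int[mu]_x c%:E = c%:E)%E//.
transitivity (c%:E * mu setT)%E; last by rewrite mu1 mule1.
exact: integral_cst.
Qed.

Let IZ (c : R) r : (1 <= r <= 4)%N ->
  \int[mu]_x (c * x ^+ r) = c * \int[mu]_x (x ^+ r).
Proof. by move=> hr; rewrite RintegralZl//; exact: hint. Qed.

(** The linear term integrates to 0 since the mean vanishes. The last error term is the price of
    replacing [1 - y^2 K2 / 2] by the exponential, which makes the factors of successive noises
    multiply. *)
Lemma integral_cos_shift A y e : 0 < e ->
  `|\int[mu]_x cos (A + y * x) - cos A * expR (- (y ^+ 2 * K2 / 2))| <=
  y ^+ 4 * K4 / 24 + (e * (y ^+ 2 * K2) + e^-1 * (y ^+ 4 * K4)) / 12 + (y ^+ 2 * K2) ^+ 2 / 8.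
Proof.
move=> e0.
have K20 : 0 <= K2 by apply: Rintegral_ge0 => x _; exact: sqr_ge0.
pose p (x : R) := cos A + (- (cos A * y ^+ 2 / 2) * x ^+ 2 + - (sin A * y) * x ^+ 1).
pose h (x : R) := (y ^+ 4 / 24 + e^-1 * y ^+ 4 / 12) * x ^+ 4 + (e * y ^+ 2 / 12) * x ^+ 2.
have ip1 : mu.-integrable [set: R] (EFin \o (fun x : R => - (cos A * y ^+ 2 / 2) * x ^+ 2 + - (sin A * y) * x ^+ 1)).
  have -> : EFin \o (fun x : R => - (cos A * y ^+ 2 / 2) * x ^+ 2 + - (sin A * y) * x ^+ 1) =
    (EFin \o (fun x : R => - (cos A * y ^+ 2 / 2) * x ^+ 2)) \+ (EFin \o (fun x : R => - (sin A * y) * x ^+ 1)).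
    by apply/funext => x.
  by apply: integrableD => //; exact: iZ.
have ip : mu.-integrable [set: R] (EFin \o p).
  have -> : EFin \o p = (EFin \o (fun=> cos A)) \+ (EFin \o (fun x : R => - (cos A * y ^+ 2 / 2) * x ^+ 2 + - (sin A * y) * x ^+ 1)).
    by apply/funext => x.
  exact: integrableD.
have ih : mu.-integrable [set: R] (EFin \o h).
  have -> : EFin \o h = (EFin \o (fun x : R => (y ^+ 4 / 24 + e^-1 * y ^+ 4 / 12) * x ^+ 4)) \+ (EFin \o (fun x : R => (e * y ^+ 2 / 12) * x ^+ 2)).
    by apply/funext => x.
  by apply: integrableD => //; exact: iZ.
have mcos : measurable_fun [set: R] (fun x : R => cos (A + y * x)).
  apply: measurableT_comp; first exact: continuous_measurable_fun (@continuous_cos R).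
  by apply: measurable_funD => //; exact: measurable_funM.
have ic : mu.-integrable [set: R] (EFin \o (fun x : R => cos (A + y * x))).
  apply: (le_integrable measurableT _ _ (icst 1)); first exact/measurable_EFinP.
  by move=> x _ /=; rewrite lee_fin normr1 ler_norml cos_le1 cos_geN1.
have Ip : \int[mu]_x p x = cos A * (1 - y ^+ 2 * K2 / 2).
  rewrite /p RintegralD// Icst RintegralD//; [|exact: iZ|exact: iZ].
  by rewrite !IZ// hmean -/K2; ring.
have Ih : \int[mu]_x h x = y ^+ 4 * K4 / 24 + (e * (y ^+ 2 * K2) + e^-1 * (y ^+ 4 * K4)) / 12.
  by rewrite /h RintegralD//; [rewrite !IZ// -/K2 -/K4; ring|exact: iZ|exact: iZ].
have D : `|\int[mu]_x cos (A + y * x) - \int[mu]_x p x| <= \int[mu]_x h x.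
  rewrite -RintegralB//.
  have icp : mu.-integrable [set: R] (EFin \o (fun x => cos (A + y * x) - p x)).
    have -> : EFin \o (fun x => cos (A + y * x) - p x) =
        ((EFin \o (fun x : R => cos (A + y * x))) \- (EFin \o p))%E.
      by apply/funext => x.
    exact: integrableB.
  apply: (le_trans (le_normr_Rintegral measurableT icp)).
  apply: le_Rintegral => //.
  - exact: integrable_norm icp.
  - move=> x _; have := cos_shift_Taylor A (y * x) e0.
    rewrite /p /h.
    have -> : cos A * (1 - (y * x) ^+ 2 / 2) - sin A * (y * x) = cos A + (- (cos A * y ^+ 2 / 2) * x ^+ 2 + - (sin A * y) * x ^+ 1) by ring.
    by move=> /le_trans; apply; rewrite le_eqVlt; apply/orP; left; apply/eqP; ring.
rewrite -Ih.
have K2y : 0 <= y ^+ 2 * K2 / 2 by rewrite divr_ge0// mulr_ge0// sqr_ge0.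
have E := expRN_Taylor K2y.
have -> : \int[mu]_x cos (A + y * x) - cos A * expR (- (y ^+ 2 * K2 / 2)) =
  (\int[mu]_x cos (A + y * x) - \int[mu]_x p x) - cos A * (expR (- (y ^+ 2 * K2 / 2)) - (1 - y ^+ 2 * K2 / 2)).
  by rewrite Ip; ring.
apply: (le_trans (ler_normB _ _)); apply: lerD => //.
rewrite normrM; have cA : `|cos A| <= 1 by rewrite ler_norml cos_le1 cos_geN1.
apply: (le_trans (ler_piMl _ cA)) => //; apply: (le_trans E).
by rewrite le_eqVlt; apply/orP; left; apply/eqP; field.
Qed.

Lemma ge0_integral_cos_shift A y r : 0 <= r <= 1 ->
  (\int[mu]_x (1 + r * cos (A + y * x))%:E = (1 + r * \int[mu]_x cos (A + y * x))%:E)%E.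
Proof.
move=> r01.
have mcos : measurable_fun [set: R] (fun x : R => cos (A + y * x)).
  apply: measurableT_comp; first exact: continuous_measurable_fun (@continuous_cos R).
  by apply: measurable_funD => //; exact: measurable_funM.
have ic : mu.-integrable [set: R] (EFin \o (fun x : R => cos (A + y * x))).
  apply: (le_integrable measurableT _ _ (icst 1)); first exact/measurable_EFinP.
  by move=> x _ /=; rewrite lee_fin normr1 ler_norml cos_le1 cos_geN1.
have irc : mu.-integrable [set: R] (EFin \o (fun x : R => r * cos (A + y * x))).
  exact: (integrableZl measurableT r ic).
have isum : mu.-integrable [set: R] (EFin \o (fun x : R => 1 + r * cos (A + y * x))).
  have -> : EFin \o (fun x : R => 1 + r * cos (A + y * x)) =
      (EFin \o (fun=> 1)) \+ (EFin \o (fun x : R => r * cos (A + y * x))).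
    by apply/funext => x.
  exact: integrableD.
rewrite -[LHS]fineK; last exact: integrable_fin_num.
congr EFin; transitivity (\int[mu]_x (1 + r * cos (A + y * x))); first by [].
by rewrite RintegralD// Icst RintegralZl.
Qed.

Lemma integral_sqr_shift a y :
  (\int[mu]_x ((a + y * x) ^+ 2)%:E = (a ^+ 2 + y ^+ 2 * K2)%:E)%E.
Proof.
have i1 : mu.-integrable [set: R] (EFin \o (fun x : R => 2 * a * y * x ^+ 1 + y ^+ 2 * x ^+ 2)).
  have -> : EFin \o (fun x : R => 2 * a * y * x ^+ 1 + y ^+ 2 * x ^+ 2) =
    (EFin \o (fun x : R => 2 * a * y * x ^+ 1)) \+ (EFin \o (fun x : R => y ^+ 2 * x ^+ 2)).
    by apply/funext => x.
  by apply: integrableD => //; exact: iZ.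
have -> : (fun x : R => ((a + y * x) ^+ 2)%:E) = (EFin \o (fun=> a ^+ 2)) \+ (EFin \o (fun x : R => 2 * a * y * x ^+ 1 + y ^+ 2 * x ^+ 2)).
  by apply/funext => x; rewrite /= -EFinD; congr EFin; ring.
have i2 := integrableD measurableT (icst (a ^+ 2)) i1.
rewrite -[LHS]fineK; last exact: integrable_fin_num.
have h := RintegralD measurableT (icst (a ^+ 2)) i1.
congr EFin; transitivity (\int[mu]_x (a ^+ 2 + (2 * a * y * x ^+ 1 + y ^+ 2 * x ^+ 2))); first by [].
rewrite h Icst RintegralD//; [|exact: iZ|exact: iZ].
by rewrite !IZ// hmean mulr0 add0r.
Qed.

End one_step.

(** * Replacement of the noises one by one *)

Section Lindeberg.
Context {R : realType} d (Omega : measurableType d) (P : probability Omega R).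
Notation leb := (@lebesgue_measure R).
Variables (lambda : R) (T X : nat -> {RV P >-> R}) (F : R.-pker R ~> R).
Hypotheses (l0 : 0 < lambda) (hT : Poisson_arrival_times lambda T).
Hypothesis hX : conditionally_independent_noises T X F.
Hypothesis hfin : forall (u : R) (r : nat), 0 < u -> (1 <= r <= 4)%N ->
  (F u).-integrable [set: R] (EFin \o (fun x : R => x ^+ r)).
Hypothesis hK1 : forall u : R, 0 < u -> noise_moment F 1 u = 0.
Variable M : R.
Hypothesis M1 : 1 <= M.
Hypothesis hK2 : forall u : R, 0 < u -> noise_moment F 2 u <= M.
Hypothesis hK4 : forall u : R, 0 < u -> noise_moment F 4 u <= M.
Variables (y : R -> R) (tau : R).
Hypothesis my : measurable_fun setT y.
Hypothesis y_supp : forall u, ~~ (0 < u <= tau) -> y u = 0.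

Let x u := y u ^+ 2 * noise_moment F 2 u / 2.
(** The cost of one replacement at arrival time [u]. The moments are at most [M], and [M <= M ^+ 2]
    because [1 <= M]; the constants 1/24, 1/12 and 1/8 of [integral_cos_shift] are rounded up to 1
    in all. *)
Let err e u := M ^+ 2 * (e * y u ^+ 2 + e^-1 * y u ^+ 4 + y u ^+ 4).
Let S n w := \sum_(0 <= j < n) y (T j w) * X j w.

Lemma measurable_noise_moment2 : measurable_fun setT (noise_moment F 2).
Proof.
apply: (measurableT_comp (f := @fine R)) => //.
apply: (measurable_fun_integral_kernel (l := fun u => F u)).
- by move=> U mU; exact: measurable_kernel.
- by move=> z; rewrite lee_fin sqr_ge0.
- by apply/measurable_EFinP; exact: measurable_funX.
Qed.

Lemma noise_moment2_ge0 u : 0 <= noise_moment F 2 u.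
Proof. by apply: Rintegral_ge0 => z _; exact: sqr_ge0. Qed.

Let noise_moment4_ge0 u : 0 <= noise_moment F 4 u.
Proof. by apply: Rintegral_ge0 => z _; rewrite (exprM _ 2 2) sqr_ge0. Qed.

Let x0 u : 0 <= x u.
Proof. by rewrite divr_ge0// mulr_ge0 ?sqr_ge0// noise_moment2_ge0. Qed.

Let mx : measurable_fun setT x.
Proof.
apply: measurable_funM => //; apply: measurable_funM; first exact: measurable_funX.
exact: measurable_noise_moment2.
Qed.

Let y4_ge0 u : 0 <= y u ^+ 4. Proof. by rewrite (exprM _ 2 2) sqr_ge0. Qed.

Let err_ge0 e u : 0 < e -> 0 <= err e u.
Proof.
move=> e0; rewrite mulr_ge0 ?sqr_ge0// !addr_ge0// mulr_ge0 ?sqr_ge0// ?invr_ge0 ltW//.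
Qed.

Let merr e : measurable_fun setT (err e).
Proof.
apply: measurable_funM => //; apply: measurable_funD; last exact: measurable_funX.
by apply: measurable_funD; apply: measurable_funM => //; exact: measurable_funX.
Qed.

Let one_step A e u : 0 < e ->
  `|\int[F u]_z cos (A + y u * z) - cos A * expR (- x u)| <= err e u.
Proof.
(* The moments are known at positive [u] only; off the support [y u = 0], and the two terms compared
   are both [cos A]. *)
move=> e0; have [/andP[u0 utau]|/y_supp yu] := boolP (0 < u <= tau); last first.
  rewrite /x yu expr0n/= !mul0r oppr0 expR0 mulr1.
  have -> : \int[F u]_z cos (A + 0 * z) = cos A.
    rewrite /Rintegral (_ : \int[F u]_z (cos (A + 0 * z))%:E = (cos A)%:E)%E//.
    transitivity ((cos A)%:E * F u setT)%E; last by rewrite prob_kernel mule1.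
    rewrite -integral_cst//; apply: eq_integral => z _ /=.
    by rewrite mul0r addr0.
  by rewrite subrr normr0 err_ge0.
have h := integral_cos_shift (mu := F u) (prob_kernel u) (fun r hr => hfin u0 hr) (hK1 u0) A (y u) e0.
apply: (le_trans h); rewrite -/(noise_moment F 2 u) -/(noise_moment F 4 u).
have k2 := hK2 u0; have k4 := hK4 u0.
have k20 := noise_moment2_ge0 u; have k40 := noise_moment4_ge0 u.
have MM : M <= M ^+ 2 by rewrite expr2 ler_peMr//; apply: le_trans M1.
have a2 : y u ^+ 2 * noise_moment F 2 u <= M ^+ 2 * y u ^+ 2.
  by rewrite mulrC ler_wpM2r ?sqr_ge0// (le_trans k2).
have a4 : y u ^+ 4 * noise_moment F 4 u <= M ^+ 2 * y u ^+ 4.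
  by rewrite mulrC ler_wpM2r// (le_trans k4).
have a22 : (y u ^+ 2 * noise_moment F 2 u) ^+ 2 <= M ^+ 2 * y u ^+ 4.
  rewrite exprMn -exprM mulrC ler_wpM2r// ler_sqr// nnegrE.
  by apply: le_trans M1.
have a20 : 0 <= y u ^+ 2 * noise_moment F 2 u by rewrite mulr_ge0// sqr_ge0.
have a40 : 0 <= y u ^+ 4 * noise_moment F 4 u by rewrite mulr_ge0.
have ei0 : 0 <= e^-1 by rewrite invr_ge0 ltW.
have e2 : e * (y u ^+ 2 * noise_moment F 2 u) <= e * (M ^+ 2 * y u ^+ 2).
  by apply: (ler_wpM2l (ltW e0)).
have e4 : e^-1 * (y u ^+ 4 * noise_moment F 4 u) <= e^-1 * (M ^+ 2 * y u ^+ 4).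
  by apply: (ler_wpM2l ei0).
have e20 := mulr_ge0 (ltW e0) a20; have e40 := mulr_ge0 ei0 a40.
have -> : err e u = e * (M ^+ 2 * y u ^+ 2) + e^-1 * (M ^+ 2 * y u ^+ 4) + M ^+ 2 * y u ^+ 4.
  by rewrite /err; ring.
lra.
Qed.

Let SS n w : S n.+1 w = S n w + y (T n w) * X n w.
Proof. by rewrite /S big_nat_recr. Qed.

Let mS n : measurable_fun setT (S n).
Proof.
apply: measurable_sum => j; apply: measurable_funM => //.
exact: (measurableT_comp my).
Qed.

Let mS_history n : measurable_fun setT (S n : noise_history T X n -> R).
Proof.
have h k : (k <= n)%N -> measurable_fun setT (S k : noise_history T X n -> R).
  elim: k => [|k IH] kn.
    by rewrite (_ : S 0 = cst 0)//; apply/funext => w; rewrite /S big_geq.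
  rewrite (_ : S k.+1 = fun w => S k w + y (T k w) * X k w); last by apply/funext => w; rewrite SS.
  apply: measurable_funD; first by apply: IH; exact: ltnW.
  apply: measurable_funM; last exact: measurable_history_noise.
  by apply: (measurableT_comp my); exact: measurable_history_arrival.
exact: h.
Qed.

(** The Gaussian factors of the arrivals [k] to [n - 1], whose noises have not been put in yet. *)
Let rho n k w := expR (- \sum_(k <= j < n) x (T j w)).

Let rho_recl n k w : (k < n)%N -> rho n k w = expR (- x (T k w)) * rho n k.+1 w.
Proof. by move=> kn; rewrite /rho big_ltn// opprD expRD. Qed.

Let rho01 n k w : 0 <= rho n k w <= 1.
Proof. by rewrite expR_ge0/= -[X in _ <= X]expR0 ler_expR oppr_le0 sumr_ge0. Qed.

Let mrho n k : measurable_fun setT (rho n k).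
Proof.
apply: measurableT_comp => //; apply: measurableT_comp => //.
by apply: measurable_sum => j; exact: (measurableT_comp mx).
Qed.

Let mrho_history n k m : measurable_fun setT (rho n k : noise_history T X m -> R).
Proof.
apply: measurableT_comp => //; apply: measurableT_comp => //.
apply: measurable_sum => j; apply: (measurableT_comp mx).
exact: measurable_history_arrival.
Qed.

Let mcos : measurable_fun setT (@cos R).
Proof. exact: continuous_measurable_fun (@continuous_cos R). Qed.

Let rcos_ge0 (r a : R) : 0 <= r <= 1 -> 0 <= 1 + r * cos a.
Proof.
move=> /andP[r0 r1]; have : r * (- cos a) <= 1 * 1.
  apply: (le_trans (ler_wpM2l r0 (_ : - cos a <= 1))).
    by rewrite lerNl cos_geN1.
  by rewrite !mulr1.
lra.
Qed.

Section telescoping.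
Variables (phi e : R) (n : nat).
Hypothesis e0 : 0 < e.

(* From [U 0] to [U n] the Gaussian factors [expR (- x (T j w))] are replaced one
   by one by the noises. Adding 1 keeps the integrands nonnegative. *)
Let U k := (\int[P]_w (1 + rho n k w * cos (S k w + phi))%:E)%E.

Let mU k : measurable_fun setT (fun w => (1 + rho n k w * cos (S k w + phi))%:E).
Proof.
apply/measurable_EFinP; apply: measurable_funD => //; apply: measurable_funM => //.
by apply: (measurableT_comp mcos); exact: measurable_funD.
Qed.

Let c k w := \int[F (T k w)]_z cos (S k w + phi + y (T k w) * z).

(** The noise [k] is integrated given the history. The factor [rho n k.+1] looks at later arrivals,
    which is allowed because a history contains all of them. *)
Let U_step k : (k < n)%N ->
  U k.+1 = (\int[P]_w (1 + rho n k.+1 w * c k w)%:E)%E /\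
  measurable_fun setT (fun w => (1 + rho n k.+1 w * c k w)%:E).
Proof.
move=> kn.
pose f (z : noise_history T X k * R) :=
  (1 + rho n k.+1 z.1 * cos (S k z.1 + phi + y (T k z.1) * z.2))%:E.
have f0 z : (0 <= f z)%E by rewrite lee_fin rcos_ge0.
have mf : measurable_fun setT f.
  apply/measurable_EFinP; apply: measurable_funD => //; apply: measurable_funM.
    by apply: (measurableT_comp (@mrho_history n k.+1 k)).
  apply: (measurableT_comp mcos); apply: measurable_funD.
    apply: measurable_funD => //.
    by apply: (measurableT_comp (@mS_history k)).
  apply: measurable_funM => //; apply: (measurableT_comp my).
  by apply: (measurableT_comp (@measurable_history_arrival _ _ _ _ T X k k)).
have inner w : (\int[F (T k w)]_z f (w, z) = (1 + rho n k.+1 w * c k w)%:E)%E.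
  by rewrite /f/=; exact: (ge0_integral_cos_shift (mu := F (T k w)) (prob_kernel _)).
split; last first.
  have := measurable_noise_integral (X := X) F f0 mf.
  by under eq_fun do rewrite inner.
transitivity (\int[P]_w f (w, X k w))%E.
  by apply: eq_integral => w _; rewrite /f/= SS addrAC.
rewrite (conditional_noise_integral hX)//; apply: eq_integral => w _.
exact: inner.
Qed.

Let E k := (\int[P]_w (err e (T k w))%:E)%E.

Let c_close k w : (k < n)%N ->
  `|rho n k.+1 w * c k w - rho n k w * cos (S k w + phi)| <= err e (T k w).
Proof.
move=> kn; have -> : rho n k.+1 w * c k w - rho n k w * cos (S k w + phi) =
    rho n k.+1 w * (c k w - cos (S k w + phi) * expR (- x (T k w))).
  by rewrite (rho_recl _ kn); ring.
rewrite normrM; have /andP[r0 r1] := rho01 n k.+1 w; rewrite (ger0_norm r0).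
apply: (le_trans (ler_piMl (normr_ge0 _) r1)); exact: one_step.
Qed.

Let merrT k : measurable_fun setT (fun w => (err e (T k w))%:E).
Proof. by apply/measurable_EFinP; exact: (measurableT_comp (merr e)). Qed.

Let U_le k : (k < n)%N -> (U k.+1 <= U k + E k)%E.
Proof.
move=> kn; have [-> mc] := U_step kn.
rewrite -ge0_integralD//; last 2 first.
- by move=> w _; rewrite lee_fin rcos_ge0.
- by move=> w _; rewrite lee_fin err_ge0.
have cpos w : 0 <= 1 + rho n k.+1 w * c k w.
  rewrite -lee_fin -(ge0_integral_cos_shift (mu := F (T k w)) (prob_kernel _))//.
  by apply: integral_ge0 => z _; rewrite lee_fin rcos_ge0.
apply: ge0_le_integral => //.
- by move=> w _; rewrite lee_fin.
- by apply: emeasurable_funD.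
- move=> w _; rewrite -EFinD lee_fin; have := c_close w kn; rewrite ler_norml; lra.
Qed.

Let U_ge k : (k < n)%N -> (U k <= U k.+1 + E k)%E.
Proof.
move=> kn; have [-> mc] := U_step kn.
have cpos w : 0 <= 1 + rho n k.+1 w * c k w.
  rewrite -lee_fin -(ge0_integral_cos_shift (mu := F (T k w)) (prob_kernel _))//.
  by apply: integral_ge0 => z _; rewrite lee_fin rcos_ge0.
rewrite -ge0_integralD//; last 2 first.
- by move=> w _; rewrite lee_fin.
- by move=> w _; rewrite lee_fin err_ge0.
apply: ge0_le_integral => //.
- by move=> w _; rewrite lee_fin rcos_ge0.
- by apply: emeasurable_funD.
- move=> w _; rewrite -EFinD lee_fin; have := c_close w kn; rewrite ler_norml; lra.
Qed.

(** Campbell's inequality keeps the total error bounded uniformly in the number of replacements. *)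
Let Esum_le k : (\sum_(0 <= j < k) E j <= lambda%:E * \int[leb]_(u in `[0%R, +oo[) (err e u)%:E)%E.
Proof.
have err_supp u : ~~ (0 <= u <= tau) -> err e u = 0.
  move=> h; rewrite /err y_supp ?expr0n/= ?mulr0 ?addr0 ?mulr0//.
  by apply: contra h => /andP[h1 ->]; rewrite ltW.
have h := Campbell_le l0 hT k (merr e) (fun u => err_ge0 u e0) err_supp.
apply: le_trans h; rewrite -ge0_integral_sum//; last by move=> j w _; rewrite lee_fin err_ge0.
apply: ge0_le_integral => //.
- by move=> w _; apply: sume_ge0 => j _; rewrite lee_fin err_ge0.
- by apply: emeasurable_sum.
- by apply/measurable_EFinP; apply: measurable_sum => j; exact: (measurableT_comp (merr e)).
- by move=> w _; rewrite sumEFin.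
Qed.

Let U_telescope k : (k <= n)%N -> (U k <= U 0 + \sum_(0 <= j < k) E j)%E /\
  (U 0 <= U k + \sum_(0 <= j < k) E j)%E.
Proof.
elim: k => [|k IH] kn; first by rewrite big_geq// adde0.
have [IH1 IH2] := IH (ltnW kn).
rewrite big_nat_recr//=; split.
  by apply: (le_trans (U_le kn)); rewrite [leRHS]addeA leeD2r.
apply: (le_trans IH2); rewrite [(_ + E k)%R]addrC [leRHS]addeA leeD2r//.
exact: U_ge.
Qed.

Lemma Lindeberg_le :
  (\int[P]_w (1 + cos (S n w + phi))%:E <=
   \int[P]_w (1 + expR (- \sum_(0 <= j < n) x (T j w)) * cos phi)%:E +
   lambda%:E * \int[leb]_(u in `[0%R, +oo[) (err e u)%:E)%E.
Proof.
have [h _] := U_telescope (leqnn n).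
rewrite (_ : integral P _ _ = U n); last first.
  by apply: eq_integral => w _; rewrite /rho big_geq// oppr0 expR0 mul1r.
rewrite (_ : (\int[P]_w (1 + expR _ * cos phi)%:E)%E = U 0); last first.
  by apply: eq_integral => w _; rewrite /S (big_geq (leqnn 0)) add0r.
by apply: (le_trans h); rewrite leeD2l.
Qed.

Lemma Lindeberg_ge :
  (\int[P]_w (1 + expR (- \sum_(0 <= j < n) x (T j w)) * cos phi)%:E <=
   \int[P]_w (1 + cos (S n w + phi))%:E +
   lambda%:E * \int[leb]_(u in `[0%R, +oo[) (err e u)%:E)%E.
Proof.
have [_ h] := U_telescope (leqnn n).
rewrite [X in (_ <= X + _)%E](_ : _ = U n); last first.
  by apply: eq_integral => w _; rewrite /rho big_geq// oppr0 expR0 mul1r.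
rewrite (_ : (\int[P]_w (1 + expR _ * cos phi)%:E)%E = U 0); last first.
  by apply: eq_integral => w _; rewrite /S (big_geq (leqnn 0)) add0r.
by apply: (le_trans h); rewrite leeD2l.
Qed.

End telescoping.

(** Given the history, the new term has mean zero, so the cross terms vanish and variances add. *)
Let S_sqr n : (\int[P]_w (S n w ^+ 2)%:E =
  \sum_(0 <= j < n) \int[P]_w (y (T j w) ^+ 2 * noise_moment F 2 (T j w))%:E)%E.
Proof.
elim: n => [|n IH].
  rewrite big_geq//; apply: integral0_eq => w _.
  by rewrite /S big_geq// expr0n.
pose f (z : noise_history T X n * R) := ((S n z.1 + y (T n z.1) * z.2) ^+ 2)%:E.
have f0 z : (0 <= f z)%E by rewrite lee_fin sqr_ge0.
have mf : measurable_fun setT f.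
  apply/measurable_EFinP; apply: measurable_funX; apply: measurable_funD.
    by apply: (measurableT_comp (@mS_history n)).
  apply: measurable_funM => //; apply: (measurableT_comp my).
  by apply: (measurableT_comp (@measurable_history_arrival _ _ _ _ T X n n)).
have inner w : (\int[F (T n w)]_z f (w, z) =
    (S n w ^+ 2 + y (T n w) ^+ 2 * noise_moment F 2 (T n w))%:E)%E.
  have [/andP[u0 utau]|/y_supp yu] := boolP (0 < T n w <= tau).
    rewrite /f /=.
    exact: (integral_sqr_shift (mu := F (T n w)) (prob_kernel _) (fun r hr => hfin u0 hr) (hK1 u0) (S n w) (y (T n w))).
  rewrite /f /= yu expr0n/= mul0r addr0.
  transitivity ((S n w ^+ 2)%:E * F (T n w) setT)%E; last by rewrite prob_kernel mule1.
  rewrite -integral_cst//; apply: eq_integral => z _ /=.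
  by rewrite mul0r addr0.
transitivity (\int[P]_w f (w, X n w))%E.
  by apply: eq_integral => w _; rewrite /f/= SS.
rewrite (conditional_noise_integral hX)// big_nat_recr//= -IH -ge0_integralD//; last 4 first.
- by move=> w _; rewrite lee_fin sqr_ge0.
- by apply/measurable_EFinP; exact: measurable_funX.
- by move=> w _; rewrite lee_fin mulr_ge0 ?sqr_ge0// noise_moment2_ge0.
- apply/measurable_EFinP; apply: measurable_funM.
    by apply: measurable_funX; exact: (measurableT_comp my).
  exact: (measurableT_comp measurable_noise_moment2).
by apply: eq_integral => w _; rewrite inner EFinD.
Qed.

Lemma shot_sum_second_moment n :
  (\int[P]_w (S n w ^+ 2)%:E <=
   lambda%:E * \int[leb]_(u in `[0%R, +oo[) (y u ^+ 2 * noise_moment F 2 u)%:E)%E.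
Proof.
pose v u := y u ^+ 2 * noise_moment F 2 u.
have v0 u : 0 <= v u by rewrite mulr_ge0 ?sqr_ge0// noise_moment2_ge0.
have mv : measurable_fun setT v.
  by apply: measurable_funM; [exact: measurable_funX|exact: measurable_noise_moment2].
have v_supp u : ~~ (0 <= u <= tau) -> v u = 0.
  move=> h; rewrite /v y_supp ?expr0n/= ?mul0r//.
  by apply: contra h => /andP[h1 ->]; rewrite ltW.
have h := Campbell_le l0 hT n mv v0 v_supp.
apply: le_trans h; rewrite S_sqr -ge0_integral_sum//; last 2 first.
- by move=> j; apply/measurable_EFinP; exact: (measurableT_comp mv).
- by move=> j w _; rewrite lee_fin; exact: v0.
apply: ge0_le_integral => //.
- by move=> w _; apply: sume_ge0 => j _; rewrite lee_fin; exact: v0.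
- by apply: emeasurable_sum => j; apply/measurable_EFinP; exact: (measurableT_comp mv).
- by apply/measurable_EFinP; apply: measurable_sum => j; exact: (measurableT_comp mv).
- by move=> w _; rewrite sumEFin.
Qed.

Section limit.
Variable Y : Omega -> R.
Hypothesis mY : measurable_fun setT Y.
Hypothesis SY : {ae P, forall w, S n w @[n --> \oo] --> Y w}.

(** Fatou's lemma; the indicator of the complement of [N] turns almost sure convergence into
    convergence everywhere. *)
Lemma shot_limit_second_moment :
  (\int[P]_w (Y w ^+ 2)%:E <=
   lambda%:E * \int[leb]_(u in `[0%R, +oo[) (y u ^+ 2 * noise_moment F 2 u)%:E)%E.
Proof.
have [N [mN PN subN]] := SY.
have mNC : measurable (~` N) by exact: measurableC.
rewrite (_ : integral P _ _ = \int[P]_w ((\1_(~` N) w * Y w) ^+ 2)%:E)%E; last first.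
  apply: ge0_ae_eq_integral => //.
  - by apply/measurable_EFinP; exact: measurable_funX.
  - by apply/measurable_EFinP; apply: measurable_funX; apply: measurable_funM.
  - by move=> w _; rewrite lee_fin sqr_ge0.
  - by move=> w _; rewrite lee_fin sqr_ge0.
  exists N; split => //; move=> w /= h; apply: contrapT => Nw; apply: h => _.
  by rewrite indicE mem_set// mul1r.
apply: (@ge0_integral_cvg_le _ _ _ P (fun n w => (\1_(~` N) w * S n w) ^+ 2)).
- by move=> n; apply: measurable_funX; apply: measurable_funM.
- by move=> n w; exact: sqr_ge0.
- move=> w; rewrite !indicE; case: (boolP (w \in ~` N)) => [/set_mem Nw|_]; last first.
    by under eq_fun do rewrite mul0r; rewrite mul0r; exact: cvg_cst.
  have h : S n w @[n --> \oo] --> Y w by apply: contrapT => h; apply: Nw; exact: subN.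
  under eq_fun do rewrite mul1r; rewrite mul1r.
  by under eq_fun do rewrite expr2; rewrite expr2; apply: cvgM.
- apply: nearW => n; apply: le_trans (shot_sum_second_moment n).
  apply: ge0_le_integral => //.
  + by move=> w _; rewrite lee_fin sqr_ge0.
  + by apply/measurable_EFinP; apply: measurable_funX; apply: measurable_funM.
  + by apply/measurable_EFinP; exact: measurable_funX.
  + move=> w _; rewrite lee_fin indicE; case: (w \in _); rewrite ?mul1r// mul0r expr0n.
    exact: sqr_ge0.
Qed.

Let q u := 1 - expR (- x u).

(** Both sides of the Lindeberg comparison pass to the limit: dominated convergence for the noises,
    the Laplace functional for the Gaussian factors. The condition [0 <= cos phi] lets this constant
    leave the integral of a nonnegative function; other phases are recovered by
    [Rintegral_cos_shift]. *)
Lemma shot_limit_cos phi e eta : 0 < e -> 0 <= cos phi ->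
  (lambda%:E * \int[leb]_(u in `[0%R, +oo[) (err e u)%:E <= eta%:E)%E ->
  `|\int[P]_w cos (Y w + phi) -
    expR (- lambda * \int[leb]_(u in `[0%R, +oo[) q u) * cos phi| <= eta.
Proof.
move=> e0 cphi heta.
have Pcst (a : R) : (\int[P]_w a%:E = a%:E)%E.
  transitivity (a%:E * P setT)%E; last by rewrite probability_setT mule1.
  exact: integral_cst.
have one_plus (Z : Omega -> R) : measurable_fun setT Z ->
    (\int[P]_w (1 + cos (Z w + phi))%:E = (1 + \int[P]_w cos (Z w + phi))%:E)%E.
  move=> mZ.
  have mc : measurable_fun setT (fun w => cos (Z w + phi)).
    by apply: (measurableT_comp mcos); exact: measurable_funD.
  have i1 : P.-integrable [set: Omega] (EFin \o (fun=> 1 : R)).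
    exact: finite_measure_integrable_cst.
  have ic : P.-integrable [set: Omega] (EFin \o (fun w => cos (Z w + phi))).
    apply: (le_integrable measurableT _ _ i1); first exact/measurable_EFinP.
    by move=> w _ /=; rewrite lee_fin normr1 ler_norml cos_le1 cos_geN1.
  have := RintegralD measurableT i1 ic.
  rewrite [X in _ = X + _](_ : _ = 1); last by rewrite /Rintegral Pcst.
  move=> <-; rewrite /Rintegral fineK//; apply: integrable_fin_num => //.
  have -> : (fun w => (1 + cos (Z w + phi))%:E) =
    (EFin \o (fun=> 1)) \+ (EFin \o (fun w => cos (Z w + phi))) by apply/funext.
  exact: integrableD.
have cvg1 : (\int[P]_w (1 + cos (S n w + phi))%:E)%E @[n --> \oo] -->
    (\int[P]_w (1 + cos (Y w + phi))%:E)%E.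
  have [] // := @dominated_convergence _ _ _ P setT measurableT
    (fun n w => (1 + cos (S n w + phi))%:E) (fun w => (1 + cos (Y w + phi))%:E) (cst 2%:E).
  - move=> n; apply/measurable_EFinP; apply: measurable_funD => //.
    by apply: (measurableT_comp mcos); exact: measurable_funD.
  - apply/measurable_EFinP; apply: measurable_funD => //.
    by apply: (measurableT_comp mcos); exact: measurable_funD.
  - apply: filterS SY => w h _; apply: cvg_EFin; first exact: nearW.
    apply: cvgD; first exact: cvg_cst.
    apply: (cvg_comp (fun n => S n w + phi) cos); last exact: continuous_cos.
    by apply: cvgD => //; exact: cvg_cst.
  - exact: finite_measure_integrable_cst.
  - apply: nearW => w n _; rewrite /= lee_fin ger0_norm.
      by have := cos_le1 (S n w + phi); lra.
    by have := cos_geN1 (S n w + phi); lra.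
have q01 u : 0 <= q u <= 1.
  by rewrite /q subr_ge0 -{1}expR0 ler_expR oppr_le0 x0/= gerBl expR_ge0.
have q_supp u : ~~ (0 <= u <= tau) -> q u = 0.
  move=> h; rewrite /q /x y_supp ?expr0n/= ?mul0r ?oppr0 ?expR0 ?subrr//.
  by apply: contra h => /andP[h1 ->]; rewrite ltW.
have mq : measurable_fun setT q.
  apply: measurable_funB => //; apply: measurableT_comp => //.
  exact: measurableT_comp.
have cvg2 : (\int[P]_w (1 + expR (- \sum_(0 <= j < n) x (T j w)) * cos phi)%:E)%E @[n --> \oo] -->
    (1 + expR (- lambda * \int[leb]_(u in `[0%R, +oo[) q u) * cos phi)%:E.
  have h := cvg_Laplace_functional l0 hT mq q01 q_supp.
  rewrite (_ : (fun n => _) = (fun n => 1 + (cos phi)%:E *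
      \int[P]_w (\prod_(0 <= j < n) (1 - q (T j w)))%:E)%E); last first.
    apply/funext => n.
    have pE w : \prod_(0 <= j < n) (1 - q (T j w)) = expR (- \sum_(0 <= j < n) x (T j w)).
      by rewrite -sumrN expR_sum; apply: eq_bigr => j _; rewrite /q opprB addrCA subrr addr0.
    under [in RHS]eq_integral do rewrite pE.
    have mp : measurable_fun setT (fun w => (expR (- \sum_(0 <= j < n) x (T j w)))%:E).
      by apply/measurable_EFinP; exact: (mrho n 0).
    rewrite -ge0_integralZl_EFin//.
    rewrite -[X in (X + _)%E](Pcst 1) -ge0_integralD//; last 2 first.
    - by move=> w _; rewrite mule_ge0 ?lee_fin ?expR_ge0.
    - exact: measurable_funeM.
    by apply: eq_integral => w _; rewrite -EFinM -EFinD mulrC.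
  rewrite EFinD; apply: cvgeD => //; first exact: cvg_cst.
  by rewrite mulrC EFinM; apply: cvgeZl.
have b1 : ((1 + \int[P]_w cos (Y w + phi))%:E <=
    (1 + expR (- lambda * \int[leb]_(u in `[0%R, +oo[) q u) * cos phi)%:E + eta%:E)%E.
  rewrite -one_plus//.
  have cvg3 : (\int[P]_w (1 + expR (- \sum_(0 <= j < n) x (T j w)) * cos phi)%:E + eta%:E)%E @[n --> \oo] -->
      ((1 + expR (- lambda * \int[leb]_(u in `[0%R, +oo[) q u) * cos phi)%:E + eta%:E)%E.
    by apply: cvgeD => //; exact: cvg_cst.
  apply: (lee_cvg_to cvg1 cvg3); apply: nearW => n.
  by apply: (le_trans (Lindeberg_le phi n e0)); rewrite leeD2l.
have b2 : ((1 + expR (- lambda * \int[leb]_(u in `[0%R, +oo[) q u) * cos phi)%:E <=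
    (1 + \int[P]_w cos (Y w + phi))%:E + eta%:E)%E.
  rewrite -one_plus//.
  have cvg3 : (\int[P]_w (1 + cos (S n w + phi))%:E + eta%:E)%E @[n --> \oo] -->
      (\int[P]_w (1 + cos (Y w + phi))%:E + eta%:E)%E.
    by apply: cvgeD cvg1 (cvg_cst _); exact: fin_num_adde_defl.
  apply: (lee_cvg_to cvg2 cvg3); apply: nearW => n.
  by apply: (le_trans (Lindeberg_ge phi n e0)); rewrite leeD2l.
move: b1 b2; rewrite -!EFinD !lee_fin ler_norml; lra.
Qed.

End limit.

End Lindeberg.

(** * Asymptotics of the intensity *)

Section intensity_estimates.
Context {R : realType}.
Notation leb := (@lebesgue_measure R).
Variables (y k : R -> R) (M K : R).
Hypotheses (my : measurable_fun setT y) (mk : measurable_fun setT k).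
Hypothesis M0 : 0 <= M.
Hypothesis kM : forall u, 0 < u -> 0 <= k u <= M.
Hypothesis iy2 : leb.-integrable `]0, +oo[ (EFin \o (fun u => y u ^+ 2)).
Hypothesis iy4 : leb.-integrable `]0, +oo[ (EFin \o (fun u => y u ^+ 4)).
Let A2 := \int[leb]_(u in `]0, +oo[) (y u ^+ 2).
Let A4 := \int[leb]_(u in `]0, +oo[) (y u ^+ 4).
Let D : set (measurableTypeR R) := `]0, +oo[%classic.

Let mD : measurable D. Proof. exact: measurable_itv. Qed.

Let iZ (f : R -> R) c : leb.-integrable D (EFin \o f) ->
  leb.-integrable D (EFin \o (fun u => c * f u)).
Proof. by move=> h; exact: (integrableZl mD c h). Qed.

Let iD (f g : R -> R) : leb.-integrable D (EFin \o f) -> leb.-integrable D (EFin \o g) ->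
  leb.-integrable D (EFin \o (fun u => f u + g u)).
Proof. by move=> hf hg; exact: (integrableD mD hf hg). Qed.

Let idom (f g : R -> R) : measurable_fun setT f -> leb.-integrable D (EFin \o g) ->
  (forall u, 0 < u -> `|f u| <= g u) -> leb.-integrable D (EFin \o f).
Proof.
move=> mf ig fg; apply: (le_integrable mD _ _ ig).
  by apply/measurable_EFinP; exact: measurable_funTS.
move=> u; rewrite /D/= in_itv/= andbT => u0; rewrite lee_fin.
by apply: (le_trans (fg u u0)); exact: ler_norm.
Qed.

Lemma integral_closed_half_line (f : R -> R) :
  measurable_fun setT f ->
  (\int[leb]_(u in `[0%R, +oo[) (f u)%:E = \int[leb]_(u in `]0%R, +oo[) (f u)%:E)%E.
Proof.
move=> mf; apply/esym; apply: integral_itv_obnd_cbnd.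
by apply/measurable_EFinP; exact: measurable_funTS.
Qed.

Lemma integral_square_intensity_le :
  (\int[leb]_(u in `[0%R, +oo[) (y u ^+ 2 * k u)%:E <= (M * A2)%:E)%E.
Proof.
rewrite integral_closed_half_line; last by apply: measurable_funM => //; exact: measurable_funX.
have h : \int[leb]_(u in D) (M * y u ^+ 2) = M * A2 by rewrite RintegralZl.
rewrite -h /Rintegral fineK; last by apply: integrable_fin_num => //; exact: iZ.
apply: ge0_le_integral => //.
- by move=> u; rewrite /= in_itv/= andbT => u0; rewrite lee_fin mulr_ge0 ?sqr_ge0//; case/andP: (kM u0).
- apply/measurable_EFinP; apply: measurable_funTS; apply: measurable_funM => //.
  exact: measurable_funX.
- apply/measurable_EFinP; apply: measurable_funTS; apply: measurable_funM => //.
  exact: measurable_funX.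
- move=> u; rewrite /= in_itv/= andbT => u0; rewrite lee_fin mulrC ler_wpM2r ?sqr_ge0//.
  by case/andP: (kM u0).
Qed.

Lemma integral_error_eq e : 0 < e ->
  (\int[leb]_(u in `[0%R, +oo[) (M ^+ 2 * (e * y u ^+ 2 + e^-1 * y u ^+ 4 + y u ^+ 4))%:E =
   (M ^+ 2 * (e * A2 + e^-1 * A4 + A4))%:E)%E.
Proof.
move=> e0.
have i1 : leb.-integrable D (EFin \o (fun u => e * y u ^+ 2 + e^-1 * y u ^+ 4 + y u ^+ 4)).
  by apply: iD => //; apply: iD; exact: iZ.
rewrite integral_closed_half_line; last first.
  apply: measurable_funM => //; apply: measurable_funD; last exact: measurable_funX.
  by apply: measurable_funD; apply: measurable_funM => //; exact: measurable_funX.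
rewrite -[LHS]fineK; last by apply: integrable_fin_num => //; exact: (iZ _ i1).
congr EFin; transitivity (\int[leb]_(u in D) (M ^+ 2 * (e * y u ^+ 2 + e^-1 * y u ^+ 4 + y u ^+ 4))) => //.
rewrite RintegralZl// RintegralD//; last by apply: iD; exact: iZ.
by rewrite RintegralD//; [rewrite !RintegralZl|exact: iZ|exact: iZ].
Qed.

(* On [u < u0], [y^2 <= (s y^4 + 1 / s) / 2] bounds the contribution of the
   range where [k] is not close to its limit. *)
Lemma integral_expR_intensity e s u0 : 0 < e -> 0 < s -> 0 < u0 -> 0 <= K ->
  (forall u, u0 <= u -> `|k u - K| <= e) ->
  `|\int[leb]_(u in `[0, +oo[) (1 - expR (- (y u ^+ 2 * k u / 2))) - K * A2 / 2| <=
  (M ^+ 2 / 8 + (M + K) * s / 4) * A4 + e / 2 * A2 + (M + K) / (4 * s) * u0.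
Proof.
move=> e0 s0 u00 K0 ke.
pose q u := 1 - expR (- (y u ^+ 2 * k u / 2)).
have mq : measurable_fun setT q.
  apply: measurable_funB => //; apply: measurableT_comp => //; apply: measurableT_comp => //.
  apply: measurable_funM => //; apply: measurable_funM => //; exact: measurable_funX.
pose I (u : R) : R := \1_(`]0, u0[ : set R) u.
have mI : measurable_fun setT I by apply: measurable_indic; exact: measurable_itv.
have eI : (\int[leb]_(u in D) (I u)%:E = u0%:E)%E.
  rewrite integral_indic//.
  rewrite setIidl; last first.
    by move=> u; rewrite /D/= !in_itv/= => /andP[->].
  have : leb `]0%R, u0[ = u0%:E by rewrite lebesgue_measure_itv/= lte_fin u00 oppr0 adde0.
  by [].
have iI : leb.-integrable D (EFin \o I).
  apply/integrableP; split; first by apply/measurable_EFinP; exact: measurable_funTS.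
  have -> : (\int[leb]_(u in D) `|(EFin \o I) u| = \int[leb]_(u in D) (I u)%:E)%E.
    by apply: eq_integral => u _; rewrite /= ger0_norm// /I indicE.
  by rewrite eI ltry.
have II : \int[leb]_(u in D) I u = u0 by rewrite /Rintegral eI.
pose g u := (M ^+ 2 / 8 + (M + K) * s / 4) * y u ^+ 4 + e / 2 * y u ^+ 2 + (M + K) / (4 * s) * I u.
have ig : leb.-integrable D (EFin \o g) by apply: iD; [apply: iD; exact: iZ|exact: iZ].
have Ig : \int[leb]_(u in D) g u = (M ^+ 2 / 8 + (M + K) * s / 4) * A4 + e / 2 * A2 + (M + K) / (4 * s) * u0.
  rewrite /g RintegralD//; [|by apply: iD; exact: iZ|exact: iZ].
  rewrite RintegralD//; [|exact: iZ|exact: iZ].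
  by rewrite !RintegralZl// II.
have bound u : 0 < u -> `|q u - K / 2 * y u ^+ 2| <= g u.
  move=> pu; have /andP[k0 k1] := kM pu; rewrite /q.
  set a := y u ^+ 2; have a0 : 0 <= a by exact: sqr_ge0.
  have y4 : y u ^+ 4 = a ^+ 2 by rewrite /a -exprM.
  have x0 : 0 <= a * k u / 2 by rewrite divr_ge0// mulr_ge0.
  have h1 := expRN_Taylor x0.
  have k2 : (a * k u / 2) ^+ 2 / 2 <= M ^+ 2 / 8 * a ^+ 2.
    have -> : (a * k u / 2) ^+ 2 / 2 = (k u ^+ 2) * (a ^+ 2 / 8) by field.
    have -> : M ^+ 2 / 8 * a ^+ 2 = M ^+ 2 * (a ^+ 2 / 8) by field.
    by rewrite ler_wpM2r ?divr_ge0 ?sqr_ge0// ler_sqr.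
  have h2 : a * `|k u - K| / 2 <= (M + K) * s / 4 * a ^+ 2 + e / 2 * a + (M + K) / (4 * s) * I u.
    have t1 : 0 <= (M + K) * s / 4 * a ^+ 2.
      by rewrite mulr_ge0 ?sqr_ge0// divr_ge0// mulr_ge0 ?addr_ge0// ltW.
    have t2 : 0 <= e / 2 * a by rewrite mulr_ge0// divr_ge0// ltW.
    have I0 : 0 <= I u by [].
    have t3 : 0 <= (M + K) / (4 * s) * I u.
      by rewrite mulr_ge0// divr_ge0 ?addr_ge0// mulr_ge0// ltW.
    have [h|h] := leP u0 u.
      have : a * `|k u - K| <= a * e by apply: (ler_wpM2l a0); exact: ke.
      lra.
    have -> : I u = 1 by rewrite /I indicE mem_set//= in_itv/= pu h.
    have kK : `|k u - K| <= M + K by rewrite ler_norml; apply/andP; split; lra.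
    have s2 : 0 <= (M + K) * (s * a - 1) ^+ 2 / (4 * s).
      by apply: divr_ge0; [rewrite mulr_ge0 ?sqr_ge0// addr_ge0|rewrite mulr_ge0// ltW].
    (* Completing the square: [s a^2 / 4 + 1 / (4 s) - a / 2 = (s a - 1)^2 / (4 s)]. *)
    have -> : (M + K) * s / 4 * a ^+ 2 + e / 2 * a + (M + K) / (4 * s) * 1 =
       e / 2 * a + (M + K) * a / 2 + (M + K) * (s * a - 1) ^+ 2 / (4 * s).
      by field; exact: lt0r_neq0.
    have : a * `|k u - K| <= a * (M + K) by apply: (ler_wpM2l a0).
    lra.
  have -> : 1 - expR (- (a * k u / 2)) - K / 2 * a =
     - (expR (- (a * k u / 2)) - (1 - a * k u / 2)) + a * (k u - K) / 2 by field.
  apply: (le_trans (ler_normD _ _)); rewrite normrN.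
  rewrite [X in _ + X <= _](_ : _ = a * `|k u - K| / 2); last first.
    rewrite -mulrA normrM (ger0_norm a0) normrM mulrA; congr (_ * _).
    by rewrite ger0_norm// invr_ge0.
  by rewrite /g y4 -/a; lra.
have iqd : leb.-integrable D (EFin \o (fun u => q u - K / 2 * y u ^+ 2)).
  apply: (idom _ ig bound); apply: measurable_funB => //.
  by apply: measurable_funM => //; exact: measurable_funX.
have iq : leb.-integrable D (EFin \o q).
  have -> : q = (fun u => (q u - K / 2 * y u ^+ 2) + K / 2 * y u ^+ 2).
    by apply/funext => u; rewrite subrK.
  by apply: iD => //; exact: iZ.
have -> : \int[leb]_(u in `[0, +oo[) q u = \int[leb]_(u in D) q u.
  by rewrite /Rintegral integral_closed_half_line.
have -> : K * A2 / 2 = \int[leb]_(u in D) (K / 2 * y u ^+ 2).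
  by rewrite RintegralZl// mulrAC.
rewrite -RintegralB//; last exact: iZ.
rewrite -Ig; apply: (le_trans (le_normr_Rintegral mD iqd)).
apply: le_Rintegral => //; first exact: integrable_norm iqd.
by move=> u; rewrite /D/= in_itv/= andbT => u1; exact: bound.
Qed.

End intensity_estimates.

(** * The kernel of a linear combination of shot noise values *)

Section shot_kernel.
Context {R : realType}.
Notation leb := (@lebesgue_measure R).
Variable m : R.
Hypotheses (m0 : 0 < m) (m1 : m < 1 / 2).
Let D : set (measurableTypeR R) := `]0, +oo[%classic.

Let mD : measurable D. Proof. exact: measurable_itv. Qed.

Lemma log_excess_le0 (s u : R) : s <= 0 -> log_excess s u = 0.
Proof. by rewrite /log_excess leNgt => /negbTE ->. Qed.

Lemma le_log_excess (s t u : R) : s <= t -> log_excess s u <= log_excess t u.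
Proof.
move=> st; have [s0|s0] := leP s 0; first by rewrite log_excess_le0// log_excess_ge0.
have t0 := lt_le_trans s0 st; rewrite /log_excess s0 t0 ge_max !le_max.
by rewrite lerD2r ler_ln ?posrE// st lexx orbT.
Qed.

(** The closed form of the integral in [integral_log_excess_cov]. The diagonal is separate because
    the facts on [Kummer_integral] require a positive argument, and there the logarithm is 0. *)
Definition log_excess_cov (s t : R) : R :=
  if (s <= 0) || (t <= 0) then 0
  else if s == t then s * Gamma (2 * m + 1)
  else Num.min s t * Kummer_integral m m (ln (Num.max s t / Num.min s t)).

Let p (s u : R) : R := log_excess s u `^ m.

Let mp s : measurable_fun setT (p s).
Proof. exact: (measurableT_comp (measurable_powR m) (measurable_log_excess s)). Qed.

Let p0 s u : 0 <= p s u. Proof. exact: powR_ge0. Qed.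

Let p_le0 s u : s <= 0 -> p s u = 0.
Proof. by move=> s0; rewrite /p log_excess_le0// powR0// gt_eqF. Qed.

Lemma integral_log_excess_cov s t :
  (\int[leb]_(u in `]0%R, +oo[) (log_excess s u `^ m * log_excess t u `^ m)%:E =
   (log_excess_cov s t)%:E)%E.
Proof.
rewrite /log_excess_cov; have [s0|s0] := leP s 0.
  by apply: integral0_eq => u _; rewrite -/(p s u) p_le0// mul0r.
have [t0|t0] := leP t 0.
  by apply: integral0_eq => u _; rewrite -/(p t u) p_le0// mulr0.
rewrite /=; have [st|ts|->] := ltgtP s t.
- exact: integral_log_excessM.
- rewrite -(integral_log_excessM m0 m1 t0 ts); apply: eq_integral => u _.
  by rewrite mulrC.
- have m20 : 0 < 2 * m by rewrite mulr_gt0.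
  rewrite -(integral_log_excess_pow t0 m20); apply: eq_integral => u _.
  rewrite mulr2n mulrDl mul1r powRD//; apply/implyP => /eqP h.
  by move: m0; lra.
Qed.

(** Homogeneity of degree 1 is the self-similarity that cancels the normalisation by [c]. *)
Lemma log_excess_covZ c s t : 0 < c -> log_excess_cov (c * s) (c * t) = c * log_excess_cov s t.
Proof.
move=> c0; have hs : (c * s <= 0) = (s <= 0) by rewrite pmulr_rle0.
have ht : (c * t <= 0) = (t <= 0) by rewrite pmulr_rle0.
rewrite /log_excess_cov.
move: (Gamma _) (@Kummer_integral R m m) => G Kf; rewrite hs ht; have [_|] := boolP ((s <= 0) || (t <= 0)); first exact: (esym (mulr0 c)).
rewrite negb_or -!ltNge => /andP[s0 t0].
have cn0 : c != 0 by exact: lt0r_neq0.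
rewrite (inj_eq (mulfI cn0)); case: ifP => _; first by rewrite mulrA.
have -> : Num.min (c * s) (c * t) = c * Num.min s t by rewrite minr_pMr// ltW.
have -> : Num.max (c * s) (c * t) = c * Num.max s t by rewrite maxr_pMr// ltW.
rewrite -mulrA; congr (_ * (_ * Kf (ln _))).
have : Num.min s t != 0 by rewrite lt0r_neq0// lt_min s0.
move: (Num.min s t) (Num.max s t) => x y x0; by field; rewrite x0 cn0.
Qed.

Let integrable_pp s t : leb.-integrable D (EFin \o (fun u => p s u * p t u)).
Proof.
apply/integrableP; split.
  by apply/measurable_EFinP; apply: measurable_funTS; apply: measurable_funM; exact: mp.
have -> : (\int[leb]_(u in D) `|(EFin \o (fun u => p s u * p t u)%R) u| =
    \int[leb]_(u in D) (p s u * p t u)%:E)%E.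
  by apply: eq_integral => u _; rewrite /= ger0_norm// mulr_ge0.
by rewrite integral_log_excess_cov ltry.
Qed.

Variables (n : nat) (t a : 'I_n -> R).

(** The cut at [0 < u] discards the values of [log_excess] at nonpositive [u], where [ln u] is 0 by
    convention; the support is then bounded. *)
Definition shot_kernel (c u : R) : R :=
  if 0 < u then \sum_(i < n) a i * log_excess (c * t i) u `^ m else 0.

Lemma measurable_shot_kernel c : measurable_fun setT (shot_kernel c).
Proof.
apply: measurable_fun_ifT => //.
  exact: measurable_fun_ltr.
by apply: measurable_sum => i; apply: measurable_funM => //; exact: mp.
Qed.

Lemma shot_kernel_supp c u : 0 < c ->
  ~~ (0 < u <= c * \sum_(i < n) `|t i|) -> shot_kernel c u = 0.
Proof.
move=> c0; rewrite /shot_kernel; case: ifP => //= u0; rewrite -ltNge => hu.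
rewrite big1// => i _; rewrite log_excess_ge ?powR0 ?gt_eqF ?mulr0//.
apply: le_trans (ltW hu); rewrite ler_pM2l// (bigD1 i)//= (le_trans (ler_norm _))//.
by rewrite lerDl sumr_ge0.
Qed.

Let sq u c : 0 < u -> shot_kernel c u ^+ 2 =
  \sum_(i < n) \sum_(j < n) a i * a j * (p (c * t i) u * p (c * t j) u).
Proof.
move=> u0; rewrite /shot_kernel u0 expr2 mulr_suml; apply: eq_bigr => i _.
by rewrite mulr_sumr; apply: eq_bigr => j _; rewrite /p; ring.
Qed.

Let sum_integrable I (s : seq I) (f : I -> R -> R) :
  (forall i, leb.-integrable D (EFin \o f i)) ->
  leb.-integrable D (EFin \o (fun u => \sum_(i <- s) f i u)) /\
  \int[leb]_(u in D) (\sum_(i <- s) f i u) = \sum_(i <- s) \int[leb]_(u in D) f i u.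
Proof.
move=> hf; elim: s => [|i s [IH1 IH2]].
  have e0 : (fun u => \sum_(i <- [::]) f i u) = cst 0 by apply/funext => u; rewrite big_nil.
  rewrite e0 big_nil; split; first exact: integrable0.
  by rewrite /Rintegral integral0.
have e1 : (fun u => \sum_(j <- i :: s) f j u) = (fun u => f i u + \sum_(j <- s) f j u).
  by apply/funext => u; rewrite big_cons.
rewrite e1 big_cons; split; first exact: (integrableD mD (hf i) IH1).
by rewrite RintegralD// IH2.
Qed.

Let sq_facts c : 0 < c ->
  leb.-integrable D (EFin \o (fun u => shot_kernel c u ^+ 2)) /\
  \int[leb]_(u in D) (shot_kernel c u ^+ 2) =
    c * \sum_(i < n) \sum_(j < n) a i * a j * log_excess_cov (t i) (t j).
Proof.
move=> c0.
pose g i u := \sum_(j < n) a i * a j * (p (c * t i) u * p (c * t j) u).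
have gi i j : leb.-integrable D (EFin \o (fun u => a i * a j * (p (c * t i) u * p (c * t j) u))).
  exact: (integrableZl mD _ (integrable_pp _ _)).
have [h1 h2] := sum_integrable (index_enum 'I_n) (fun i => (sum_integrable (index_enum 'I_n) (gi i)).1).
have eqD u : u \in D -> shot_kernel c u ^+ 2 = \sum_(i < n) g i u.
  by rewrite inE /D/= in_itv/= andbT => u0; rewrite sq.
split.
  apply: (eq_integrable mD _ _ _ h1) => u uD /=; by rewrite eqD.
transitivity (\int[leb]_(u in D) (\sum_(i < n) g i u)); first exact: eq_Rintegral.
rewrite h2 mulr_sumr; apply: eq_bigr => i _.
rewrite (sum_integrable (index_enum 'I_n) (gi i)).2 mulr_sumr; apply: eq_bigr => j _.
rewrite RintegralZl; [|exact: mD|exact: integrable_pp].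
rewrite /Rintegral integral_log_excess_cov/= log_excess_covZ//; ring.
Qed.

Definition integrable_shot_kernel_sqr c (c0 : 0 < c) := (sq_facts c0).1.
Definition integral_shot_kernel_sqr c (c0 : 0 < c) := (sq_facts c0).2.

Let A := \sum_(i < n) `|a i|.
Let ts := 1 + \sum_(i < n) `|t i|.

Let ts0 : 0 < ts. Proof. by rewrite ltr_pwDl// sumr_ge0. Qed.

(** One time [ts] dominates all the [t i], so fourth powers need a single Gamma integral and no
    fourfold products. The 1 in [ts] keeps it positive when all the times are 0. *)
Let kernel_le c u : 0 < c -> `|shot_kernel c u| <= A * p (c * ts) u.
Proof.
move=> c0; rewrite /shot_kernel; case: ifP => _; last first.
  by rewrite normr0 mulr_ge0 ?sumr_ge0.
apply: (le_trans (ler_norm_sum _ _ _)); rewrite /A mulr_suml; apply: ler_sum => i _.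
rewrite normrM; apply: (ler_wpM2l (normr_ge0 _)); rewrite ger0_norm ?powR_ge0//.
apply: ge0_ler_powR; rewrite ?nnegrE ?log_excess_ge0 ?(ltW m0)//.
apply: le_log_excess; rewrite ler_pM2l// /ts (bigD1 i)//= (le_trans (ler_norm _))//.
by rewrite addrCA lerDl addr_ge0// sumr_ge0.
Qed.

Let p4 s : 0 < s ->
  leb.-integrable D (EFin \o (fun u => p s u ^+ 4)) /\
  \int[leb]_(u in D) (p s u ^+ 4) = s * Gamma (4 * m + 1).
Proof.
move=> s0.
have h : (\int[leb]_(u in D) (p s u ^+ 4)%:E = (s * Gamma (4 * m + 1))%:E)%E.
  rewrite -(integral_log_excess_pow s0 (_ : 0 < 4 * m)) ?mulr_gt0//.
  apply: eq_integral => u _; rewrite /p [4 * m]mulrC powRrM powR_mulrn//.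
  exact: powR_ge0.
split; last by rewrite /Rintegral h.
apply/integrableP; split.
  by apply/measurable_EFinP; apply: measurable_funTS; apply: measurable_funX; exact: mp.
have -> : (\int[leb]_(u in D) `|(EFin \o (fun u => p s u ^+ 4)%R) u| =
    \int[leb]_(u in D) (p s u ^+ 4)%:E)%E.
  by apply: eq_integral => u _; rewrite /= ger0_norm// exprn_ge0.
by rewrite h ltry.
Qed.

Let fourth c : 0 < c ->
  leb.-integrable D (EFin \o (fun u => shot_kernel c u ^+ 4)) /\
  \int[leb]_(u in D) (shot_kernel c u ^+ 4) <= c * (A ^+ 4 * (ts * Gamma (4 * m + 1))).
Proof.
move=> c0; have cts : 0 < c * ts by rewrite mulr_gt0.
have [i4 e4] := p4 cts.
have i5 : leb.-integrable D (EFin \o (fun u => A ^+ 4 * p (c * ts) u ^+ 4)).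
  exact: (integrableZl mD _ i4).
have le4 u : `|shot_kernel c u ^+ 4| <= A ^+ 4 * p (c * ts) u ^+ 4.
  by rewrite normrX -exprMn lerXn2r ?nnegrE// ?kernel_le// mulr_ge0// sumr_ge0.
have mk : measurable_fun setT (fun u => shot_kernel c u ^+ 4).
  by apply: measurable_funX; exact: measurable_shot_kernel.
have i6 : leb.-integrable D (EFin \o (fun u => shot_kernel c u ^+ 4)).
  apply: (le_integrable mD _ _ i5).
    by apply/measurable_EFinP; exact: measurable_funTS.
  by move=> u _ /=; rewrite lee_fin (le_trans (le4 u))// ler_norm.
split => //.
apply: (@le_trans _ _ (\int[leb]_(u in D) (A ^+ 4 * p (c * ts) u ^+ 4))).
  by apply: le_Rintegral => // u _; apply: le_trans (le4 u); exact: ler_norm.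
by rewrite RintegralZl// e4 le_eqVlt; apply/orP; left; apply/eqP; ring.
Qed.

Definition integrable_shot_kernel_pow4 c (c0 : 0 < c) := (fourth c0).1.

Lemma integral_shot_kernel_pow4 : exists2 C, 0 <= C &
  forall c, 0 < c -> \int[leb]_(u in D) (shot_kernel c u ^+ 4) <= c * C.
Proof.
exists (A ^+ 4 * (ts * Gamma (4 * m + 1))); last by move=> c c0; case: (fourth c0).
apply: mulr_ge0; first by rewrite exprn_ge0// sumr_ge0.
by rewrite mulr_ge0 ?ltW// Gamma_gt0//; move: (m0); lra.
Qed.

End shot_kernel.

(** * Covariance of the limit *)

Section Hadamard_covariance.
Context {R : realType} d (Omega : measurableType d) (P : probability Omega R).
Variables (alpha : R) (B : R -> {RV P >-> R}).
Hypotheses (halpha : 1 < alpha < 2) (hB : Hadamard_fBm alpha B).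
Let m := (alpha - 1) / 2.

Let B2 t : 0 <= t -> (\int[P]_w (B t w ^+ 2)%:E = t%:E)%E.
Proof. by have [_ _ _ h _] := hB; move=> /h; rewrite unlock. Qed.

(** Cauchy-Schwarz for known second moments, as [|X Y| <= (s / 2) X^2 + Y^2 / (2 s)]: with [s] the
    ratio of the two norms, each term contributes half of the bound. *)
Lemma expectation_mulr_le (X Y : Omega -> R) (v s : R) :
  measurable_fun setT X -> measurable_fun setT Y -> 0 < s ->
  (\int[P]_w (X w ^+ 2)%:E = v%:E)%E -> (\int[P]_w (Y w ^+ 2)%:E = (s ^+ 2 * v)%:E)%E ->
  (`|\int[P]_w (X w * Y w)%:E| <= (s * v)%:E)%E.
Proof.
move=> mX mY s0 hX hY.
have mXY : measurable_fun setT (fun w => (X w * Y w)%:E).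
  by apply/measurable_EFinP; exact: measurable_funM.
apply: (le_trans (le_abse_integral P measurableT mXY)).
have -> : ((s * v)%:E = (s / 2)%:E * \int[P]_w (X w ^+ 2)%:E + (2 * s)^-1%:E * \int[P]_w (Y w ^+ 2)%:E)%E.
  rewrite hX hY -!EFinM -EFinD; congr EFin; field; exact: lt0r_neq0.
have s20 : 0 <= s / 2 by rewrite divr_ge0// ltW.
have s20' : 0 <= (2 * s)^-1 by rewrite invr_ge0 mulr_ge0// ltW.
rewrite -!ge0_integralZl_EFin//; last 4 first.
- by move=> w _; rewrite lee_fin sqr_ge0.
- by apply/measurable_EFinP; exact: measurable_funX.
- by move=> w _; rewrite lee_fin sqr_ge0.
- by apply/measurable_EFinP; exact: measurable_funX.
rewrite -ge0_integralD//; last 4 first.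
- by move=> w _; rewrite -EFinM lee_fin mulr_ge0// sqr_ge0.
- by apply/measurable_EFinP; apply: measurable_funM => //; exact: measurable_funX.
- by move=> w _; rewrite -EFinM lee_fin mulr_ge0// sqr_ge0.
- by apply/measurable_EFinP; apply: measurable_funM => //; exact: measurable_funX.
apply: ge0_le_integral => //.
- exact: measurableT_comp.
- apply/measurable_EFinP; apply: measurable_funD; apply: measurable_funM => //; exact: measurable_funX.
- move=> w _; rewrite -!EFinM -EFinD lee_fin normrM.
  have := sqr_ge0 (s * `|X w| - `|Y w|).
  rewrite -(real_normK (num_real (X w))) -(real_normK (num_real (Y w))).
  move: (`|X w|) (`|Y w|) => a b h.
  have -> : s / 2 * a ^+ 2 + (2 * s)^-1 * b ^+ 2 = a * b + (s * a - b) ^+ 2 / (2 * s).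
    by field; exact: lt0r_neq0.
  by rewrite lerDl divr_ge0// mulr_ge0// ltW.
Qed.

(** Puts the covariance in the form that the shot noise produces. Time 0 is settled by [B 0 = 0]
    almost surely, the diagonal by the variance, and the other pairs by the Kummer integral. *)
Lemma Hadamard_fBm_covariance s t : 0 <= s -> 0 <= t ->
  (\int[P]_w (B s w * B t w)%:E = (log_excess_cov m s t / Gamma alpha)%:E)%E.
Proof.
move=> s0 t0; have [_ _ B0 _ hcov] := hB; have /andP[a1 a2] := halpha.
have G0 : Gamma alpha != 0 by rewrite lt0r_neq0// Gamma_gt0//; lra.
have mBB (x y : R) : measurable_fun setT (fun w => (B x w * B y w)%:E).
  by apply/measurable_EFinP; exact: measurable_funM.
have I0 : (\int[P]_w (cst (0 : \bar R) w) = 0)%E by exact: integral0.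
have [s1|s1] := leP s 0.
  rewrite /log_excess_cov s1 mul0r (_ : s = 0); last lra.
  rewrite -[RHS]I0; apply: ae_eq_integral => //; apply: filterS B0 => w /= -> _.
  by rewrite mul0r.
have [t1|t1] := leP t 0.
  rewrite /log_excess_cov t1 orbT mul0r (_ : t = 0); last lra.
  rewrite -[RHS]I0; apply: ae_eq_integral => //; apply: filterS B0 => w /= -> _.
  by rewrite mulr0.
rewrite /log_excess_cov !leNgt s1 t1 /=.
have [<-|st] /= := eqVneq s t.
  have -> : 2 * m + 1 = alpha by rewrite /m; field.
  by rewrite mulfK//; under eq_integral do rewrite -expr2; exact: B2.
(* By Cauchy-Schwarz the covariance of [B 1] and [B (expR z)] grows slower than
   [expR z], the growth of the other solutions of Kummer's equation. *)
have bound z : 0 < z ->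
    `|C_coef alpha * Tricomi_Psi ((1 - alpha) / 2) (1 - alpha) z| <= 1 * expR (z / 2).
  move=> z0; have e1 : 1 < expR z by rewrite expR_gt1.
  have := hcov 1 (expR z) ltr01 (expR_gt0 z).
  rewrite lt_eqF// => /(_ isT); rewrite unlock.
  rewrite (min_l (ltW e1)) (max_r (ltW e1)) divr1 expRK mulr1 mul1r => h.
  have BE : (\int[P]_w (B (expR z) w ^+ 2)%:E = (expR (z / 2) ^+ 2 * 1)%:E)%E.
    rewrite B2 ?expR_ge0// mulr1 expr2 -expRD; congr (expR _)%:E; by field.
  have mB1 : measurable_fun setT (B 1) by [].
  have mBz : measurable_fun setT (B (expR z)) by [].
  have := expectation_mulr_le mB1 mBz (expR_gt0 (z / 2)) (B2 ler01) BE.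
  by rewrite h mulr1.
have := hcov s t s1 t1 st; rewrite unlock => ->.
have z0 : 0 < ln (Num.max s t / Num.min s t).
  rewrite ln_gt0// ltr_pdivlMr ?mul1r ?lt_min ?s1//.
  by case: (ltgtP s t) st.
have h := Tricomi_Psi_integral halpha bound z0.
congr EFin; rewrite mulrAC h (C_coefE halpha).
have G1 : Gamma ((1 + alpha) / 2) != 0 by rewrite lt0r_neq0// Gamma_gt0//; lra.
have cancel (g0 g1 k x : R) : g0 != 0 -> g1 != 0 -> g1 / g0 / g1 * k * x = x * k / g0.
  by move=> h0 h1; field; rewrite h0 h1.
exact: cancel.
Qed.

End Hadamard_covariance.

(** * Gaussian laws *)

Section Gaussian_Fourier.
Context {R : realType}.
Notation leb := (@lebesgue_measure R).
Variable c : R.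
Hypothesis c0 : 0 < c.
Let D : set (measurableTypeR R) := `]0, +oo[%classic.

Let mD : measurable D. Proof. exact: measurable_itv. Qed.

Let w (x : R) : R := expR (- (c * x ^+ 2)).

Let w0 x : 0 <= w x. Proof. exact: expR_ge0. Qed.

(** Since [c x^2 - x + 1 / (4 c)] is a square, [w x <= C e^(-x)]: polynomial multiples of [w] are
    dominated by Euler integrands. *)
Let C := expR ((4 * c)^-1).

Let w_le x : w x <= C * expR (- x).
Proof.
rewrite /w /C -expRD ler_expR.
have : 0 <= (2 * c * x - 1) ^+ 2 / (4 * c) by rewrite divr_ge0 ?sqr_ge0// mulr_ge0// ltW.
have -> : (2 * c * x - 1) ^+ 2 / (4 * c) = c * x ^+ 2 - x + (4 * c)^-1.
  by field; exact: lt0r_neq0.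
lra.
Qed.

Let dw (x : R) : is_derive x 1 w (- (2 * c * x) * w x).
Proof.
rewrite /w; have d : is_derive x 1 (fun x => - (c * x ^+ 2)) (- (2 * c * x)).
  apply: is_derive_eq; rewrite /GRing.scale/=; ring.
by have := is_derive1_comp (is_derive_expR _) d; rewrite /GRing.scale/= mulrC.
Qed.

Let cw : continuous w.
Proof. by move=> x; exact: is_derive_continuous (dw x). Qed.

Let mw : measurable_fun setT w.
Proof. exact: continuous_measurable_fun cw. Qed.

Let ix k (f : R -> R) (B : R) : measurable_fun setT f -> (forall x, 0 < x -> `|f x| <= B * x ^+ k) ->
  leb.-integrable D (EFin \o (fun x => f x * w x)).
Proof.
move=> mf fB; have k0 : 0 < k%:R + 1 :> R by rewrite ltr_wpDl.
have h := integrable_Euler k0.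
have B0 : 0 <= B.
  have := fB 1 ltr01; rewrite expr1n mulr1; exact: le_trans.
have h2 : leb.-integrable D (EFin \o (fun x => (B * C) * (x `^ (k%:R + 1 - 1) * expR (- x)))).
  exact: (integrableZl mD _ h).
apply: (le_integrable mD _ _ h2).
  by apply/measurable_EFinP; apply: measurable_funTS; exact: measurable_funM.
move=> x; rewrite /D/= in_itv/= andbT => x0; rewrite lee_fin addrK powR_mulrn; last exact: ltW.
apply: le_trans (ler_norm _); rewrite normrM (ger0_norm (w0 x)).
have -> : B * C * (x ^+ k * expR (- x)) = (B * x ^+ k) * (C * expR (- x)) by ring.
by apply: ler_pM => //; exact: fB.
Qed.

Let cvg_zero (f : R -> R) k : (forall x, 0 < x -> `|f x| <= x ^+ k) ->
  f x * w x @[x --> +oo] --> (0 : R).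
Proof.
move=> fk; apply: norm_cvg0.
apply: (@squeeze_cvgr _ _ _ _ (cst 0) (fun x => C * (x `^ k.+1%:R * expR (- x)))).
- near=> x; rewrite normr_ge0/= normrM (ger0_norm (w0 x)).
  have x1 : 1 < x by near: x; exact: nbhs_pinfty_gt.
  have x0 : 0 < x by lra.
  rewrite powR_mulrn ?(ltW x0)// mulrCA; apply: ler_pM => //.
  apply: (le_trans (fk x x0)); rewrite exprS ler_peMl ?exprn_ge0// ltW.
- exact: cvg_cst.
- rewrite -[X in _ --> X](mulr0 C); apply: cvgM; first exact: cvg_cst.
  exact: cvg_pow_expN.
Unshelve. all: by end_near. Qed.

Let mcos (t : R) : measurable_fun setT (fun x => cos (t * x)).
Proof.
apply: measurableT_comp; first exact: continuous_measurable_fun (@continuous_cos R).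
exact: measurable_funM.
Qed.

Let msin (t : R) : measurable_fun setT (fun x => sin (t * x)).
Proof.
apply: measurableT_comp; first exact: continuous_measurable_fun (@continuous_sin R).
exact: measurable_funM.
Qed.

Let cos_norm (x : R) : `|cos x| <= 1. Proof. by rewrite ler_norml cos_le1 cos_geN1. Qed.
Let sin_norm (x : R) : `|sin x| <= 1. Proof. by rewrite ler_norml sin_le1 sin_geN1. Qed.

Let icos t : leb.-integrable D (EFin \o (fun x => cos (t * x) * w x)).
Proof.
apply: (@ix 0 _ 1); first exact: mcos.
by move=> x _; rewrite expr0 mulr1.
Qed.

Let ixsin t : leb.-integrable D (EFin \o (fun x => x * sin (t * x) * w x)).
Proof.
apply: (@ix 1 _ 1); first by apply: measurable_funM => //; exact: msin.
by move=> x x0; rewrite normrM (gtr0_norm x0) expr1 mul1r ler_piMr// ltW.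
Qed.

Let i1 : leb.-integrable D (EFin \o (fun x => 1 * w x)).
Proof. by apply: (@ix 0 _ 1) => // x _; rewrite expr0 mulr1 normr1. Qed.

Let i2 : leb.-integrable D (EFin \o (fun x => x ^+ 2 * w x)).
Proof.
apply: (@ix 2 _ 1); first exact: measurable_funX.
by move=> x x0; rewrite normrX (gtr0_norm x0) mul1r.
Qed.

Let dcos (t x : R) : is_derive x 1 (fun x => sin (t * x)) (t * cos (t * x)).
Proof.
have d : is_derive x 1 (fun x => t * x) t by apply: is_derive_eq; rewrite /GRing.scale/= mulr1.
by have := is_derive1_comp (is_derive_sin _) d; rewrite /GRing.scale/= mulrC.
Qed.

Let G t := \int[leb]_(x in D) (cos (t * x) * w x).

Let G_parts t : t * G t = 2 * c * \int[leb]_(x in D) (x * sin (t * x) * w x).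
Proof.
have j1 : leb.-integrable D (EFin \o (fun x => t * (cos (t * x) * w x))).
  exact: (integrableZl mD _ (icos t)).
have j2 : leb.-integrable D (EFin \o (fun x => 2 * c * (x * sin (t * x) * w x))).
  exact: (integrableZl mD _ (ixsin t)).
have h : \int[leb]_(x in `]0, +oo[) (t * (cos (t * x) * w x) - 2 * c * (x * sin (t * x) * w x)) = 0 - 0.
  apply: (@integrable_FTC2_pos _ _ (fun x => sin (t * x) * w x)).
  - exact: (integrableB mD j1 j2).
  - move=> x x0; apply: continuousB.
      apply: continuousM; first exact: cst_continuous.
      apply: continuousM; last exact: cw.
      apply: (@continuous_comp _ _ _ (fun x => t * x) cos); last exact: continuous_cos.
      by apply: continuousM; [exact: cst_continuous|exact: cvg_id].
    apply: continuousM; first exact: cst_continuous.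
    apply: continuousM; last exact: cw.
    apply: continuousM; first exact: cvg_id.
    exact: is_derive_continuous (dcos t x).
  - move=> x x0; apply: (is_derive_eq (is_deriveM (dcos t x) (dw x))).
    by rewrite /GRing.scale/=; ring.
  - have h0 : sin (t * 0) * w 0 = 0 by rewrite mulr0 sin0 mul0r.
    rewrite -[X in _ --> X]h0; apply: cvg_at_right_filter; apply: continuousM; last exact: cw.
    exact: is_derive_continuous (dcos t 0).
  - by apply: (@cvg_zero _ 0) => x _; rewrite expr0.
rewrite RintegralB// !RintegralZl// subr0 in h.
by apply/eqP; rewrite -subr_eq0 h.
Qed.

Let dG (t : R) : is_derive t 1 G (- \int[leb]_(x in D) (x * sin (t * x) * w x)).
Proof.
pose f (u x : R) := cos (u * x) * w x.
have pd (u x : R) : is_derive u 1 (f ^~ x) (- (x * sin (u * x) * w x)).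
  have d : is_derive u 1 (fun u => u * x) x by apply: is_derive_eq; rewrite /GRing.scale/=; ring.
  have d1 := is_derive1_comp (is_derive_cos _) d.
  have d2 := is_deriveZ (w x) d1.
  rewrite (_ : f ^~ x = w x \*: (cos \o (fun u => u * x))); last first.
    by apply/funext => v; rewrite /f mulrC.
  by apply: (is_derive_eq d2); rewrite /GRing.scale/=; ring.
have It : (`](t - 1), (t + 1)[%classic : set R) t by rewrite /= in_itv/=; apply/andP; split; lra.
have intf y : (`](t - 1), (t + 1)[%classic : set R) y -> leb.-integrable D (EFin \o f y).
  by move=> _; exact: icos.
have derf y x : (`](t - 1), (t + 1)[%classic : set R) y -> D x -> derivable (f ^~ x) y 1.
  by move=> _ _; case: (pd y x).
have iN : leb.-integrable D (EFin \o (fun x => `|x| * w x)).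
  apply: (@ix 1 _ 1); first exact: normr_measurable.
  by move=> x x0; rewrite normr_id (gtr0_norm x0) mul1r.
have N0 x : 0 <= `|x| * w x by rewrite mulr_ge0.
have Gub y x : (`](t - 1), (t + 1)[%classic : set R) y -> D x -> `|partial1of2 f y x| <= `|x| * w x.
  move=> _ _; rewrite partial1of2E; have [_ ->] := pd y x.
  by rewrite normrN !normrM (ger0_norm (w0 x)) ler_wpM2r// ler_piMr.
split; first exact: (derivable_under_integral mD It intf derf N0 iN Gub).
rewrite -derive1E (differentiation_under_integral mD It intf derf N0 iN Gub).
rewrite -[RHS]mulN1r -RintegralZl//.
apply: eq_Rintegral => x _; rewrite partial1of2E; case: (pd t x) => _ ->.
by rewrite mulN1r.
Qed.

(** Differentiation under the integral and [G_parts] give [G' = - t G / (2 c)], so [G] times the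
    inverse Gaussian factor has zero derivative. *)
Let G_eq t : G t = G 0 * expR (- (t ^+ 2 / (4 * c))).
Proof.
pose H (u : R) := G u * expR (u ^+ 2 / (4 * c)).
have dH (u : R) : is_derive u 1 H 0.
  have d : is_derive u 1 (fun u => u ^+ 2 / (4 * c)) (u / (2 * c)).
    apply: is_derive_eq; rewrite /GRing.scale/=; field; exact: lt0r_neq0.
  have d1 := is_derive1_comp (is_derive_expR _) d.
  apply: (is_derive_eq (is_deriveM (dG u) d1)).
  have -> : \int[leb]_(x in D) (x * sin (u * x) * w x) = u * G u / (2 * c).
    by rewrite G_parts mulrC mulKf// mulf_neq0// lt0r_neq0.
  by rewrite /GRing.scale/=; ring.
have := is_derive_0_is_cst t 0 dH.
rewrite /H expr0n/= mul0r expR0 mulr1 expRN => <-.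
by rewrite mulfK// gt_eqF// expR_gt0.
Qed.

Let W := \int[leb]_(x in D) (1 * w x).

Let sq_parts : W = 2 * c * \int[leb]_(x in D) (x ^+ 2 * w x).
Proof.
have j2 : leb.-integrable D (EFin \o (fun x => 2 * c * (x ^+ 2 * w x))).
  exact: (integrableZl mD _ i2).
have h : \int[leb]_(x in `]0, +oo[) (1 * w x - 2 * c * (x ^+ 2 * w x)) = 0 - 0.
  apply: (@integrable_FTC2_pos _ _ (fun x => x * w x)).
  - exact: (integrableB mD i1 j2).
  - move=> x x0; apply: continuousB.
      by apply: continuousM; [exact: cst_continuous|exact: cw].
    apply: continuousM; first exact: cst_continuous.
    apply: continuousM; last exact: cw.
    exact: exprn_continuous.
  - move=> x x0; apply: (is_derive_eq (is_deriveM (is_derive_id x 1) (dw x))).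
    by rewrite /GRing.scale/=; ring.
  - rewrite -[X in _ --> X](mul0r (w 0)).
    apply: cvg_at_right_filter; apply: continuousM; last exact: cw.
    exact: cvg_id.
  - by apply: (@cvg_zero _ 1) => x x0; rewrite expr1 gtr0_norm.
have e : \int[leb]_(x in D) (2 * c * (x ^+ 2 * w x)) = 2 * c * \int[leb]_(x in D) (x ^+ 2 * w x).
  by rewrite RintegralZl.
rewrite subr0 RintegralB// e in h.
by apply/eqP; rewrite -subr_eq0 h.
Qed.

Let half (f : R -> R) : (forall x, 0 <= f x) -> continuous f -> f =1 f \o -%R ->
  leb.-integrable D (EFin \o (fun x => f x * w x)) ->
  (\int[leb]_x (f x * w x)%:E = (2 * \int[leb]_(x in D) (f x * w x))%:E)%E.
Proof.
move=> f0 cf fe fi.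
have fw0 x : 0 <= f x * w x by rewrite mulr_ge0.
have cfw : continuous (fun x => f x * w x).
  by move=> x; apply: continuousM; [exact: cf|exact: cw].
have few : (fun x => f x * w x) =1 (fun x => f x * w x) \o -%R.
  by move=> x /=; rewrite /w sqrrN; congr (_ * _); rewrite fe.
rewrite (ge0_symfun_integralT fw0 cfw few) -set_itvcy EFinM; congr (_ * _)%E.
rewrite /Rintegral fineK; last exact: integrable_fin_num.
apply/esym; apply: integral_itv_obnd_cbnd.
by apply/measurable_EFinP; apply: measurable_funTS; exact: continuous_measurable_fun cfw.
Qed.

(** The total mass [V] is left unevaluated: in [rho_facts] it cancels against [normal_peak], because
    a normal density has mass 1. *)
Lemma integral_Gaussian_weight : exists2 V, 0 <= V &
  [/\ (\int[leb]_x (w x)%:E = V%:E)%E,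
      (\int[leb]_x (x ^+ 2 * w x)%:E = (V / (2 * c))%:E)%E &
      (\int[leb]_x ((1 + cos x) * w x)%:E = (V * (1 + expR (- (4 * c)^-1)))%:E)%E].
Proof.
have W0 : 0 <= W by apply: Rintegral_ge0 => x _; rewrite mul1r.
exists (2 * W); first by rewrite mulr_ge0.
split.
- rewrite /W -(half (f := cst 1))//; first by apply: eq_integral => x _; rewrite /= mul1r.
  by move=> x; exact: cst_continuous.
- rewrite (half (f := fun x => x ^+ 2))//.
  + by congr EFin; rewrite sq_parts; field; exact: lt0r_neq0.
  + by move=> x; exact: sqr_ge0.
  + exact: exprn_continuous.
  + by move=> x /=; rewrite sqrrN.
- have j : leb.-integrable D (EFin \o (fun x => cos (1 * x) * w x)) by exact: icos.
  rewrite (half (f := fun x => 1 + cos x)).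
  + congr EFin; transitivity (2 * \int[leb]_(x in D) (1 * w x + cos (1 * x) * w x)).
      congr (_ * _); apply: eq_Rintegral => x _; by rewrite [1 * x]mul1r; ring.
    rewrite RintegralD// -/(G 1) G_eq expr1n div1r.
    have -> : G 0 = W by apply: eq_Rintegral => x _; rewrite mul0r cos0.
    by rewrite -/W; ring.
  + by move=> x; have := cos_geN1 x; lra.
  + move=> x; apply: continuousD; first exact: cst_continuous.
    exact: continuous_cos.
  + by move=> x /=; rewrite cosN.
  + have -> : (fun x => (1 + cos x) * w x) = (fun x => 1 * w x + cos (1 * x) * w x).
      by apply/funext => x; rewrite [1 * x]mul1r; ring.
    exact: (integrableD mD i1 j).
Qed.

End Gaussian_Fourier.

(** * Integrals against normal and Dirac laws *)

Section Gaussian_law.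
Context {R : realType} d (Omega : measurableType d) (P : probability Omega R).
Notation leb := (@lebesgue_measure R).

Lemma ge0_integral_opp (f : R -> \bar R) : measurable_fun setT f -> (forall x, 0 <= f x)%E ->
  (\int[leb]_x f x = \int[leb]_x f (- x)%R)%E.
Proof.
move=> mf f0.
have mopp : measurable_fun setT (-%R : measurableTypeR R -> measurableTypeR R) by exact: measurable_funN.
transitivity (\int[pushforward leb (-%R : measurableTypeR R -> measurableTypeR R)]_x f x)%E.
  by apply: eq_measure_integral => A mA _; exact/esym/lebesgue_measureN.
by rewrite (ge0_integral_pushforward mopp)// preimage_setT.
Qed.

Variables (Y : Omega -> R) (m s : R).
Hypothesis mY : measurable_fun setT Y.
Let rho (x : R) : R := normal_pdf 0 s x.

Let normal_shift (f : R -> \bar R) : (forall A, measurable A -> P (Y @^-1` A) = normal_prob m s A) ->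
  s != 0 -> (forall x, 0 <= f x)%E -> measurable_fun setT f ->
  (\int[P]_w f (Y w) = \int[leb]_x (f (m + x)%R * (rho x)%:E))%E.
Proof.
move=> hY s0 f0 mf.
have mid : measurable_fun setT (id : measurableTypeR R -> R) by exact: measurable_id.
transitivity (\int[image_measure P mY]_y f y)%E.
  by rewrite ge0_integral_pushforward// preimage_setT.
have e0 y : 0 <= normal_pdf m s y by exact: normal_pdf_ge0.
have me := measurable_normal_pdf m s.
have hnu A : measurable A -> image_measure P mY A =
    (\int[leb]_(y in A) (normal_pdf m s y)%:E)%E by move=> mA; exact: hY.
rewrite (ge0_integral_density mid me e0 hnu f0 mf).
have mfp : measurable_fun setT (fun x => f x * (normal_pdf m s x)%:E)%E.
  by apply: emeasurable_funM => //; exact/measurable_EFinP.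
have fp0 x : setT x -> (0 <= f x * (normal_pdf m s x)%:E)%E.
  by move=> _; rewrite mule_ge0// lee_fin.
apply: etrans (ge0_integral_translation m measurableT mfp fp0) _.
rewrite preimage_setT; apply: eq_integral => x _; congr (_ * _%:E)%E.
by rewrite /rho !normal_pdfE// /normal_fun addrAC subrr add0r subr0.
Qed.


Let rho0 x : 0 <= rho x. Proof. exact: normal_pdf_ge0. Qed.

Let mrho : measurable_fun setT rho. Proof. exact: measurable_normal_pdf. Qed.

Let rho_facts : s != 0 ->
  [/\ (\int[leb]_x (rho x)%:E = 1)%E,
      (\int[leb]_x (x ^+ 2 * rho x)%:E = (s ^+ 2)%:E)%E,
      (\int[leb]_x ((1 + cos x) * rho x)%:E = (1 + expR (- (s ^+ 2 / 2)))%:E)%E &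
      forall x, rho (- x) = rho x].
Proof.
move=> s0; have s20 : 0 < s ^+ 2 by rewrite exprn_even_gt0.
pose c := (2 * s ^+ 2)^-1; have c0 : 0 < c by rewrite invr_gt0 mulr_gt0.
pose pk : R := normal_peak s; have pk0 : 0 <= pk by exact: normal_peak_ge0.
have rhoE x : rho x = pk * expR (- (c * x ^+ 2)).
  rewrite /rho normal_pdfE// /normal_fun subr0; congr (_ * expR _).
  by rewrite /c -mulr_natl mulNr mulrC.
have [V V0 [h0 h2 hc]] := integral_Gaussian_weight c0.
have scale (f : R -> R) : (forall x, 0 <= f x) -> measurable_fun setT f ->
    (\int[leb]_x (f x * rho x)%:E = pk%:E * \int[leb]_x (f x * expR (- (c * x ^+ 2)))%:E)%E.
  move=> f0 mf; rewrite -ge0_integralZl_EFin//; last 2 first.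
  - by move=> x _; rewrite lee_fin mulr_ge0// expR_ge0.
  - apply/measurable_EFinP; apply: measurable_funM => //.
    apply: measurableT_comp => //; apply: measurableT_comp => //.
    by apply: measurable_funM => //; exact: measurable_funX.
  by apply: eq_integral => x _; rewrite rhoE -EFinM mulrCA.
have r1 : (\int[leb]_x (rho x)%:E = 1)%E by exact: integral_normal_pdf.
have pV : pk * V = 1.
  have := scale (cst 1) (fun _ => ler01) (measurable_cst _).
  rewrite (_ : (\int[leb]_x (cst 1 x * rho x)%:E)%E = 1%E); last first.
    by rewrite -r1; apply: eq_integral => x _; rewrite /= mul1r.
  rewrite (_ : (\int[leb]_x (cst 1 x * expR (- (c * x ^+ 2)))%:E)%E = V%:E); last first.
    by rewrite -h0; apply: eq_integral => x _; rewrite /= mul1r.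
  by rewrite -EFinM => -[].
split => //.
- rewrite scale; [|by move=> x; exact: sqr_ge0|exact: measurable_funX].
  rewrite h2 -EFinM mulrA pV /c; congr EFin; by field.
- rewrite scale; last first.
  + apply: measurable_funD => //; exact: continuous_measurable_fun (@continuous_cos R).
  + by move=> x; have := cos_geN1 x; lra.
  rewrite hc -EFinM mulrA pV mul1r /c; congr (1 + expR (- _))%:E; by field.
- by move=> x; rewrite !rhoE sqrrN.
Qed.

(** The odd part of [f] does not contribute, the centred density being even. Writing this as
    [f x + f (- x) = 2 * g x] between nonnegative functions avoids integrating the odd part, such as
    [x] or [sin x], separately. *)
Let symmetrize (f g : R -> R) : s != 0 -> (forall x, 0 <= f x) -> measurable_fun setT f ->
  (forall x, 0 <= g x) -> measurable_fun setT g ->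
  (forall x, f x + f (- x) = 2 * g x) ->
  (\int[leb]_x (f x * rho x)%:E = \int[leb]_x (g x * rho x)%:E)%E.
Proof.
move=> s0 f0 mf g0 mg fg; have [_ _ _ re] := rho_facts s0.
have mfr : measurable_fun setT (fun x => (f x * rho x)%:E).
  by apply/measurable_EFinP; exact: measurable_funM.
have fr0 x : (0 <= (f x * rho x)%:E)%E by rewrite lee_fin mulr_ge0.
have mfr' : measurable_fun setT (fun x : R => (f (- x) * rho (- x))%:E).
  apply/measurable_EFinP; apply: measurable_funM.
    by apply: measurableT_comp => //; exact: measurable_funN.
  by apply: measurableT_comp => //; exact: measurable_funN.
have h := ge0_integral_opp mfr fr0.
have : (\int[leb]_x (f x * rho x)%:E + \int[leb]_x (f x * rho x)%:E =
    2%:E * \int[leb]_x (g x * rho x)%:E)%E.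
  rewrite {2}h -ge0_integralD//.
  rewrite -ge0_integralZl_EFin//; last 2 first.
  - by move=> x _; rewrite lee_fin mulr_ge0.
  - exact/measurable_EFinP/measurable_funM.
  apply: eq_integral => x _; rewrite -EFinD -EFinM; congr EFin.
  by rewrite re mulrA -fg mulrDl.
have : (0 <= \int[leb]_x (f x * rho x)%:E)%E by apply: integral_ge0.
have : (0 <= \int[leb]_x (g x * rho x)%:E)%E.
  by apply: integral_ge0 => x _; rewrite lee_fin mulr_ge0.
move: (integral _ _ _) (integral _ _ _) => [a| |] [b| |]//= _ _.
- by rewrite -EFinD -EFinM => -[] ab; congr EFin; lra.
- by rewrite mulry gtr0_sg// mul1e.
Qed.

Lemma normal_law_Fourier : (forall A, measurable A -> P (Y @^-1` A) = normal_prob m s A) ->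
  s != 0 ->
  (forall a, (\int[P]_w ((Y w + a) ^+ 2)%:E = ((m + a) ^+ 2 + s ^+ 2)%:E)%E) /\
  (m = 0 -> (\int[P]_w (1 + cos (Y w))%:E = (1 + expR (- (s ^+ 2 / 2)))%:E)%E /\
    (\int[P]_w (1 + sin (Y w))%:E = 1)%E).
Proof.
move=> hY s0; have [r1 r2 rc _] := rho_facts s0.
split=> [a|m0].
  rewrite (normal_shift (f := fun y => ((y + a) ^+ 2)%:E) hY s0); last 2 first.
  - by move=> x; rewrite lee_fin sqr_ge0.
  - by apply/measurable_EFinP; apply: measurable_funX; exact: measurable_funD.
  pose f (x : R) := (m + x + a) ^+ 2; pose g (x : R) := (m + a) ^+ 2 + x ^+ 2.
  rewrite (_ : (\int[leb]_x _)%E = (\int[leb]_x (f x * rho x)%:E)%E)//.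
  rewrite (@symmetrize f g s0); first last.
  - by move=> x; rewrite /f /g; ring.
  - by apply: measurable_funD => //; exact: measurable_funX.
  - by move=> x; rewrite addr_ge0 ?sqr_ge0.
  - by apply: measurable_funX; apply: measurable_funD => //; exact: measurable_funD.
  - by move=> x; exact: sqr_ge0.
  rewrite EFinD -r2 -[X in (X + _)%E]mule1 -r1 -ge0_integralZl_EFin ?sqr_ge0//; last first.
  - exact/measurable_EFinP.
  - by move=> x _; rewrite lee_fin.
  rewrite -ge0_integralD//; last 4 first.
  - by move=> x _; rewrite -EFinM lee_fin mulr_ge0// sqr_ge0.
  - by apply: measurable_funeM; exact/measurable_EFinP.
  - by move=> x _; rewrite lee_fin mulr_ge0// sqr_ge0.
  - by apply/measurable_EFinP; apply: measurable_funM => //; exact: measurable_funX.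
  by apply: eq_integral => x _; rewrite -EFinM -EFinD -mulrDl.
have mc : measurable_fun setT (fun x : R => 1 + cos x).
  by apply: measurable_funD => //; exact: continuous_measurable_fun (@continuous_cos R).
have ms : measurable_fun setT (fun x : R => 1 + sin x).
  by apply: measurable_funD => //; exact: continuous_measurable_fun (@continuous_sin R).
have c0 (x : R) : 0 <= 1 + cos x by have := cos_geN1 x; lra.
have t0 (x : R) : 0 <= 1 + sin x by have := sin_geN1 x; lra.
split.
  rewrite (normal_shift (f := fun y => (1 + cos y)%:E) hY s0)//; last exact/measurable_EFinP.
  by rewrite -rc; apply: eq_integral => x _; rewrite m0 add0r.
rewrite (normal_shift (f := fun y => (1 + sin y)%:E) hY s0)//; last exact/measurable_EFinP.
transitivity (\int[leb]_x ((1 + sin x) * rho x)%:E)%E.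
  by apply: eq_integral => x _; rewrite m0 add0r.
rewrite (@symmetrize _ (cst 1) s0)//.
- by rewrite -[RHS]r1; apply: eq_integral => x _; rewrite /= mul1r.
- by move=> x; rewrite sinN /=; ring.
Qed.

Lemma Dirac_law_integral (f : R -> \bar R) : (forall A, measurable A -> P (Y @^-1` A) = \d_m A) ->
  (forall x, 0 <= f x)%E -> measurable_fun setT f -> (\int[P]_w f (Y w) = f m)%E.
Proof.
move=> hY f0 mf.
transitivity (\int[image_measure P mY]_y f y)%E.
  by rewrite ge0_integral_pushforward// preimage_setT.
transitivity (\int[\d_m]_y f y)%E.
  by apply: eq_measure_integral => A mA _; exact: hY.
by rewrite integral_dirac// diracT mul1e.
Qed.

End Gaussian_law.

Section Gaussian_characteristic.
Context {R : realType} d (Omega : measurableType d) (P : probability Omega R).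
Variables (Y : Omega -> R) (v : R).
Hypotheses (mY : measurable_fun setT Y) (gY : Gaussian_law P Y).
Hypotheses (EY : (\int[P]_w (Y w)%:E = 0)%E) (EY2 : (\int[P]_w (Y w ^+ 2)%:E = v%:E)%E).

Let Pcst (a : R) : (\int[P]_w a%:E = a%:E)%E.
Proof.
transitivity (a%:E * P setT)%E; last by rewrite probability_setT mule1.
exact: integral_cst.
Qed.

(* The moments of order 2 about 0 and about -1 determine the parameters of the
   law through integrals of nonnegative functions only. *)
Let shifted : (\int[P]_w ((Y w + 1) ^+ 2)%:E = (v + 1)%:E)%E.
Proof.
have i2 : P.-integrable [set: Omega] (EFin \o (fun w => Y w ^+ 2)).
  apply/integrableP; split; first by apply/measurable_EFinP; exact: measurable_funX.
  rewrite (_ : (\int[P]_x _)%E = (\int[P]_w (Y w ^+ 2)%:E)%E); first by rewrite EY2 ltry.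
  by apply: eq_integral => w _; rewrite /= ger0_norm// sqr_ge0.
have i0 : P.-integrable [set: Omega] (EFin \o (fun=> 1 : R)).
  exact: finite_measure_integrable_cst.
have i1 : P.-integrable [set: Omega] (EFin \o Y).
  apply: (le_integrable measurableT _ _ (integrableD measurableT i0 i2)).
    exact/measurable_EFinP.
  move=> w _; rewrite /= lee_fin; apply: le_trans (ler_norm _).
  have : 0 <= (`|Y w| - 1) ^+ 2 + `|Y w| ^+ 2 + 1 by rewrite !addr_ge0 ?sqr_ge0.
  by rewrite -(real_normK (num_real (Y w))); lra.
have i3 : P.-integrable [set: Omega] (EFin \o (fun w => 2 * Y w)).
  exact: (integrableZl measurableT 2 i1).
transitivity (\int[P]_w ((Y w ^+ 2)%:E + ((2 * Y w)%:E + 1)))%E.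
  by apply: eq_integral => w _; rewrite -!EFinD; congr EFin; ring.
rewrite (integralD measurableT i2 (integrableD measurableT i3 i0)).
rewrite (integralD measurableT i3 i0) EY2.
rewrite (_ : (\int[P]_x (EFin \o (fun w => (2 * Y w)%R)) x)%E = 0%E); last first.
  transitivity (\int[P]_w (2%:E * (Y w)%:E))%E; first by [].
  by rewrite integralZl// EY mule0.
by rewrite add0e (_ : (\int[P]_x (EFin \o (fun=> 1%R)) x)%E = 1%E); [rewrite -EFinD|exact: Pcst].
Qed.

Lemma Gaussian_law_Fourier :
  (\int[P]_w (1 + cos (Y w))%:E = (1 + expR (- (v / 2)))%:E)%E /\
  (\int[P]_w (1 + sin (Y w))%:E = 1)%E.
Proof.
have [m [s [s0 hY]]] := gY.
have mc : measurable_fun setT (fun x : R => (1 + cos x)%:E).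
  by apply/measurable_EFinP; apply: measurable_funD => //; exact: continuous_measurable_fun (@continuous_cos R).
have ms : measurable_fun setT (fun x : R => (1 + sin x)%:E).
  by apply/measurable_EFinP; apply: measurable_funD => //; exact: continuous_measurable_fun (@continuous_sin R).
have c0 (x : R) : (0 <= (1 + cos x)%:E)%E by rewrite lee_fin; have := cos_geN1 x; lra.
have t0 (x : R) : (0 <= (1 + sin x)%:E)%E by rewrite lee_fin; have := sin_geN1 x; lra.
(* Degenerate or not, the difference of the two second moments is [2 m + 1] on one side and 1 on the
   other, which forces [m = 0]. *)
have [s1|s1] := eqVneq s 0.
  have hY' A : measurable A -> P (Y @^-1` A) = \d_m A.
    by move=> mA; rewrite hY// s1 eqxx.
  have e0 := @Dirac_law_integral _ _ _ P Y m mY (fun x => (x ^+ 2)%:E) hY'.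
  have e1 := @Dirac_law_integral _ _ _ P Y m mY (fun x => ((x + 1) ^+ 2)%:E) hY'.
  rewrite EY2 in e0; rewrite shifted in e1.
  have [] : v%:E = (m ^+ 2)%:E.
    apply: e0; first by move=> x; rewrite lee_fin sqr_ge0.
    by apply/measurable_EFinP; exact: measurable_funX.
  move=> hv; have [] : (v + 1)%:E = ((m + 1) ^+ 2)%:E.
    apply: e1; first by move=> x; rewrite lee_fin sqr_ge0.
    by apply/measurable_EFinP; apply: measurable_funX; exact: measurable_funD.
  rewrite hv sqrrD expr1n mulr1 => hm.
  have m0 : m = 0 by move: hm; lra.
  rewrite (@Dirac_law_integral _ _ _ P Y m mY (fun x => (1 + cos x)%:E))//.
  rewrite (@Dirac_law_integral _ _ _ P Y m mY (fun x => (1 + sin x)%:E))//.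
  by rewrite m0 cos0 sin0 expr0n/= mul0r oppr0 expR0 addr0.
have hY' A : measurable A -> P (Y @^-1` A) = normal_prob m s A.
  by move=> mA; rewrite hY// (negbTE s1).
have [h1 h2] := normal_law_Fourier mY hY' s1.
have := h1 1; rewrite shifted => -[] e1.
have := h1 0; under eq_integral do rewrite addr0; rewrite EY2 => -[] e0.
have m0 : m = 0.
  by move: e0 e1; rewrite addr0 sqrrD expr1n mulr1; lra.
have [-> ->] := h2 m0; split => //.
by rewrite e0 m0 addr0 expr0n add0r.
Qed.

End Gaussian_characteristic.

(** * Convergence in law from trigonometric tests *)

Section Bernstein_walk.
Context {R : realType} (n : nat).
Implicit Types (u : 'I_n -> R) (s : seq 'I_n) (G : ('I_n -> nat) -> R) (k : 'I_n -> nat).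

Definition increment (i : 'I_n) k : 'I_n -> nat := fun j => (k j + (j == i))%N.

(* Expectation of [G] at the endpoint of a walk from [k] whose successive steps
   increment the coordinates [i] listed in [s], independently with probability
   [u i]; for [n = 1] this is a Bernstein polynomial. *)
Fixpoint walk_mean u s G k : R :=
  if s is i :: s' then
    u i * walk_mean u s' G (increment i k) + (1 - u i) * walk_mean u s' G k
  else G k.

Variable u : 'I_n -> R.
Hypothesis u01 : forall i, 0 <= u i <= 1.

Lemma walk_mean_cst s c k : walk_mean u s (fun=> c) k = c.
Proof. by elim: s k => //= i s IH k; rewrite !IH; ring. Qed.

Lemma walk_meanD s G H k :
  walk_mean u s (fun k => G k + H k) k = walk_mean u s G k + walk_mean u s H k.
Proof. by elim: s k => //= i s IH k; rewrite !IH; ring. Qed.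

Lemma walk_meanZ s c G k : walk_mean u s (fun k => c * G k) k = c * walk_mean u s G k.
Proof. by elim: s k => //= i s IH k; rewrite !IH; ring. Qed.

Lemma walk_mean_sum s (G : 'I_n -> ('I_n -> nat) -> R) k :
  walk_mean u s (fun k => \sum_(i < n) G i k) k = \sum_(i < n) walk_mean u s (G i) k.
Proof.
elim: s k => //= i s IH k; rewrite !IH !mulr_sumr -big_split.
by apply: eq_bigr.
Qed.

Lemma le_walk_mean s G H k : (forall k, G k <= H k) -> walk_mean u s G k <= walk_mean u s H k.
Proof.
move=> GH; elim: s k => //= i s IH k; have /andP[h0 h1] := u01 i.
by apply: lerD; apply: ler_wpM2l; rewrite ?subr_ge0// IH.
Qed.

(** Squared bias plus a binomial variance with as many trials as [i] has occurrences in [s]; it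
    supplies the Chebyshev estimate of [trigonometric_approximation]. *)
Lemma walk_mean_second s k i b :
  walk_mean u s (fun k' => ((k' i)%:R - b) ^+ 2) k =
  ((k i)%:R + (count_mem i s)%:R * u i - b) ^+ 2 + (count_mem i s)%:R * (u i * (1 - u i)).
Proof.
elim: s k => [|j s IH] k /=; first by rewrite !mul0r !addr0.
rewrite !IH /increment eq_sym; have [->|_] /= := eqVneq j i.
  by rewrite !natrD; ring.
by rewrite addn0 add0n; ring.
Qed.

End Bernstein_walk.

Section trigonometric.
Context {R : realType} (n : nat).

(** The phase [phi] includes sines, so convergence of cosines alone carries over to the whole class
    by linearity. *)
Inductive trigonometric : ('rV[R]_n -> R) -> Prop :=
| trigonometric_cos (a : 'I_n -> R) (phi : R) :
    trigonometric (fun v => cos (\sum_(i < n) a i * v ord0 i + phi))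
| trigonometric_lin (c : R) f g : trigonometric f -> trigonometric g ->
    trigonometric (fun v => c * f v + g v).

Lemma trigonometric_cst (c : R) : trigonometric (fun=> c).
Proof.
have h1 : trigonometric (fun=> 1).
  rewrite (_ : (fun=> 1) = fun v : 'rV[R]_n => cos (\sum_(i < n) (fun=> 0) i * v ord0 i + 0)).
    exact: trigonometric_cos.
  by apply/funext => v; rewrite big1 ?addr0 ?cos0// => i _; rewrite mul0r.
rewrite (_ : (fun=> c) = fun v : 'rV[R]_n => (c - 1) * (fun=> 1) v + (fun=> 1) v).
  exact: trigonometric_lin.
by apply/funext => v; ring.
Qed.

Lemma trigonometricZ (c : R) f : trigonometric f -> trigonometric (fun v => c * f v).
Proof.
move=> hf; rewrite (_ : (fun v => c * f v) = fun v => c * f v + (fun=> 0) v).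
  by apply: trigonometric_lin => //; exact: trigonometric_cst.
by apply/funext => v; rewrite addr0.
Qed.

Lemma trigonometricD f g : trigonometric f -> trigonometric g ->
  trigonometric (fun v => f v + g v).
Proof.
move=> hf hg; rewrite (_ : (fun v => f v + g v) = fun v => 1 * f v + g v).
  exact: trigonometric_lin.
by apply/funext => v; rewrite mul1r.
Qed.

(** Product-to-sum formula, with the sines rewritten as cosines shifted by a quarter period. *)
Lemma trigonometric_sinM (b : R) (i : 'I_n) f : trigonometric f ->
  trigonometric (fun v => sin (b * v ord0 i) * f v).
Proof.
elim=> [a phi|c g h _ hg _ hh].
- pose a1 j := a j + b * (j == i)%:R; pose a2 j := a j - b * (j == i)%:R.
  have sumE (v : 'rV[R]_n) e : \sum_(j < n) (a j + e * (j == i)%:R) * v ord0 j =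
      \sum_(j < n) a j * v ord0 j + e * v ord0 i.
    under eq_bigr do rewrite mulrDl.
    rewrite big_split/=; congr (_ + _); rewrite (bigD1 i)//= eqxx mulr1 big1 ?addr0//.
    by move=> j /negbTE ->; rewrite mulr0 mul0r.
  rewrite (_ : (fun v => _) = fun v : 'rV[R]_n =>
    2^-1 * cos (\sum_(j < n) (a j + b * (j == i)%:R) * v ord0 j + (phi - pi / 2)) +
    2^-1 * cos (\sum_(j < n) (a j + - b * (j == i)%:R) * v ord0 j + (phi + pi / 2))).
    by apply: trigonometricD; apply: trigonometricZ; exact: trigonometric_cos.
  apply/funext => v; rewrite !sumE !addrA cosBpihalf cosDpihalf mulNr.
  move: (\sum_(j < n) _) (b * v ord0 i) => x y.
  have -> : x + y + phi = (x + phi) + y by ring.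
  have -> : x - y + phi = (x + phi) - y by ring.
  by rewrite sinD sinB; field.
- rewrite (_ : (fun v => _) = fun v : 'rV[R]_n =>
    c * (sin (b * v ord0 i) * g v) + sin (b * v ord0 i) * h v).
    exact: trigonometric_lin.
  by apply/funext => v; ring.
Qed.

Lemma trigonometric_walk_mean (b : R) (s : seq 'I_n) G k :
  trigonometric (fun v => walk_mean (fun i => (1 + sin (b * v ord0 i)) / 2) s G k).
Proof.
elim: s k => [|i s IH] k /=; first exact: trigonometric_cst.
rewrite (_ : (fun v => _) = fun v : 'rV[R]_n =>
  (2^-1 * walk_mean (fun i => (1 + sin (b * v ord0 i)) / 2) s G (increment i k) +
   2^-1 * (sin (b * v ord0 i) * walk_mean (fun i => (1 + sin (b * v ord0 i)) / 2) s G (increment i k))) +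
  (2^-1 * walk_mean (fun i => (1 + sin (b * v ord0 i)) / 2) s G k +
   - 2^-1 * (sin (b * v ord0 i) * walk_mean (fun i => (1 + sin (b * v ord0 i)) / 2) s G k))).
  apply: trigonometricD; apply: trigonometricD; apply: trigonometricZ => //;
    exact: trigonometric_sinM.
by apply/funext => v; field.
Qed.

End trigonometric.

(** * Approximation of bounded continuous functions *)

Section approximation.
Context {R : realType}.

(** With half-difference [t] and midpoint [a], the claim reads [2 (sin t)^2 <= 2 cos a sin t]; and
    [sin t <= cos a] because [|a| <= pi / 2 - t]. It makes the injectivity of the sine on this
    interval quantitative. *)
Lemma sin_gap (x y : R) : - (pi / 2) <= x -> x <= y -> y <= pi / 2 ->
  1 - cos (y - x) <= sin y - sin x.
Proof.
move=> hx xy hy; have p2 := @pi_ge2 R.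
pose t := (y - x) / 2; pose a := (y + x) / 2.
have yE : y = a + t by rewrite /a /t; field.
have xE : x = a - t by rewrite /a /t; field.
have t0 : 0 <= t by rewrite divr_ge0// subr_ge0.
have t1 : t <= pi / 2 by rewrite /t; lra.
have st : 0 <= sin t by apply: sin_ge0_pi; lra.
have ca : sin t <= cos a.
  wlog a0 : / 0 <= a => [h|].
    have [/h//|a0] := leP 0 a.
    rewrite -cosN -cosBpihalf -(cosN (t - _)) opprB.
    have le_cos (u v : R) : 0 <= u -> u <= v -> v <= pi -> cos v <= cos u.
      move=> u0; rewrite le_eqVlt => /predU1P[->//|uv] vp.
      by rewrite ltW// ltr_cos// in_itv/=; lra.
    by apply: le_cos; move: hx; rewrite xE; lra.
  rewrite -cosBpihalf -(cosN (t - _)) opprB.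
  have le_cos (u v : R) : 0 <= u -> u <= v -> v <= pi -> cos v <= cos u.
    move=> u0; rewrite le_eqVlt => /predU1P[->//|uv] vp.
    by rewrite ltW// ltr_cos// in_itv/=; lra.
  by apply: le_cos => //; move: hy; rewrite yE; lra.
have -> : y - x = t + t by rewrite yE xE; ring.
rewrite yE xE sinD sinB cosD.
have := cos2Dsin2 t; have := ler_wpM2l st ca.
rewrite -!expr2; lra.
Qed.

Variables (n : nat) (f : 'rV[R]_n -> R) (M : R).
Hypotheses (cf : continuous f) (fM : forall v, `|f v| <= M).

(** Only [v] is confined to the box: [y] may leave it, as the nodes of the approximation can. *)
Lemma uniformly_continuous_box L e : 0 < e -> exists2 dl, 0 < dl &
  forall v y : 'rV[R]_n, (forall i, `|v ord0 i| <= L) ->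
    (forall i, `|v ord0 i - y ord0 i| < dl) -> `|f v - f y| <= e.
Proof.
move=> e0.
have cK : compact [set v : 'rV[R]_n | forall i, v ord0 i \in `[(- L), L]].
  by apply: (@rV_compact _ _ (fun=> `[(- L), L]%classic)) => _; exact: segment_compact.
have := (compact_near_coveringP _).1 cK R 0^'+ (fun dl v => forall y : 'rV[R]_n,
  (forall i, `|v ord0 i - y ord0 i| < dl) -> `|f v - f y| <= e) _.
case.
- move=> v Kv.
  have := @cf v; move=> /cvgrPdist_lt /(_ (e / 2)).
  rewrite divr_gt0// => /(_ isT) /nbhs_ballP[r /= r0 hr].
  have r2 : 0 < r / 2 by rewrite divr_gt0.
  exists (ball v (r / 2), [set dl | dl < r / 2]); first split => /=.
  + exact: nbhsx_ballx.
  + exact: nbhs_right_lt.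
  move=> [v' dl] /= [[_ vv'] dlr] y hy.
  have b1 : ball v r v'.
    by split => // i j; apply: le_ball (vv' i j); lra.
  have b2 : ball v r y.
    split => // i j; rewrite (ord1 i); have := vv' ord0 j; have := hy j.
    rewrite /ball/= => h1 h2; rewrite (_ : v ord0 j - y ord0 j = (v ord0 j - v' ord0 j) + (v' ord0 j - y ord0 j)); last ring.
    by apply: (le_lt_trans (ler_normD _ _)); lra.
  have h1 := hr _ b1; have h2 := hr _ b2; rewrite /= in h1 h2.
  rewrite (_ : f v' - f y = - (f v - f v') + (f v - f y)); last ring.
  apply: (le_trans (ler_normD _ _)); rewrite normrN; lra.
move=> dl /= dl0 h; exists (dl / 2); first by rewrite divr_gt0.
move=> v y Lv hy; have d2 : 0 < dl / 2 by rewrite divr_gt0.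
apply: (h (dl / 2)) => //.
- by rewrite /ball/= sub0r normrN gtr0_norm//; lra.
- by move=> i; rewrite in_itv/= -ler_norml.
Qed.

(** Inverts [x = (1 + sin th) / 2] up to [asin]. The upper cut is there because [node] is defined
    for every [k], even for counts above the number of trials. *)
Let clamp (x : R) := Num.min 1 (2 * x - 1).

Let clampP (x : R) : 0 <= x -> - 1 <= clamp x <= 1.
Proof. by move=> x0; rewrite /clamp le_min ge_min lexx/= andbT; lra. Qed.

(** In the box the angles [v_i / L] are at most 1, below [pi / 2], so [f] is a continuous function
    of the probabilities [(1 + sin (v_i / L)) / 2] and has Bernstein polynomials in them. Outside,
    some [(v_i / L)^2] exceeds 1 and the term with [2 * M] covers the trivial bound. *)
Lemma trigonometric_approximation L e : 0 < L -> 0 < e -> exists2 Q, trigonometric Q &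
  forall v : 'rV[R]_n, `|f v - Q v| <= e + 2 * M * \sum_(i < n) (v ord0 i / L) ^+ 2.
Proof.
move=> L0 e0; have e20 : 0 < e / 2 by rewrite divr_gt0.
have M0 : 0 <= M by apply: le_trans (fM 0).
have [dl dl0 hdl] := uniformly_continuous_box L e20.
(* Angles are coordinates divided by [L]; the minimum with 1 keeps [d] below [pi], where the cosine
   is decreasing. *)
pose d := Num.min (dl / L) 1; have d0 : 0 < d by rewrite lt_min ltr01 divr_gt0.
have p2 := @pi_ge2 R.
pose eta := 1 - cos d.
have eta0 : 0 < eta.
  rewrite subr_gt0 -[X in _ < X](@cos0 R) ltr_cos// in_itv/=.
    by rewrite lexx/=; lra.
  by rewrite (ltW d0)/= /d ge_min; apply/orP; right; lra.
(* So large that the [n] Chebyshev terms, of size [8 M / (eta^2 N.+1)] each, add up to at most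
   [e / 2]. *)
have [N hN] : exists N : nat, 16 * M * n%:R / (eta ^+ 2 * e) < N.+1%:R.
  by exists (Num.truncn (16 * M * n%:R / (eta ^+ 2 * e))); exact: truncnS_gt.
pose s := flatten (nseq N.+1 (enum 'I_n)).
have cs i : count_mem i s = N.+1.
  rewrite /s count_flatten map_nseq sumn_nseq.
  by rewrite (count_uniq_mem _ (enum_uniq _)) mem_enum mul1n.
have N0 : 0 < N.+1%:R :> R by [].
(* The walk makes [N.+1] trials of probability [u v i] for each coordinate, so
   that [node] concentrates near [v] when [v] lies in the box. *)
pose node (k : 'I_n -> nat) : 'rV[R]_n := \row_i (L * asin (clamp ((k i)%:R / N.+1%:R))).
pose u (v : 'rV[R]_n) i := (1 + sin (L^-1 * v ord0 i)) / 2.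
pose Q v := walk_mean (u v) s (fun k => f (node k)) (fun=> 0%N).
exists Q; first exact: trigonometric_walk_mean.
move=> v.
have u01 i : 0 <= u v i <= 1.
  have := sin_le1 (L^-1 * v ord0 i); have := sin_geN1 (L^-1 * v ord0 i); rewrite /u; lra.
have S0 : 0 <= \sum_(i < n) (v ord0 i / L) ^+ 2 by apply: sumr_ge0 => i _; exact: sqr_ge0.
have QM : `|Q v| <= M.
  rewrite ler_norml; apply/andP; split.
    rewrite -(walk_mean_cst (u v) s (- M) (fun=> 0%N)); apply: le_walk_mean => // k.
    by have := fM (node k); rewrite ler_norml => /andP[].
  rewrite -[leRHS](walk_mean_cst (u v) s M (fun=> 0%N)); apply: le_walk_mean => // k.
  by have := fM (node k); rewrite ler_norml => /andP[].
have [/forallP Lv|] := boolP [forall i, `|v ord0 i| <= L]; last first.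
  rewrite negb_forall => /existsP[i]; rewrite -ltNge => hi.
  have h1 : 1 <= \sum_(i < n) (v ord0 i / L) ^+ 2.
    rewrite (bigD1 i)//= -[leLHS]addr0; apply: lerD; last by apply: sumr_ge0 => j _; exact: sqr_ge0.
    rewrite -(real_normK (num_real _)) normrM normfV (gtr0_norm L0) exprn_ege1//.
    by rewrite ler_pdivlMr// mul1r ltW.
  apply: (le_trans (ler_normB _ _)); have := fM v.
  have : M <= M * \sum_(i < n) (v ord0 i / L) ^+ 2 by rewrite ler_peMr.
  lra.
(* Either the node is within [dl] of [v], at cost [e / 2], or some frequency misses its probability
   by [eta / 2]; its square term is then at least [2 * M], which bounds any difference of values of
   [f]. *)
pose g (k : 'I_n -> nat) := e / 2 + \sum_(i < n) (2 * M / (eta / 2) ^+ 2 / N.+1%:R ^+ 2) * ((k i)%:R - N.+1%:R * u v i) ^+ 2.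
have fg k : `|f v - f (node k)| <= g k.
  have C0 : 0 <= 2 * M / (eta / 2) ^+ 2 / N.+1%:R ^+ 2.
    by rewrite !divr_ge0 ?mulr_ge0 ?exprn_ge0// ltW// divr_gt0.
  have T0 i : 0 <= (2 * M / (eta / 2) ^+ 2 / N.+1%:R ^+ 2) * ((k i)%:R - N.+1%:R * u v i) ^+ 2.
    by rewrite mulr_ge0// sqr_ge0.
  have [/forallP near|] := boolP [forall i, `|v ord0 i - node k ord0 i| < dl].
    apply: (@le_trans _ _ (e / 2)); first exact: hdl.
    by rewrite lerDl sumr_ge0.
  rewrite negb_forall => /existsP[i]; rewrite -leNgt => far.
  apply: (@le_trans _ _ (2 * M)).
    by apply: (le_trans (ler_normB _ _)); have := fM v; have := fM (node k); lra.
  have gap : eta / 2 <= `|(k i)%:R / N.+1%:R - u v i|.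
    pose r : R := (k i)%:R / N.+1%:R; have r0 : 0 <= r by rewrite divr_ge0.
    pose th := L^-1 * v ord0 i; pose x := asin (clamp r).
    have th1 : -1 <= th <= 1.
      rewrite -ler_norml normrM normfV (gtr0_norm L0) mulrC ler_pdivrMr// mul1r.
      exact: Lv.
    have hx1 := asin_geNpi2 (clampP r0); have hx2 := asin_lepi2 (clampP r0).
    have xs : sin x = clamp r by apply: asinK; rewrite in_itv/=; exact: clampP.
    have dth : d <= `|th - x|.
      have -> : th - x = L^-1 * (v ord0 i - node k ord0 i).
        by rewrite /node mxE -/r -/x /th; field; exact: lt0r_neq0.
      rewrite normrM normfV (gtr0_norm L0) /d ge_min; apply/orP; left.
      by rewrite [leRHS]mulrC ler_wpM2r// invr_ge0 ltW.
    have p22 : `|th - x| <= pi by rewrite ler_norml; move: hx1 hx2; rewrite -/x; lra.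
    have cosle : cos `|th - x| <= cos d.
      move: dth; rewrite le_eqVlt => /predU1P[->//|dlt].
      by rewrite ltW// ltr_cos// in_itv/=; lra.
    have sgap : eta <= `|sin th - sin x|.
      have [tx|xt] := leP th x.
        have e1 : `|th - x| = x - th by rewrite distrC ger0_norm// subr_ge0.
        rewrite e1 in cosle; have := @sin_gap th x => /(_ _ tx hx2) h; rewrite distrC; apply: le_trans (ler_norm _).
        apply: (le_trans _ (h _)); last lra.
        by rewrite /eta; lra.
      have := @sin_gap x th hx1 (ltW xt).
      have e1 : `|th - x| = th - x by rewrite ger0_norm// subr_ge0 ltW.
      rewrite e1 in cosle; move=> h; apply: le_trans (ler_norm _); apply: (le_trans _ (h _)); last lra.
      by rewrite /eta; lra.
    have : `|sin th - sin x| <= 2 * `|r - u v i|.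
      have := sin_le1 th; rewrite xs /clamp /u -/th => st1.
      have rE : 2 * `|r - (1 + sin th) / 2| = `|(2 * r - 1) - sin th|.
        transitivity (`|2| * `|r - (1 + sin th) / 2|); first by rewrite (ger0_norm (ler0n R 2)).
        by rewrite -normrM; congr `|_|; field.
      rewrite rE distrC; have [h|h] := leP 1 (2 * r - 1).
        by rewrite ler_norml; have := ler_norm (2 * r - 1 - sin th); lra.
      by [].
    by rewrite -/r; lra.
  apply: (@le_trans _ _ ((2 * M / (eta / 2) ^+ 2 / N.+1%:R ^+ 2) * ((k i)%:R - N.+1%:R * u v i) ^+ 2)).
    have -> : (2 * M / (eta / 2) ^+ 2 / N.+1%:R ^+ 2) * ((k i)%:R - N.+1%:R * u v i) ^+ 2 =
       2 * M * ((`|(k i)%:R / N.+1%:R - u v i| / (eta / 2)) ^+ 2).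
      rewrite [in RHS]expr_div_n (real_normK (num_real _)).
      move: (lt0r_neq0 N0) (lt0r_neq0 eta0); move: (N.+1%:R : R) => x hx he; by field; rewrite hx he.
    rewrite ler_peMr ?mulr_ge0// exprn_ege1// ler_pdivlMr ?mul1r//.
    by rewrite divr_gt0.
  rewrite /g (bigD1 i)//= addrCA lerDl addr_ge0 ?(ltW e20)//.
  by apply: sumr_ge0 => j _; exact: T0.
have main : `|f v - Q v| <= walk_mean (u v) s g (fun=> 0%N).
  rewrite ler_norml; apply/andP; split.
    rewrite lerNl opprB lerBlDl -[X in X + _](walk_mean_cst (u v) s (f v) (fun=> 0%N)) -walk_meanD.
    by apply: le_walk_mean => // k; have := fg k; rewrite ler_norml; lra.
  rewrite lerBlDr -[leLHS](walk_mean_cst (u v) s (f v) (fun=> 0%N)) -walk_meanD.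
  by apply: le_walk_mean => // k; have := fg k; rewrite ler_norml; lra.
apply: (le_trans main); rewrite /g walk_meanD walk_mean_cst walk_mean_sum.
apply: (@le_trans _ _ (e / 2 + \sum_(i < n) (2 * M / (eta / 2) ^+ 2 / N.+1%:R))).
  rewrite lerD2l; apply: ler_sum => i _.
  rewrite walk_meanZ walk_mean_second cs mulr0n add0r subrr expr0n add0r.
  have C0 : 0 <= 2 * M / (eta / 2) ^+ 2 / N.+1%:R.
    by rewrite !divr_ge0 ?mulr_ge0 ?exprn_ge0// ltW// divr_gt0.
  have -> : 2 * M / (eta / 2) ^+ 2 / N.+1%:R ^+ 2 * (N.+1%:R * (u v i * (1 - u v i))) =
     2 * M / (eta / 2) ^+ 2 / N.+1%:R * (u v i * (1 - u v i)).
    move: (lt0r_neq0 N0) (lt0r_neq0 eta0); move: (N.+1%:R : R) => x hx he; by field; rewrite hx he.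
  apply: ler_piMr => //; have /andP[h0 h1] := u01 i.
  by rewrite mulr_ile1// ?subr_ge0// gerBl.
rewrite sumr_const card_ord -[X in _ + X <= _]mulr_natr.
have : 2 * M / (eta / 2) ^+ 2 / N.+1%:R * n%:R <= e / 2.
  rewrite mulrAC ler_pdivrMr//; move: (ltW hN).
  rewrite ler_pdivrMr ?mulr_gt0 ?exprn_gt0// => h.
  have -> : 2 * M / (eta / 2) ^+ 2 * n%:R = 8 * M * n%:R / eta ^+ 2.
    by field; exact: lt0r_neq0.
  rewrite ler_pdivrMr ?exprn_gt0//.
  lra.
have : 0 <= 2 * M * \sum_(i < n) (v ord0 i / L) ^+ 2 by rewrite mulr_ge0// mulr_ge0.
move: (2 * M / _ / _ * _) (2 * M * _) => x y; lra.
Qed.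

End approximation.

Section integral_off_null.
Context d (T : measurableType d) (R : realType) (mu : {measure set T -> \bar R}).
Variable N : set T.
Hypotheses (mN : measurable N) (N0 : mu N = 0%E).
Local Open Scope ereal_scope.

Import HBNNSimple.

(** A simple function below [f], set to 0 on [N], keeps its integral and lies below [g]. *)
Let ge0_le_off_null (f g : T -> \bar R) : (forall x, 0 <= f x) -> (forall x, 0 <= g x) ->
  (forall x, ~ N x -> f x = g x) -> \int[mu]_x f x <= \int[mu]_x g x.
Proof.
move=> f0 g0 fg; rewrite [leLHS]ge0_integralTE// [leRHS]ge0_integralTE//.
apply: ub_ereal_sup => _ [h /= hf <-].
have mNC : measurable (~` N) by exact: measurableC.
pose h' : {nnsfun T >-> R} := proj_nnsfun h mNC.
have -> : sintegral mu h = sintegral mu h'.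
  rewrite -!integralT_nnsfun; apply: ge0_ae_eq_integral => //.
  - exact/measurable_EFinP.
  - exact/measurable_EFinP.
  - by move=> x _; rewrite lee_fin.
  - by move=> x _; rewrite lee_fin.
  exists N; split => //; move=> x /= hx; apply: contrapT => Nx; apply: hx => _.
  by rewrite /= mindicE mem_set// mulr1.
apply: ereal_sup_ubound; exists h' => //= x; rewrite mindicE.
have [/set_mem Nx|_] := boolP (x \in ~` N); last by rewrite mulr0.
by rewrite mulr1 -fg//; exact: hf.
Qed.

(* No measurability is required of [f] and [g]: the library integral of a
   nonnegative function is a supremum over the simple functions below it. *)
Lemma eq_integral_off_null (f g : T -> \bar R) :
  (forall x, ~ N x -> f x = g x) -> \int[mu]_x f x = \int[mu]_x g x.
Proof.
move=> fg; rewrite integralE [RHS]integralE; congr (_ - _); apply/eqP; rewrite eq_le;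
  apply/andP; split; apply: ge0_le_off_null => // x Nx; by rewrite !(funeposE, funenegE) fg.
Qed.

End integral_off_null.

Section measurable_vector.
Context {R : realType} d (Omega : measurableType d) (n : nat).
Variable V : 'I_n -> Omega -> R.
Hypothesis mV : forall i, measurable_fun setT (V i).

Lemma measurable_trigonometric Q : trigonometric Q ->
  measurable_fun setT (fun w => Q (\row_i V i w)).
Proof.
elim=> [a phi|c f g _ mf _ mg]; last by apply: measurable_funD => //; exact: measurable_funM.
apply: measurableT_comp; first exact: continuous_measurable_fun (@continuous_cos R).
apply: measurable_funD => //; apply: measurable_sum => i.
rewrite (_ : (fun w => _) = fun w => a i * V i w); first exact: measurable_funM.
by apply/funext => w; rewrite mxE.
Qed.

(** With box size [k.+1] and precision [1 / k.+1] the approximations converge pointwise, so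
    measurability passes from trigonometric functions to [f]. *)
Lemma measurable_continuous_vector (f : 'rV[R]_n -> R) (M : R) : continuous f ->
  (forall v, `|f v| <= M) -> measurable_fun setT (fun w => f (\row_i V i w)).
Proof.
move=> cf fM.
have ex (k : nat) : exists Q, trigonometric Q /\
    forall v : 'rV[R]_n, `|f v - Q v| <= k.+1%:R^-1 + 2 * M * \sum_(i < n) (v ord0 i / k.+1%:R) ^+ 2.
  have k0 : 0 < k.+1%:R^-1 :> R by rewrite invr_gt0.
  by have [Q hQ1 hQ2] := trigonometric_approximation cf fM (ltr0Sn R k) k0; exists Q.
have [Q hQ] := choice ex.
apply: (@measurable_fun_cvg _ _ _ _ (fun k w => Q k (\row_i V i w))).
  by move=> k; apply: measurable_trigonometric; exact: (hQ k).1.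
move=> w _; set v : 'rV[R]_n := \row_i V i w.
pose S := \sum_(i < n) (v ord0 i) ^+ 2.
apply/cvgrPdist_le => e e0.
have c1 : k.+1%:R^-1 + 2 * M * S * k.+1%:R^-1 * k.+1%:R^-1 @[k --> \oo] --> (0 : R).
  have h : k.+1%:R^-1 @[k --> \oo] --> (0 : R) by exact: cvg_harmonic.
  rewrite -[X in _ --> X](addr0 0); apply: cvgD => //.
  rewrite -[X in _ --> X](mulr0 (2 * M * S * 0)); apply: cvgM => //.
  by apply: cvgM => //; exact: cvg_cst.
have /cvgrPdist_le/(_ e e0) := c1; apply: filterS => k; rewrite sub0r normrN => h.
apply: (le_trans ((hQ k).2 v)); apply: le_trans h; apply: le_trans (ler_norm _).
rewrite lerD2l le_eqVlt; apply/orP; left; apply/eqP.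
rewrite -!mulrA; congr (_ * (_ * _)); rewrite /S mulr_suml; apply: eq_bigr => i _.
by rewrite expr_div_n expr2 -[in RHS]invfM.
Qed.

End measurable_vector.

Lemma integrable_bounded {R : realType} d (T : measurableType d) (P : probability T R)
    (g : T -> R) (b : R) : measurable_fun setT g -> (forall w, `|g w| <= b) ->
  P.-integrable setT (EFin \o g).
Proof.
move=> mg gb; have ib : P.-integrable setT (EFin \o (fun=> b)).
  exact: finite_measure_integrable_cst.
apply: (le_integrable measurableT _ _ ib); first exact/measurable_EFinP.
by move=> w _ /=; rewrite lee_fin (le_trans (gb w))// ler_norm.
Qed.

(** * Weak convergence from cosines and second moments *)

Section weak_convergence.
Context {R : realType} d (Omega : measurableType d) d' (Omega' : measurableType d').
Variables (P : probability Omega R) (P' : probability Omega' R) (n : nat).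
Variables (V : R -> 'I_n -> Omega -> R) (W : 'I_n -> Omega' -> R).
Hypotheses (mV : forall c i, measurable_fun setT (V c i)) (mW : forall i, measurable_fun setT (W i)).

Let trigonometric_bounded (Q : 'rV[R]_n -> R) : trigonometric Q -> exists b, forall v, `|Q v| <= b.
Proof.
elim=> [a phi|c f g _ [b hb] _ [b' hb']].
  by exists 1 => v; rewrite ler_norml cos_le1 cos_geN1.
exists (`|c| * b + b') => v; apply: (le_trans (ler_normD _ _)); apply: lerD => //.
by rewrite normrM; apply: ler_wpM2l.
Qed.

Hypothesis cvg_cos : forall (a : 'I_n -> R) (phi : R),
  \int[P]_w cos (\sum_(i < n) a i * V c i w + phi) @[c --> +oo] -->
  \int[P']_w cos (\sum_(i < n) a i * W i w + phi).

Let cvg_trigonometric Q : trigonometric Q ->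
  \int[P]_w Q (\row_i V c i w) @[c --> +oo] --> \int[P']_w Q (\row_i W i w).
Proof.
elim=> [a phi|b f g hf cf hg cg].
  rewrite (_ : (fun c => _) = fun c => \int[P]_w cos (\sum_(i < n) a i * V c i w + phi)).
    rewrite (_ : \int[P']_w _ = \int[P']_w cos (\sum_(i < n) a i * W i w + phi)); first exact: cvg_cos.
    apply: eq_Rintegral => w _; congr (cos (_ + _)); apply: eq_bigr => i _; by rewrite mxE.
  apply/funext => c; apply: eq_Rintegral => w _; congr (cos (_ + _)).
  by apply: eq_bigr => i _; rewrite mxE.
have [bf hbf] := trigonometric_bounded hf; have [bg hbg] := trigonometric_bounded hg.
have lin d0 (O : measurableType d0) (p : probability O R) (U : 'I_n -> O -> R) :
    (forall i, measurable_fun setT (U i)) ->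
    \int[p]_w (b * f (\row_i U i w) + g (\row_i U i w)) =
    b * \int[p]_w f (\row_i U i w) + \int[p]_w g (\row_i U i w).
  move=> mU; have i1 := @integrable_bounded _ _ _ p _ _ (measurable_trigonometric mU hf) (fun w => hbf _).
  have i2 := @integrable_bounded _ _ _ p _ _ (measurable_trigonometric mU hg) (fun w => hbg _).
  rewrite RintegralD//; last exact: (integrableZl measurableT b i1).
  by rewrite RintegralZl.
rewrite (lin _ _ _ W)// (_ : (fun c => _) = fun c => b * \int[P]_w f (\row_i V c i w) + \int[P]_w g (\row_i V c i w)).
  by apply: cvgD => //; apply: cvgM => //; exact: cvg_cst.
by apply/funext => c; exact: lin.
Qed.

Variable C : R.
Hypothesis V2 : forall c i, 0 < c -> (\int[P]_w (V c i w ^+ 2)%:E <= C%:E)%E.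
Hypothesis W2 : forall i, (\int[P']_w (W i w ^+ 2)%:E <= C%:E)%E.

Let close d0 (O : measurableType d0) (p : probability O R) (U : 'I_n -> O -> R)
    (f Q : 'rV[R]_n -> R) (M L e : R) :
  (forall i, measurable_fun setT (U i)) -> (forall i, (\int[p]_w (U i w ^+ 2)%:E <= C%:E)%E) ->
  continuous f -> (forall v, `|f v| <= M) -> trigonometric Q -> 0 < L ->
  (forall v, `|f v - Q v| <= e + 2 * M * \sum_(i < n) (v ord0 i / L) ^+ 2) ->
  `|\int[p]_w f (\row_i U i w) - \int[p]_w Q (\row_i U i w)| <= e + 2 * M * (n%:R * C / L ^+ 2).
Proof.
move=> mU U2 cf fM hQ L0 fQ.
have M0 : 0 <= M by apply: le_trans (fM 0).
have [bQ hbQ] := trigonometric_bounded hQ.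
have mf := measurable_continuous_vector mU cf fM.
have mQ := measurable_trigonometric mU hQ.
have i1 := @integrable_bounded _ _ _ p _ _ mf (fun w => fM _).
have i2 := @integrable_bounded _ _ _ p _ _ mQ (fun w => hbQ _).
have iU i : p.-integrable setT (EFin \o (fun w => U i w ^+ 2)).
  apply/integrableP; split; first by apply/measurable_EFinP; exact: measurable_funX.
  have -> : (\int[p]_w `|(EFin \o (fun w => (U i w ^+ 2)%R)) w| = \int[p]_w (U i w ^+ 2)%:E)%E.
    by apply: eq_integral => w _; rewrite /= ger0_norm// sqr_ge0.
  exact: le_lt_trans (U2 i) (ltry _).
have sumI (s : seq 'I_n) : p.-integrable setT (EFin \o (fun w => \sum_(i <- s) U i w ^+ 2)) /\
    \int[p]_w (\sum_(i <- s) U i w ^+ 2) <= (size s)%:R * C.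
  elim: s => [|i s [IH1 IH2]].
    have -> : (fun w => \sum_(i <- [::]) U i w ^+ 2) = cst 0 by apply/funext => w; rewrite big_nil.
    split; first exact: integrable0.
    by rewrite /Rintegral integral0 mul0r.
  have -> : (fun w => \sum_(j <- i :: s) U j w ^+ 2) = (fun w => U i w ^+ 2 + \sum_(j <- s) U j w ^+ 2).
    by apply/funext => w; rewrite big_cons.
  split; first exact: (integrableD measurableT (iU i) IH1).
  rewrite RintegralD// /= -natr1 mulrDl mul1r addrC; apply: lerD => //.
  rewrite /Rintegral -lee_fin fineK; last exact: integrable_fin_num (iU i).
  exact: U2.
have [j1 j2] := sumI (index_enum 'I_n).
have j3 : p.-integrable setT (EFin \o (fun w => 2 * M / L ^+ 2 * \sum_(i < n) U i w ^+ 2)).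
  exact: (integrableZl measurableT _ j1).
have je : p.-integrable setT (EFin \o (fun=> e : R)) by exact: finite_measure_integrable_cst.
have ib : p.-integrable setT (EFin \o (fun w => e + 2 * M / L ^+ 2 * \sum_(i < n) U i w ^+ 2)).
  exact: (integrableD measurableT je j3).
rewrite -RintegralB//.
apply: (le_trans (le_normr_Rintegral measurableT (integrableB measurableT i1 i2))).
apply: (@le_trans _ _ (\int[p]_w (e + 2 * M / L ^+ 2 * \sum_(i < n) U i w ^+ 2))).
  apply: le_Rintegral => //; first exact: integrable_norm (integrableB measurableT i1 i2).
  move=> w _; apply: (le_trans (fQ _)); rewrite lerD2l -[leRHS]mulrA; apply: (ler_wpM2l (_ : 0 <= 2 * M)).
    by rewrite mulr_ge0.
  rewrite mulr_sumr; apply: ler_sum => i _.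
  by rewrite mxE expr_div_n mulrC.
rewrite RintegralD// RintegralZl// [X in X + _ <= _](_ : _ = e); last first.
  rewrite /Rintegral (_ : \int[p]_w e%:E = e%:E)%E//.
  transitivity (e%:E * p setT)%E; last by rewrite probability_setT mule1.
  exact: integral_cst.
rewrite lerD2l -!mulrA; apply: (ler_wpM2l (_ : 0 <= 2)) => //; apply: (ler_wpM2l M0).
rewrite mulrC mulrA; apply: (ler_wpM2r (_ : 0 <= (L ^+ 2)^-1)).
  by rewrite invr_ge0 sqr_ge0.
have sz : size (index_enum 'I_n) = n by rewrite /index_enum -enumT size_enum_ord.
by move: j2; rewrite sz.
Qed.

Lemma weak_cvg_of_cos (f : 'rV[R]_n -> R) : continuous f -> (exists M : R, forall v, `|f v| <= M) ->
  (\int[P]_w (f (\row_i V c i w))%:E)%E @[c --> +oo] --> (\int[P']_w (f (\row_i W i w))%:E)%E.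
Proof.
move=> cf [M fM]; have M0 : 0 <= M by apply: le_trans (fM 0).
have fin d0 (O : measurableType d0) (p : probability O R) (U : 'I_n -> O -> R) :
    (forall i, measurable_fun setT (U i)) ->
    (\int[p]_w (f (\row_i U i w))%:E = (\int[p]_w f (\row_i U i w))%:E)%E.
  move=> mU; rewrite /Rintegral fineK//; apply: integrable_fin_num => //.
  by apply: (@integrable_bounded _ _ _ _ _ M) => //; exact: (measurable_continuous_vector mU cf fM).
rewrite (fin _ _ _ W)//.
rewrite (_ : (fun c => _) = fun c => (\int[P]_w f (\row_i V c i w))%:E); last first.
  by apply/funext => c; exact: fin.
apply: cvg_EFin; first exact: nearW.
apply/cvgrPdist_le => e e0.
have C0 : 0 <= n%:R * `|C| by rewrite mulr_ge0.
(* Makes the quadratic error [2 M n C / L^2] at most [e / 8]; the added 1s keep [L] positive. Each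
   of the two approximations then costs [e / 4], and so does the trigonometric convergence. *)
pose L := Num.sqrt (16 * (M + 1) * (n%:R * `|C| + 1) / e).
have L20 : 0 < 16 * (M + 1) * (n%:R * `|C| + 1) / e.
  by rewrite divr_gt0// !mulr_gt0// ltr_wpDl.
have L0 : 0 < L by rewrite sqrtr_gt0.
have L2 : L ^+ 2 = 16 * (M + 1) * (n%:R * `|C| + 1) / e by rewrite sqr_sqrtr// ltW.
have e80 : 0 < e / 8 by rewrite divr_gt0.
have [Q hQ fQ] := trigonometric_approximation cf fM L0 e80.
have small : 2 * M * (n%:R * C / L ^+ 2) <= e / 8.
  rewrite L2 mulrA ler_pdivrMr//.
  have -> : e / 8 * (16 * (M + 1) * (n%:R * `|C| + 1) / e) = 2 * ((M + 1) * (n%:R * `|C| + 1)).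
    by field; exact: lt0r_neq0.
  rewrite -mulrA; apply: (ler_wpM2l (_ : 0 <= 2)) => //.
  apply: (@le_trans _ _ (M * (n%:R * `|C|))).
    by apply: (ler_wpM2l M0); apply: ler_wpM2l => //; exact: ler_norm.
  by apply: ler_pM => //; rewrite lerDl.
have cW := close mW W2 cf fM hQ L0 fQ.
have /cvgrPdist_le/(_ (e / 4)) := cvg_trigonometric hQ.
rewrite divr_gt0// => /(_ isT) hc.
near=> c.
have c0 : 0 < c by near: c; exact: nbhs_pinfty_gt.
have cV := close (mV c) (fun i => V2 i c0) cf fM hQ L0 fQ.
have h : `|\int[P']_w Q (\row_i W i w) - \int[P]_w Q (\row_i V c i w)| <= e / 4 by near: c.
rewrite /=; move: cW cV h small; rewrite !ler_norml.
move: (2 * M * (n%:R * C / L ^+ 2)) (\int[P']_w f (\row_i W i w)) (\int[P]_w f (\row_i V c i w)).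
move: (\int[P']_w Q (\row_i W i w)) (\int[P]_w Q (\row_i V c i w)) => x1 x2 x3 x4 x5.
lra.
Unshelve. all: by end_near. Qed.

End weak_convergence.

(** * Convergence of the shot noise *)

Section shot_noise_limit.
Context {R : realType} d (Omega : measurableType d) (P : probability Omega R).
Notation leb := (@lebesgue_measure R).
Variables (alpha lambda K : R) (T X : nat -> {RV P >-> R}) (F : R.-pker R ~> R).
Hypotheses (halpha : 1 < alpha < 2) (l0 : 0 < lambda).
Hypothesis hT : Poisson_arrival_times lambda T.
Hypothesis hX : conditionally_independent_noises T X F.
Hypothesis hfin : forall (u : R) (r : nat), 0 < u -> (1 <= r <= 4)%N ->
  (F u).-integrable [set: R] (EFin \o (fun x : R => x ^+ r)).
Hypothesis hK1 : forall u : R, 0 < u -> noise_moment F 1 u = 0.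
Variable M : R.
Hypothesis M1 : 1 <= M.
Hypothesis hK2 : forall u : R, 0 < u -> noise_moment F 2 u <= M.
Hypothesis hK4 : forall u : R, 0 < u -> noise_moment F 4 u <= M.
Hypothesis K0 : 0 < K.
Hypothesis hK2_lim : noise_moment F 2 u @[u --> +oo] --> K.

Let m := (alpha - 1) / 2.
Let m0 : 0 < m. Proof. rewrite /m; move: (halpha) => /andP[h1 h2]; lra. Qed.
Let m1 : m < 1 / 2. Proof. rewrite /m; move: (halpha) => /andP[h1 h2]; lra. Qed.
Let G := K * lambda * Gamma alpha.
Let Ga0 : 0 < Gamma alpha. Proof. by apply: Gamma_gt0; move: (halpha) => /andP[h1 h2]; lra. Qed.
Let G0 : 0 < G. Proof. apply: mulr_gt0; [exact: mulr_gt0|exact: Ga0]. Qed.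
Let M0 : 0 <= M. Proof. by apply: le_trans M1. Qed.

Section kernel.
Variables (n : nat) (t a : 'I_n -> R).

Let h c u := shot_kernel m t a c u.
Let y c u := (Num.sqrt (c * G))^-1 * h c u.
Let s2 := \sum_(i < n) \sum_(j < n) a i * a j * log_excess_cov m (t i) (t j).

Let my c : measurable_fun setT (y c).
Proof. by apply: measurable_funM => //; exact: measurable_shot_kernel. Qed.

Let D : set (measurableTypeR R) := `]0, +oo[%classic.
Let mD : measurable D. Proof. exact: measurable_itv. Qed.

Let sqrtG c : 0 < c -> (Num.sqrt (c * G))^-1 ^+ 2 = (c * G)^-1.
Proof. by move=> c0; rewrite exprVn sqr_sqrtr// ltW// mulr_gt0. Qed.

Let y2E c u : 0 < c -> y c u ^+ 2 = (c * G)^-1 * h c u ^+ 2.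
Proof. by move=> c0; rewrite exprMn sqrtG. Qed.

Let y4E c u : 0 < c -> y c u ^+ 4 = (c * G)^-1 ^+ 2 * h c u ^+ 4.
Proof. by move=> c0; rewrite exprMn (exprM _ 2 2) sqrtG. Qed.

Let iy2 c : 0 < c -> leb.-integrable D (EFin \o (fun u => y c u ^+ 2)).
Proof.
move=> c0; have -> : (fun u => y c u ^+ 2) = (fun u => (c * G)^-1 * h c u ^+ 2).
  by apply/funext => u; exact: y2E.
exact: (integrableZl mD _ (integrable_shot_kernel_sqr m0 m1 t a c0)).
Qed.

Let iy4 c : 0 < c -> leb.-integrable D (EFin \o (fun u => y c u ^+ 4)).
Proof.
move=> c0; have -> : (fun u => y c u ^+ 4) = (fun u => (c * G)^-1 ^+ 2 * h c u ^+ 4).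
  by apply/funext => u; exact: y4E.
exact: (integrableZl mD _ (integrable_shot_kernel_pow4 m0 t a c0)).
Qed.

Let A2 c : 0 < c -> \int[leb]_(u in D) (y c u ^+ 2) = s2 / G.
Proof.
move=> c0; have -> : (fun u => y c u ^+ 2) = (fun u => (c * G)^-1 * h c u ^+ 2).
  by apply/funext => u; exact: y2E.
have i := integrable_shot_kernel_sqr m0 m1 t a c0.
have g0 := G0.
rewrite RintegralZl// (integral_shot_kernel_sqr m0 m1 t a c0) -/s2.
by field; rewrite !lt0r_neq0.
Qed.

Let s2_ge0 : 0 <= s2 / G.
Proof. by rewrite -(A2 ltr01); apply: Rintegral_ge0 => u _; exact: sqr_ge0. Qed.

(** The normalisation contributes [c^(-2)], the integral of the fourth power only a factor [c]. *)
Let A4 : exists2 C, 0 <= C & forall c, 0 < c -> \int[leb]_(u in D) (y c u ^+ 4) <= C / c.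
Proof.
have [C C0 hC] := integral_shot_kernel_pow4 m0 t a.
have g0 := G0.
exists (C / G ^+ 2); first by rewrite divr_ge0// sqr_ge0.
move=> c c0; have -> : (fun u => y c u ^+ 4) = (fun u => (c * G)^-1 ^+ 2 * h c u ^+ 4).
  by apply/funext => u; exact: y4E.
have i := integrable_shot_kernel_pow4 m0 t a c0.
rewrite RintegralZl//.
have -> : C / G ^+ 2 / c = (c * G)^-1 ^+ 2 * (c * C) by field; rewrite !lt0r_neq0.
by apply: ler_wpM2l; [rewrite exprn_ge0// invr_ge0 mulr_ge0 ?ltW|exact: hC].
Qed.

Let A4_ge0 c : 0 <= \int[leb]_(u in D) (y c u ^+ 4).
Proof. by apply: Rintegral_ge0 => u _; rewrite (exprM _ 2 2) sqr_ge0. Qed.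

Let kM u : 0 < u -> 0 <= noise_moment F 2 u <= M.
Proof. by move=> u0; rewrite noise_moment2_ge0 hK2. Qed.

Let q c u := 1 - expR (- (y c u ^+ 2 * noise_moment F 2 u / 2)).
Let err c e u := M ^+ 2 * (e * y c u ^+ 2 + e^-1 * y c u ^+ 4 + y c u ^+ 4).

Let v := s2 / Gamma alpha.

Let cvg_intensity : lambda * \int[leb]_(u in `[0, +oo[) q c u @[c --> +oo] --> v / 2.
Proof.
apply/cvgrPdist_le => eps eps0.
have [C C0 hC] := A4.
(* Keeps the contribution of the range where the second moment is within [e] of [K] below
   [eps / 2]. *)
pose e := eps / (lambda * (s2 / G) + 1).
have ga0 := Ga0; have g0 := G0; have p0 := s2_ge0; have m00 := M0.
have le0 : 0 < lambda * (s2 / G) + 1 by rewrite ltr_wpDl// mulr_ge0// ltW.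
have e0 : 0 < e by rewrite divr_gt0.
have [u0 u00 hu0] : exists2 u0, 0 < u0 & forall u, u0 <= u -> `|noise_moment F 2 u - K| <= e.
  have /cvgrPdist_le/(_ e e0)[b [_ hb]] := hK2_lim.
  exists (Num.max b 0 + 1); first by rewrite ltr_wpDl// le_max lexx orbT.
  move=> u hu; rewrite distrC; apply: hb.
  by apply: lt_le_trans hu; rewrite ltr_pwDr// le_max lexx.
pose Z := lambda * ((M ^+ 2 / 8 + (M + K) / 4) * C + (M + K) * u0 / 4).
have MK0 : 0 <= M + K by rewrite addr_ge0// ltW.
have Z0 : 0 <= Z.
  rewrite /Z; apply: mulr_ge0; first exact: ltW.
  apply: addr_ge0; last by rewrite divr_ge0// mulr_ge0// ltW.
  apply: mulr_ge0 => //; apply: addr_ge0; last by rewrite divr_ge0.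
  by rewrite divr_ge0// sqr_ge0.
near=> c.
have c1 : 1 < c by near: c; exact: nbhs_pinfty_gt.
have c0 : 0 < c by lra.
(* This [s] balances the quartic term, of order [s / c], against the bounded range of [u], of order
   [u0 / s]; both become of order [1 / s] and are collected in [Z / s]. *)
pose s := Num.sqrt c; have s0 : 0 < s by rewrite sqrtr_gt0.
have ss : s ^+ 2 = c by rewrite sqr_sqrtr// ltW.
have s1 : 1 <= s by rewrite -sqrtr1 ler_sqrt// ltW.
have hs : 2 * Z / eps <= s.
  have h0 : 0 <= 2 * Z / eps by apply: divr_ge0; [exact: mulr_ge0|exact: ltW].
  have hc1 : (2 * Z / eps) ^+ 2 <= c by near: c; apply: nbhs_pinfty_ge; exact: num_real.
  by rewrite -[leLHS](ger0_norm h0) -sqrtr_sqr /s; exact: ler_wsqrtr.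
have := integral_expR_intensity (my c) (measurable_noise_moment2 F) M0 kM (iy2 c0) (iy4 c0)
  e0 s0 u00 (ltW K0) hu0.
rewrite (A2 c0) -/(q c).
have hc := hC _ c0; have h4 := A4_ge0 c.
set I := \int[leb]_(u in `[0, +oo[) q c u.
set B := \int[leb]_(x in _) _ in hc h4 *.
move=> hI.
have vE : v / 2 = lambda * (K * (s2 / G) / 2).
  by rewrite /v /G; field; rewrite !lt0r_neq0.
rewrite vE -mulrBr normrM (gtr0_norm l0) distrC.
apply: (@le_trans _ _ (lambda * ((M ^+ 2 / 8 + (M + K) * s / 4) * (C / c) +
    e / 2 * (s2 / G) + (M + K) / (4 * s) * u0))).
  apply: (ler_wpM2l (ltW l0)); apply: (le_trans hI); rewrite lerD2r lerD2r.
  apply: ler_wpM2l => //; rewrite addr_ge0// divr_ge0 ?mulr_ge0 ?sqr_ge0//; exact: ltW.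
have b1 : lambda * (e / 2 * (s2 / G)) <= eps / 2.
  have -> : lambda * (e / 2 * (s2 / G)) = (eps / 2) * (lambda * (s2 / G) / (lambda * (s2 / G) + 1)).
    by rewrite /e; move: (_ + 1) (lt0r_neq0 le0) => L Ln0; field; rewrite Ln0 lt0r_neq0.
  apply: ler_piMr; first by rewrite divr_ge0// ltW.
  by rewrite ler_pdivrMr// mul1r lerDl.
have b2 : lambda * ((M ^+ 2 / 8 + (M + K) * s / 4) * (C / c) + (M + K) / (4 * s) * u0) <= Z / s.
  have -> : Z / s = lambda * ((M ^+ 2 / 8 * s + (M + K) * s / 4) * (C / c) + (M + K) / (4 * s) * u0).
    by rewrite /Z -ss; field; rewrite lt0r_neq0.
  apply: (ler_wpM2l (ltW l0)); rewrite lerD2r; apply: ler_wpM2r; first by rewrite divr_ge0// ltW.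
  by rewrite lerD2r ler_peMr// divr_ge0// sqr_ge0.
have b3 : Z / s <= eps / 2.
  rewrite ler_pdivrMr// mulrAC ler_pdivlMr//; move: hs; rewrite ler_pdivrMr//; lra.
rewrite addrAC mulrDr; lra.
Unshelve. all: by end_near. Qed.

(** The order of choice matters: [e] is fixed first and tames the quadratic term, which does not
    depend on [c]; then [c] is taken large enough to beat the factor [e^-1] of the quartic term. *)
Let small_error eta : 0 < eta -> exists2 e, 0 < e & \forall c \near +oo,
  (lambda%:E * \int[leb]_(u in `[0%R, +oo[) (err c e u)%:E <= eta%:E)%E.
Proof.
move=> eta0; have [C C0 hC] := A4.
have L0 : 0 < lambda * M ^+ 2 * (s2 / G) + 1.
  apply: ltr_wpDl => //; apply: mulr_ge0; last exact: s2_ge0.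
  by rewrite mulr_ge0 ?sqr_ge0// ltW.
have g0 := G0; pose e := eta / 2 / (lambda * M ^+ 2 * (s2 / G) + 1).
have e0 : 0 < e by rewrite !divr_gt0.
exists e => //; pose Z := lambda * M ^+ 2 * (e^-1 + 1) * C.
near=> c.
have c0 : 0 < c by near: c; exact: nbhs_pinfty_gt.
have hc1 : 2 * Z / eta <= c by near: c; apply: nbhs_pinfty_ge; exact: num_real.
rewrite (integral_error_eq M (my c) (iy2 c0) (iy4 c0) e0) (A2 c0) -EFinM lee_fin.
have hc := hC _ c0; set B := \int[leb]_(x in _) _ in hc *.
have b1 : lambda * M ^+ 2 * (e * (s2 / G)) <= eta / 2.
  have -> : lambda * M ^+ 2 * (e * (s2 / G)) = (eta / 2) * (lambda * M ^+ 2 * (s2 / G) / (lambda * M ^+ 2 * (s2 / G) + 1)).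
    by rewrite /e; move: (_ + 1) (lt0r_neq0 L0) => L Ln0; field; rewrite Ln0 lt0r_neq0.
  apply: ler_piMr; first by rewrite divr_ge0// ltW.
  by rewrite ler_pdivrMr// mul1r lerDl.
have b2 : lambda * M ^+ 2 * ((e^-1 + 1) * B) <= eta / 2.
  apply: (@le_trans _ _ (Z / c)).
    have -> : Z / c = lambda * M ^+ 2 * ((e^-1 + 1) * (C / c)) by rewrite /Z; ring.
    apply: ler_wpM2l; first by rewrite mulr_ge0 ?sqr_ge0// ltW.
    by apply: ler_wpM2l => //; rewrite addr_ge0// invr_ge0 ltW.
  rewrite ler_pdivrMr// mulrAC ler_pdivlMr//; move: hc1; rewrite ler_pdivrMr//; lra.
have -> : lambda * (M ^+ 2 * (e * (s2 / G) + e^-1 * B + B)) =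
  lambda * M ^+ 2 * (e * (s2 / G)) + lambda * M ^+ 2 * ((e^-1 + 1) * B) by ring.
lra.
Unshelve. all: by end_near. Qed.

Variable Y : R -> Omega -> R.
Hypothesis mY : forall c, measurable_fun setT (Y c).
Hypothesis SY : forall c, 0 < c -> {ae P, forall w,
  \sum_(0 <= j < k) y c (T j w) * X j w @[k --> \oo] --> Y c w}.

Let y_supp c u : 0 < c -> ~~ (0 < u <= c * \sum_(i < n) `|t i|) -> y c u = 0.
Proof. by move=> c0 hu; rewrite /y /h (shot_kernel_supp m0 a c0 hu) mulr0. Qed.

Lemma shot_noise_cvg_cos phi : 0 <= cos phi ->
  \int[P]_w cos (Y c w + phi) @[c --> +oo] --> expR (- (v / 2)) * cos phi.
Proof.
move=> cphi.
have h1 : expR (- lambda * \int[leb]_(u in `[0, +oo[) q c u) * cos phi @[c --> +oo] -->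
    expR (- (v / 2)) * cos phi.
  apply: cvgM; last exact: cvg_cst.
  apply: (cvg_comp _ expR); last exact: continuous_expR.
  rewrite (_ : (fun c => _) = fun c => - (lambda * \int[leb]_(u in `[0, +oo[) q c u)).
    by apply: cvgN; exact: cvg_intensity.
  by apply/funext => c; rewrite mulNr.
apply/cvgrPdist_le => eps eps0; have eps2 : 0 < eps / 2 by rewrite divr_gt0.
have [e e0 he] := small_error eps2.
have /cvgrPdist_le/(_ _ eps2) h2 := h1.
near=> c.
have c0 : 0 < c by near: c; exact: nbhs_pinfty_gt.
have b1 : `|expR (- (v / 2)) * cos phi -
    expR (- lambda * \int[leb]_(u in `[0, +oo[) q c u) * cos phi| <= eps / 2 by near: c.
have b2 : (lambda%:E * \int[leb]_(u in `[0%R, +oo[) (err c e u)%:E <= (eps / 2)%:E)%E by near: c.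
have b3 := shot_limit_cos l0 hT hX hfin hK1 M1 hK2 hK4 (my c) (fun u => y_supp c0) (mY c) (SY c0) e0 cphi b2.
move: b1 b3; rewrite !ler_norml.
move: (expR (- (v / 2)) * cos phi) (expR (- lambda * _) * cos phi) (\int[P]_w cos (Y c w + phi)).
move=> z1 z2 z3; lra.
Unshelve. all: by end_near. Qed.

Lemma shot_noise_second_moment c : 0 < c ->
  (\int[P]_w (Y c w ^+ 2)%:E <= (lambda * (M * (s2 / G)))%:E)%E.
Proof.
move=> c0.
have h1 := shot_limit_second_moment l0 hT hX hfin hK1 (my c) (fun u => y_supp c0) (mY c) (SY c0).
apply: (le_trans h1); rewrite EFinM; apply: lee_wpmul2l; first by rewrite lee_fin ltW.
have := integral_square_intensity_le (my c) (measurable_noise_moment2 F) kM (iy2 c0).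
by rewrite (A2 c0).
Qed.

End kernel.

End shot_noise_limit.

(** Phases 0 and -pi/2 have nonnegative cosines and generate all the others, which lifts the
    restriction in [shot_limit_cos]. *)
Lemma Rintegral_cos_shift {R : realType} d (Omega : measurableType d) (P : probability Omega R)
    (Y : Omega -> R) phi : measurable_fun setT Y ->
  \int[P]_w cos (Y w + phi) =
  cos phi * \int[P]_w cos (Y w + 0) - sin phi * \int[P]_w cos (Y w + - (pi / 2)).
Proof.
move=> mY.
have iY (psi : R) : P.-integrable setT (EFin \o (fun w => cos (Y w + psi))).
  apply: (@integrable_bounded _ _ _ _ _ 1) => [|w]; last first.
    by rewrite ler_norml cos_geN1 cos_le1.
  apply: measurableT_comp; first exact: continuous_measurable_fun (@continuous_cos R).
  exact: measurable_funD.
rewrite -(RintegralZl _ measurableT (iY 0)) -(RintegralZl _ measurableT (iY _)).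
rewrite -RintegralB//; first last.
- exact: (integrableZl measurableT _ (iY _)).
- exact: (integrableZl measurableT _ (iY _)).
by apply: eq_Rintegral => w _; rewrite addr0 cosBpihalf cosD mulrC [X in _ - X]mulrC.
Qed.

(** * Linear combinations of the limit process *)

Section Gaussian_combination.
Context {R : realType} d (Omega : measurableType d) (P : probability Omega R).
Variables (alpha : R) (B : R -> {RV P >-> R}).
Hypotheses (halpha : 1 < alpha < 2) (hB : Hadamard_fBm alpha B).
Variables (n : nat) (t a : 'I_n -> R).
Hypothesis t0 : forall i, 0 <= t i.

Let m := (alpha - 1) / 2.
Let Z w := \sum_(i < n) a i * B (t i) w.
Let v := (\sum_(i < n) \sum_(j < n) a i * a j * log_excess_cov m (t i) (t j)) / Gamma alpha.

Let mZ : measurable_fun setT Z.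
Proof. by apply: measurable_sum => i; exact: measurable_funM. Qed.

Let B2 i : P.-integrable setT (EFin \o (fun w => B (t i) w ^+ 2)).
Proof.
apply/integrableP; split; first by apply/measurable_EFinP; exact: measurable_funX.
have [_ _ _ h _] := hB; have := h _ (t0 i); rewrite unlock => h2.
under eq_integral do rewrite /= ger0_norm ?sqr_ge0//.
by rewrite h2 ltry.
Qed.

Let iB i : P.-integrable setT (EFin \o B (t i)).
Proof.
have i1 : P.-integrable setT (EFin \o (fun=> 1 : R)) by exact: finite_measure_integrable_cst.
have i2 := integrableD measurableT i1 (B2 i).
apply: (le_integrable measurableT _ _ i2); first exact/measurable_EFinP.
move=> w _ /=; rewrite lee_fin.
rewrite [leRHS]ger0_norm; last by rewrite addr_ge0// sqr_ge0.
rewrite -(real_normK (num_real (B (t i) w))).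
by have := sqr_ge0 (`|B (t i) w| - 1); have := normr_ge0 (B (t i) w); nra.
Qed.

Let iBB i j : P.-integrable setT (EFin \o (fun w => B (t i) w * B (t j) w)).
Proof.
have i2 := integrableD measurableT (B2 i) (B2 j).
apply: (le_integrable measurableT _ _ i2); first by apply/measurable_EFinP; exact: measurable_funM.
move=> w _ /=; rewrite lee_fin.
rewrite [leRHS]ger0_norm; last by rewrite addr_ge0// sqr_ge0.
rewrite normrM -(real_normK (num_real (B (t i) w))) -(real_normK (num_real (B (t j) w))).
have := sqr_ge0 (`|B (t i) w| - `|B (t j) w|).
by have := normr_ge0 (B (t i) w); have := normr_ge0 (B (t j) w); nra.
Qed.

Let EZ : (\int[P]_w (Z w)%:E = 0)%E.
Proof.
under eq_integral do rewrite /Z -sumEFin.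
rewrite integral_sum//; last by move=> i; exact: (integrableZl measurableT _ (iB i)).
rewrite big1// => i _; under eq_integral do rewrite EFinM.
rewrite integralZl//; last exact: iB.
by have [_ h _ _ _] := hB; have := h _ (t0 i); rewrite unlock => ->; rewrite mule0.
Qed.

Let EZ2 : (\int[P]_w (Z w ^+ 2)%:E = v%:E)%E.
Proof.
have iij i j : P.-integrable setT (EFin \o (fun w => a i * a j * (B (t i) w * B (t j) w))).
  exact: (integrableZl measurableT _ (iBB i j)).
have Z2 w : ((Z w ^+ 2)%:E =
    \sum_(i < n) \sum_(j < n) (a i * a j * (B (t i) w * B (t j) w))%:E)%E.
  under eq_bigr do rewrite sumEFin.
  rewrite sumEFin; congr EFin; rewrite expr2 /Z mulr_suml; apply: eq_bigr => i _.
  by rewrite mulr_sumr; apply: eq_bigr => j _; ring.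
under eq_integral do rewrite Z2.
rewrite integral_sum//; last by move=> i; apply: integrable_sum => // j _; exact: iij.
rewrite /v mulr_suml -sumEFin; apply: eq_bigr => i _.
rewrite integral_sum; [|by []|exact: iij].
rewrite mulr_suml -sumEFin; apply: eq_bigr => j _.
under eq_integral do rewrite EFinM.
rewrite integralZl//; last exact: iBB.
by rewrite (Hadamard_fBm_covariance halpha hB (t0 i) (t0 j)) -EFinM mulrA.
Qed.

(** Only the cosine part survives: the combination is centred Gaussian, so its sine has mean 0. *)
Lemma Hadamard_fBm_cos phi : \int[P]_w cos (Z w + phi) = expR (- (v / 2)) * cos phi.
Proof.
have [gB _ _ _ _] := hB.
have [hc hs] := Gaussian_law_Fourier mZ (gB n t a t0) EZ EZ2.
have mcos : measurable_fun setT (fun w => cos (Z w)).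
  by apply: measurableT_comp => //; exact: continuous_measurable_fun (@continuous_cos R).
have msin : measurable_fun setT (fun w => sin (Z w)).
  by apply: measurableT_comp => //; exact: continuous_measurable_fun (@continuous_sin R).
have i1 : P.-integrable setT (EFin \o (fun=> 1 : R)) by exact: finite_measure_integrable_cst.
have ic : P.-integrable setT (EFin \o (fun w => cos (Z w))).
  by apply: (@integrable_bounded _ _ _ _ _ 1) => // w; rewrite ler_norml cos_geN1 cos_le1.
have is_ : P.-integrable setT (EFin \o (fun w => sin (Z w))).
  by apply: (@integrable_bounded _ _ _ _ _ 1) => // w; rewrite ler_norml sin_geN1 sin_le1.
have one : \int[P]_w (1 : R) = 1 by rewrite Rintegral_cst// [X in fine X](_ : _ = 1%E) ?mulr1//; exact: probability_setT.
have c1 : \int[P]_w (1 + cos (Z w)) = 1 + expR (- (v / 2)) by rewrite /Rintegral hc.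
have s1 : \int[P]_w (1 + sin (Z w)) = 1 by rewrite /Rintegral hs.
rewrite RintegralD// one in c1; rewrite RintegralD// one in s1.
rewrite Rintegral_cos_shift//.
under eq_Rintegral do rewrite addr0.
under [X in _ - _ * X]eq_Rintegral do rewrite cosBpihalf.
have -> : \int[P]_w cos (Z w) = expR (- (v / 2)) by lra.
have -> : \int[P]_w sin (Z w) = 0 by lra.
by rewrite mulr0 subr0 mulrC.
Qed.

End Gaussian_combination.

(** The partial sums are eventually constant, all terms beyond [N] being 0. *)
Lemma is_cvg_shot_series {R : realType} (m x : R) (s r : R^nat) : 0 < m ->
  (exists N, forall j, (N <= j)%N -> x < s j) ->
  cvgn (series (fun j => log_excess x (s j) `^ m * r j)).
Proof.
move=> m0 [N hN]; set u := fun j => _.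
apply: (cvgP (series u N)); apply: cvg_near_cst; near=> k.
have Nk : (N <= k)%N by near: k; exact: nbhs_infty_ge.
apply/eqP; rewrite eq_sym -subr_eq0 -opprB oppr_eq0 sub_series_geq//.
rewrite big_nat big1// => j /andP[Nj _].
by rewrite /u log_excess_ge ?ltW ?hN// powR0 ?mul0r// gt_eqF.
Unshelve. all: by end_near. Qed.

Section finite_dimensional.
Context {R : realType} d (Omega : measurableType d) (P : probability Omega R).
Context d' (Omega' : measurableType d') (P' : probability Omega' R).
Variables (alpha lambda K : R) (T X : nat -> {RV P >-> R}) (F : R.-pker R ~> R).
Variable B : R -> {RV P' >-> R}.
Hypotheses (halpha : 1 < alpha < 2) (l0 : 0 < lambda).
Hypothesis hT : Poisson_arrival_times lambda T.
Hypothesis hX : conditionally_independent_noises T X F.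
Hypothesis hfin : forall (u : R) (r : nat), 0 < u -> (1 <= r <= 4)%N ->
  (F u).-integrable [set: R] (EFin \o (fun x : R => x ^+ r)).
Hypothesis hK1 : forall u : R, 0 < u -> noise_moment F 1 u = 0.
Variable M : R.
Hypothesis M1 : 1 <= M.
Hypothesis hK2 : forall u : R, 0 < u -> noise_moment F 2 u <= M.
Hypothesis hK4 : forall u : R, 0 < u -> noise_moment F 4 u <= M.
Hypothesis K0 : 0 < K.
Hypothesis hK2_lim : noise_moment F 2 u @[u --> +oo] --> K.
Hypothesis hB : Hadamard_fBm alpha B.

Let m := (alpha - 1) / 2.
Let m0 : 0 < m. Proof. rewrite /m; move: (halpha) => /andP[h1 h2]; lra. Qed.
Let G := K * lambda * Gamma alpha.

Variable N : set Omega.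
Hypotheses (mN : measurable N) (N0 : P N = 0%E).
Hypothesis hN : forall w, ~ N w -> (forall j, 0 < T j w) /\
  forall x : R, exists n, forall j, (n <= j)%N -> x < T j w.

Variables (n : nat) (t : 'I_n -> R).
Hypothesis t0 : forall i, 0 <= t i.

Let S c x w := shot_noise alpha lambda K T X c x w.
(* On [N] the series in [shot_noise] may diverge, and then [limn] is arbitrary
   and possibly not measurable. *)
Let V c (i : 'I_n) w := \1_(~` N) w * S c (t i) w.

Let VE c i w : ~ N w -> V c i w = S c (t i) w.
Proof. by move=> Nw; rewrite /V indicE mem_set// mul1r. Qed.

Let partial c x w k := \sum_(0 <= j < k) log_excess (c * x) (T j w) `^ m * X j w.

Let cvg_partial c x w : ~ N w -> (Num.sqrt (c * G))^-1 * partial c x w k @[k --> \oo] --> S c x w.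
Proof.
move=> Nw; apply: cvgMr; rewrite /shot_noise.
exact: (@is_cvg_shot_series _ _ _ (fun j => T j w) (fun j => X j w) m0 ((hN Nw).2 (c * x))).
Qed.

Let mV c i : measurable_fun setT (V c i).
Proof.
pose h k w := \1_(~` N) w * ((Num.sqrt (c * G))^-1 * partial c (t i) w k).
apply: (@measurable_fun_cvg _ _ _ _ h).
  move=> k; apply: measurable_funM; first by apply: measurable_indic; exact: measurableC.
  apply: measurable_funM => //; apply: measurable_sum => j; apply: measurable_funM => //.
  apply: (measurableT_comp (measurable_powR m)).
  by apply: measurableT_comp => //; exact: measurable_log_excess.
move=> w _; have [Nw|Nw] := pselect (N w).
  have z : \1_(~` N) w = 0 :> R by rewrite indicE memNset//; exact.
  by rewrite /h /V z mul0r; under eq_fun do rewrite mul0r; exact: cvg_cst.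
by apply: cvgMr; exact: cvg_partial.
Qed.

Let SV a c : 0 < c -> {ae P, forall w,
  \sum_(0 <= j < k) (Num.sqrt (c * G))^-1 * shot_kernel m t a c (T j w) * X j w @[k --> \oo]
    --> \sum_(i < n) a i * V c i w}.
Proof.
move=> c0; exists N; split => // w; apply: contra_notP => Nw.
have [T0 _] := hN Nw => /=.
rewrite (_ : (fun k => _) = fun k => \sum_(i < n) a i * ((Num.sqrt (c * G))^-1 * partial c (t i) w k)).
  apply: cvg_big => [|i _]; first exact: add_continuous.
  rewrite VE//.
  by apply: cvgMr; exact: cvg_partial.
apply/funext => k; under [RHS]eq_bigr do rewrite /partial !mulr_sumr.
rewrite exchange_big /=; apply: eq_bigr => j _.
(* Positivity of the arrival times opens the cut in [shot_kernel]. *)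
rewrite /shot_kernel T0 mulr_sumr mulr_suml; apply: eq_bigr => i _; ring.
Qed.

Let s2 a := \sum_(i < n) \sum_(j < n) a i * a j * log_excess_cov m (t i) (t j).

Let mY a c : measurable_fun setT (fun w => \sum_(i < n) a i * V c i w).
Proof. by apply: measurable_sum => i; exact: measurable_funM. Qed.

Let cvg_cos a phi : \int[P]_w cos (\sum_(i < n) a i * V c i w + phi) @[c --> +oo] -->
  \int[P']_w cos (\sum_(i < n) a i * B (t i) w + phi).
Proof.
have h psi : 0 <= cos psi -> \int[P]_w cos (\sum_(i < n) a i * V c i w + psi) @[c --> +oo] -->
    \int[P']_w cos (\sum_(i < n) a i * B (t i) w + psi).
  move=> hpsi; rewrite (Hadamard_fBm_cos halpha hB a t0).
  exact: (shot_noise_cvg_cos halpha l0 hT hX hfin hK1 M1 hK2 hK4 K0 hK2_lim (mY a) (@SV a) hpsi).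
rewrite Rintegral_cos_shift; last by apply: measurable_sum => i; exact: measurable_funM.
under eq_fun do rewrite Rintegral_cos_shift//.
apply: cvgB; apply: cvgMr; apply: h; first by rewrite cos0.
by rewrite cosN cos_pihalf.
Qed.

Let bound a := lambda * (M * (s2 a / G)).

Lemma cvg_shot_noise_vector (f : 'rV[R]_n -> R) : continuous f -> (exists b, forall v, `|f v| <= b) ->
  ('E_P[fun w => f (\row_i S c (t i) w)])%E @[c --> +oo] -->
  ('E_P'[fun w => f (\row_i B (t i) w)])%E.
Proof.
move=> cf fb.
(* Single coordinates are linear combinations too, so [shot_noise_second_moment] bounds each of
   them; [C] dominates these bounds and the variances [t i] at once. *)
pose delta (i j : 'I_n) : R := (j == i)%:R.
pose C := \sum_(i < n) (`|bound (delta i)| + `|t i|).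
have leC i : `|bound (delta i)| + `|t i| <= C.
  by rewrite /C (bigD1 i)//= lerDl sumr_ge0// => j _; rewrite addr_ge0.
have V2 c i : 0 < c -> (\int[P]_w (V c i w ^+ 2)%:E <= C%:E)%E.
  move=> c0.
  have Ve w : V c i w = \sum_(j < n) delta i j * V c j w.
    rewrite (bigD1 i)//= /delta eqxx mul1r big1 ?addr0// => j ji.
    by rewrite (negbTE ji) mul0r.
  under eq_integral do rewrite Ve.
  apply: (le_trans (shot_noise_second_moment halpha l0 hT hX hfin hK1 hK2 K0
    (mY (delta i)) (@SV (delta i)) c0)).
  rewrite lee_fin; apply: le_trans (leC i); apply: (le_trans (ler_norm _)).
  by rewrite lerDl.
have W2 i : (\int[P']_w (B (t i) w ^+ 2)%:E <= C%:E)%E.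
  have [_ _ _ h _] := hB; have := h _ (t0 i); rewrite unlock => ->.
  rewrite lee_fin; apply: le_trans (leC i); apply: (le_trans (ler_norm _)).
  by rewrite lerDr.
have mW (i : 'I_n) : measurable_fun setT (B (t i)) by [].
have := weak_cvg_of_cos mV mW cvg_cos V2 W2 cf fb.
have E1 (Z : Omega -> R) : ('E_P[Z] = \int[P]_w (Z w)%:E)%E by rewrite unlock.
have E2 (Z : Omega' -> R) : ('E_P'[Z] = \int[P']_w (Z w)%:E)%E by rewrite unlock.
rewrite E2 (_ : (fun c => 'E_P[_])%E = fun c => (\int[P]_w (f (\row_i V c i w))%:E)%E)//.
(* The shot noise is exchanged for its measurable version [V], equal to it off [N]. *)
apply/funext => c; rewrite E1; apply: (eq_integral_off_null mN N0) => w Nw.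
by congr (f _)%:E; apply/rowP => i; rewrite !mxE VE.
Qed.

End finite_dimensional.

Theorem theorem3p1 (R : realType)
  (d : measure_display) (Omega : measurableType d) (P : probability Omega R)
  (d' : measure_display) (Omega' : measurableType d')
  (P' : probability Omega' R)
  (alpha lambda K kappa : R)
  (T X : nat -> {RV P >-> R}) (F : R.-pker R ~> R)
  (B : R -> {RV P' >-> R})
  (halpha : 1 < alpha < 2) (hlambda : 0 < lambda)
  (hT : Poisson_arrival_times lambda T)
  (hX : conditionally_independent_noises T X F)
  (hfin : forall (u : R) (r : nat), 0 < u -> (1 <= r <= 4)%N ->
    (F u).-integrable [set: R] (EFin \o (fun x : R => x ^+ r)))
  (hK1 : forall u : R, 0 < u -> noise_moment F 1 u = 0)
  (hK2_gt0 : forall u : R, 0 < u -> 0 < noise_moment F 2 u)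
  (hK4_gt0 : forall u : R, 0 < u -> 0 < noise_moment F 4 u)
  (hK2_bounded : exists M : R, forall u : R, 0 < u -> noise_moment F 2 u <= M)
  (hK4_bounded : exists M : R, forall u : R, 0 < u -> noise_moment F 4 u <= M)
  (hK : 0 < K)
  (hK2_lim : noise_moment F 2 u @[u --> +oo] --> K)
  (hkappa : 0 < kappa)
  (hK4_K2 : forall u : R, 0 < u ->
    noise_moment F 4 u / noise_moment F 2 u <= kappa)
  (hB : Hadamard_fBm alpha B) :
  cvg_fdd P P' (shot_noise alpha lambda K T X) B.
Proof.
have [M2 hM2] := hK2_bounded; have [M4 hM4] := hK4_bounded.
(* A single bound for both moments, at least 1 as [err] requires. *)
pose M := 1 + `|M2| + `|M4|.
have n2 := normr_ge0 M2; have n4 := normr_ge0 M4.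
have l2 := ler_norm M2; have l4 := ler_norm M4.
have M1 : 1 <= M by rewrite /M; lra.
have hK2 u : 0 < u -> noise_moment F 2 u <= M.
  by move=> /hM2 h; rewrite /M; lra.
have hK4 u : 0 < u -> noise_moment F 4 u <= M.
  by move=> /hM4 h; rewrite /M; lra.
have [N [mN N0 NT]] := ae_arrival_times hlambda hT.
have hN w : ~ N w -> (forall j, 0 < T j w) /\
    forall x : R, exists n, forall j, (n <= j)%N -> x < T j w.
  by move=> Nw; apply: contrapT => h; apply: Nw; exact: NT.
move=> n t t0 f cf fb.
exact: (cvg_shot_noise_vector halpha hlambda hT hX hfin hK1 M1 hK2 hK4 hK hK2_lim hB
  mN N0 hN t0 cf fb).
Qed.
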